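(* For every integer $n\geq 2$ we have \[A_{\mathrm{Lag}}(B^{2n},\omega_0)\geq\frac{\pi}{2},\] \[A^d_{\mathrm{coiso}}(B^{2n},\omega_0)\geq\frac{\pi}{3},\quad\forall d\in\{n+1,\ldots,2n-3\},\] where $B^{2n}\subseteq\mathbb{R}^{2n}$ is the open ball of radius $1$ around $0$ and $\omega_0$ is the standard symplectic form.
   Context: $\mathbb{D}\subseteq\mathbb{R}^2$ is the closed unit disk, $S^1=\partial\mathbb{D}$, and $\omega_0=\sum_{i=1}^n dq_i\wedge dp_i$. ''Closed'' for a submanifold means compact and without boundary. A symplectic manifold $(M,\omega)$ is (symplectically) aspherical iff $\int_{S^2}u^*\omega=0$ for every $u\in C^\infty(S^2,M)$. Let $(M,\omega)$ be a symplectic manifold. A submanifold $N\subseteq M$ is coisotropic iff for every $x\in N$ the subspace $T_xN^\omega=\{v\in T_xM\mid\omega(v,w)=0\ \forall w\in T_xN\}$ is contained in $T_xN$. For a coisotropic submanifold $N$, the isotropy relation on $N$ is \[R^{N,\omega}:=\big\{(x(0),x(1))\,\big|\,x\in C^\infty([0,1],N),\ \dot x(t)\in(T_{x(t)}N)^\omega\ \forall t\big\}\subseteq N\times N.\] It is an equivalence relation; the equivalence class of $x_0\in N$ is called the isotropic leaf of $N$ through $x_0$. $N$ is called regular iff $R^{N,\omega}$ is a closed subset and a submanifold of $N\times N$. The (symplectic) area spectrum and the minimal (symplectic) area of $N$ are \[S(M,\omega,N):=\Big\{\int_{\mathbb{D}}u^*\omega\,\Big|\,u\in C^\infty(\mathbb{D},M):\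 \exists\text{ isotropic leaf }F\text{ of }N:\ u(S^1)\subseteq F\Big\},\] \[A(M,\omega,N):=\inf\big(S(M,\omega,N)\cap(0,\infty)\big)\in[0,\infty],\] with the convention $\inf\emptyset=\infty$. For $d\in\{n,\ldots,2n-1\}$ the $d$-th regular coisotropic capacity assigns to each aspherical symplectic manifold $(M,\omega)$ of dimension $2n$ the number \[A^d_{\mathrm{coiso}}(M,\omega):=\sup_N A(M,\omega,N)\in[0,\infty],\] where $N\subseteq M$ runs over all non-empty closed regular coisotropic submanifolds of dimension $d$ satisfying: for every isotropic leaf $F$ of $N$ and every continuous loop $x\in C(S^1,F)$, $x$ is contractible in $M$. One abbreviates $A_{\mathrm{Lag}}:=A^n_{\mathrm{coiso}}$. *)

(* Defs.v *)
From HB Require Import structures.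
From mathcomp Require Import all_boot all_order all_algebra.
From mathcomp Require Import all_classical all_reals all_analysis.

Set Implicit Arguments.
Unset Strict Implicit.
Unset Printing Implicit Defensive.
Import Order.TTheory GRing.Theory Num.Theory.
Import numFieldNormedType.Exports.

Local Open Scope ring_scope.
Local Open Scope classical_set_scope.

(* The MathComp-Analysis norms on 'rV[R]_m and R * R are sup norms.  They are
   used below for the topology and the differential calculus only; the disk,
   the circle and the ball are defined with sums of squares. *)

Section Smooth.
Context {R : realType}.

(* f is of class C^k on the open set O.  All spaces used below have finite
   dimension, so that this agrees with continuity of all partial derivatives
   of order at most k. *)
Fixpoint Ck_on {E F : normedModType R} (k : nat) (O : set E) (f : E -> F) :
    Prop :=
  if k is k'.+1 then
    (forall x, O x -> differentiable f x) /\
    (forall v, Ck_on k' O ('D_v f))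
  else forall x, O x -> {for x, continuous f}.

Definition smooth_on {E F : normedModType R} (O : set E) (f : E -> F) : Prop :=
  forall k, Ck_on k O f.

(* C^oo maps on a set K that need not be open: f represents its restriction to
   K, and is required to be smooth on some open neighbourhood of K. *)
Definition smooth_near {E F : normedModType R} (K : set E) (f : E -> F) :
    Prop :=
  exists O : set E, [/\ open O, K `<=` O & smooth_on O f].

(* X is a (boundaryless, embedded) smooth k-dimensional submanifold of E: around
   each point of X there is a smooth slice chart phi : O -> W, with inverse psi,
   taking X to R^k x {0} in R^k x R^c; c is necessarily the codimension. *)
Definition submanifold {E : normedModType R} (k : nat) (X : set E) : Prop :=
  forall x, X x ->
  exists (c : nat) (O : set E) (W : set ('rV[R]_k * 'rV[R]_c))
         (phi : E -> 'rV[R]_k * 'rV[R]_c) (psi : 'rV[R]_k * 'rV[R]_c -> E),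
    [/\ open O, open W & O x] /\
    [/\ smooth_on O phi, smooth_on W psi,
        phi @` O = W,
        forall y, O y -> psi (phi y) = y &
        phi @` (O `&` X) = W `&` [set z | z.2 = 0]].

(* T_x X, as the set of velocities at x of smooth curves in X. *)
Definition tangent_space {E : normedModType R} (X : set E) (x : E) : set E :=
  [set v | exists (e : R) (gamma : R -> E),
    [/\ 0 < e, smooth_on `]- e, e[ gamma,
        (forall t, t \in `]- e, e[ -> X (gamma t)),
        gamma 0 = x & gamma^`() 0 = v]].

Definition disk : set (R * R) := [set z | z.1 ^+ 2 + z.2 ^+ 2 <= 1].

Definition circle : set (R * R) := [set z | z.1 ^+ 2 + z.2 ^+ 2 = 1].

(* The loop x|circle is freely homotopic in M to a constant loop. *)
Definition contractible_loop {E : normedModType R} (M : set E)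
    (x : R * R -> E) : Prop :=
  exists (h : R * (R * R) -> E) (p : E),
    [/\ {within `[0, 1] `*` circle, continuous h},
        h @` (`[0, 1] `*` circle) `<=` M,
        forall z, circle z -> h (0, z) = x z &
        forall z, circle z -> h (1, z) = p].

End Smooth.

(* Throughout, the symplectic manifold is an open subset M of R^(2n) with
   omega0; it is aspherical since omega0 is exact.  A submanifold of M is a
   submanifold of R^(2n) contained in M, and T_x M is all of R^(2n). *)
Section Symplectic.
Context {R : realType} {n : nat}.
Local Notation V := 'rV[R]_(n + n).

(* The sum of dq_i /\ dp_i, where v = (q, p) with q = lsubmx v, p = rsubmx v. *)
Definition omega0 (v w : V) : R :=
  \sum_(i < n) (lsubmx v 0 i * rsubmx w 0 i - rsubmx v 0 i * lsubmx w 0 i).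

Definition symp_orth (T : set V) : set V :=
  [set v | forall w, T w -> omega0 v w = 0].

Definition coisotropic (N : set V) : Prop :=
  forall x, N x -> symp_orth (tangent_space N x) `<=` tangent_space N x.

Definition isotropy_relation (N : set V) : set (V * V) :=
  [set p | exists x : R -> V,
    [/\ smooth_near (`[0, 1] : set R) x,
        forall t, t \in `[0, 1] ->
          N (x t) /\ symp_orth (tangent_space N (x t)) (x^`() t),
        x 0 = p.1 & x 1 = p.2]].

Definition isotropic_leaf (N : set V) (F : set V) : Prop :=
  exists2 x0, N x0 & F = [set y | isotropy_relation N (x0, y)].

Definition regular_coisotropic (N : set V) : Prop :=
  closed (isotropy_relation N : set (subspace (N `*` N))) /\
  exists k, submanifold k (isotropy_relation N).

(* The integral of u^* omega0 over the disk. *)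
Definition symp_area (u : R * R -> V) : R :=
  \int[(@lebesgue_measure R \x @lebesgue_measure R)%E]_(z in disk)
    omega0 ('D_(1, 0) u z) ('D_(0, 1) u z).

Definition area_spectrum (M N : set V) : set R :=
  [set a | exists u : R * R -> V,
    [/\ smooth_near disk u,
        u @` disk `<=` M,
        exists2 F, isotropic_leaf N F & u @` circle `<=` F &
        a = symp_area u]].

(* ereal_inf set0 = +oo *)
Definition minimal_area (M N : set V) : \bar R :=
  ereal_inf (EFin @` (area_spectrum M N `&` [set a | 0 < a])).

Definition admissible_coisotropic (d : nat) (M N : set V) : Prop :=
  [/\ N !=set0, N `<=` M, compact N & submanifold d N] /\
  [/\ coisotropic N, regular_coisotropic N &
      forall (F : set V) (x : R * R -> V), isotropic_leaf N F ->
        {within circle, continuous x} -> x @` circle `<=` F ->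
        contractible_loop M x].

(* A supremum in [0, +oo]: 0 is adjoined because ereal_sup set0 = -oo. *)
Definition coiso_capacity (d : nat) (M : set V) : \bar R :=
  ereal_sup (0%E |` (minimal_area M @` admissible_coisotropic d M)).

Definition Lag_capacity (M : set V) : \bar R := coiso_capacity n M.

Definition unit_ball : set V := [set v | \sum_(i < n + n) v 0 i ^+ 2 < 1].

End Symplectic.
Arguments unit_ball : clear implicits.

(* Main.v *)
Require Import Defs.
From HB Require Import structures.
From mathcomp Require Import all_boot all_order all_algebra.
From mathcomp Require Import all_classical all_reals all_analysis.
From mathcomp Require Import measurable_realfun ring lra zify.

(* Write C^n = R^2n with z = q + ip.  The Lagrangian L_k(a) = {e^{it} x : x in
   R^k, |x| = a} has minimal action pi a^2 / 2: the squared phase e^{2it} is a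
   well-defined function sum_j z_j^2 / a^2 on it, and q dp - p dq restricts to
   a^2 / 2 times its angle form.  This gives the Lagrangian bound as a -> 1.
   For d = 2n - c with 3 <= c <= n - 1 take k = c - 1, m = n - k and
   N = L_k(a) x S^{2m-1}(b) with a^2 = 2 r / 3, b^2 = r / 3 and r -> 1: its
   isotropic leaves are L_k(a) x (Hopf circle), and since a^2 / 2 = b^2 both
   factors have actions in (pi r / 3) Z.
   By Green's theorem the area of a disk with boundary in a leaf is half the
   integral of q dp - p dq over the boundary loop, hence kappa pi times the
   winding number of an S^1-valued loop. *)

Set Implicit Arguments.
Unset Strict Implicit.
Unset Printing Implicit Defensive.
Import Order.TTheory GRing.Theory Num.Theory.
Import numFieldNormedType.Exports.

Local Open Scope ring_scope.
Local Open Scope classical_set_scope.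

(** * Smooth maps *)

(** The area of a disk with boundary in a leaf of the product is an integer multiple of pi a^2 / 2
    plus an integer multiple of pi b^2. Positivity bounds such a sum below only through a common
    divisor of the two numbers, so they are made equal; with a^2 + b^2 = r this leaves the values 2
    r / 3 and r / 3. The parameter r stays below 1 because a compact subset of the open ball avoids
    the unit sphere, and the supremum in the capacity absorbs the limit. Regularity concerns the
    isotropy relation itself, so it is computed exactly in each factor: any two points of [lagr a]
    are related, its tangent spaces being Lagrangian and the set path connected, while two points of
    the sphere are related iff they differ by a unit complex scalar. The S^1-valued functions on the
    leaves have explicit global formulas, so integrality of the winding number comes from
    differentiating along the boundary loop, without lifting angles. *)

Section Calculus.
Context {R : realType}.
Implicit Types (E F G : normedModType R) (k : nat).

Lemma near_eq_differentiable E F (f g : E -> F) (x : E) :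
  {near x, f =1 g} -> differentiable f x -> differentiable g x.
Proof.
move=> fg df; have [cdf dfx] := (diff_locallyP _ _).1 df.
suff H : g \o shift x = cst (g x) + 'd f x +o_ 0 id.
  have e : 'd g x = 'd f x :> (E -> F) by apply: diff_unique.
  by apply/diff_locallyP; rewrite e.
apply/eqaddoP => _/posnumP[e].
have gx : g x = f x by rewrite (nbhs_singleton fg).
move/eqaddoP: dfx => /(_ _ (gt0 e)) dfx.
have fg' : \forall h \near (0 : E), f (h + x) = g (h + x).
  by move: fg; rewrite (near_shift 0 x); apply: filterS => h /=; rewrite subr0.
apply: filterS2 fg' dfx => h e1.
by rewrite !fctE /= -e1 gx.
Qed.

(** Kept as a predicate on bare functions, so that projections, coordinates and lambda terms qualify
    directly. *)
Definition clinear E F (f : E -> F) := linear f /\ continuous f.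

Lemma clinear_diff E F (f : E -> F) x : clinear f ->
  differentiable f x /\ 'd f x = f :> (E -> F).
Proof.
move=> [lf cf].
pose fM := GRing.isLinear.Build _ _ _ _ f lf.
pose fL : {linear _ -> _} := HB.pack f fM.
split; first exact: (@linear_differentiable _ _ _ fL).
exact: (@diff_lin _ _ _ fL).
Qed.

Lemma clinear_derive E F (f : E -> F) x v : clinear f -> 'D_v f x = f v.
Proof. by move=> /(clinear_diff x)[df e]; rewrite deriveE // e. Qed.

Lemma clinear_comp E F G (f : E -> F) (g : F -> G) :
  clinear f -> clinear g -> clinear (g \o f).
Proof.
move=> [lf cf] [lg cg]; split; first by move=> a x y /=; rewrite lf lg.
by move=> x; apply: continuous_comp; [exact: cf|exact: cg].
Qed.

Lemma clinear_id E : clinear (@id E).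
Proof. by split=> [a x y //|x]; exact: cvg_id. Qed.

Lemma clinear_fst E F : clinear (@fst E F).
Proof. by split=> [a [? ?] [? ?] //|x]; exact: cvg_fst. Qed.

Lemma clinear_snd E F : clinear (@snd E F).
Proof. by split=> [a [? ?] [? ?] //|x]; exact: cvg_snd. Qed.

Lemma clinear_pair E F G (f : E -> F) (g : E -> G) :
  clinear f -> clinear g -> clinear (fun x => (f x, g x)).
Proof.
move=> [lf cf] [lg cg]; split; first by move=> a x y /=; rewrite lf lg.
by move=> x; apply: cvg_pair; [exact: cf|exact: cg].
Qed.

Lemma clinear_coord m n (i : 'I_m) (j : 'I_n) :
  clinear (fun M : 'M[R]_(m, n) => M i j).
Proof.
by split; [move=> a x y; rewrite !mxE|exact: coord_continuous].
Qed.

Lemma clinear_scale E (v : E) : clinear (fun a : R => a *: v).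
Proof.
split; first by move=> a x y; rewrite scalerDl scalerA.
exact: scalel_continuous.
Qed.

(** Finite dimension, in the form the chain rule uses: the derivative of a composite becomes a
    finite sum of products of scalar functions. *)
Definition has_coords F := exists (m : nat) (e : 'I_m -> F) (c : 'I_m -> F -> R),
  (forall i, clinear (c i)) /\ (forall v, v = \sum_i c i v *: e i).

Lemma has_coords_R : has_coords R.
Proof.
exists 1%N, (fun=> 1), (fun=> id); split => [_|v]; first exact: clinear_id.
by rewrite big_ord1 [_ *: _]mulr1.
Qed.

Lemma has_coords_rV m : has_coords 'rV[R]_m.
Proof.
exists m, (fun i => delta_mx 0 i), (fun i (v : 'rV[R]_m) => v 0 i); split => [i|v].
  exact: clinear_coord.
exact: row_sum_delta.
Qed.

Lemma has_coords_pair F G : has_coords F -> has_coords G -> has_coords (F * G)%type.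
Proof.
move=> [m [e [c [cl ce]]]] [m' [e' [c' [cl' ce']]]].
exists (m + m')%N,
  (fun i : 'I_(m + m') => match fintype.split i with inl j => (e j, 0) | inr j => (0, e' j) end),
  (fun (i : 'I_(m + m')) (v : F * G) => match fintype.split i with inl j => c j v.1 | inr j => c' j v.2 end).
split => [i|[v w]].
  case: (fintype.split i) => j.
    by apply: (clinear_comp (f := fst)) => //; exact: clinear_fst.
  by apply: (clinear_comp (f := snd)) => //; exact: clinear_snd.
rewrite big_split_ord /=.
under eq_bigr => i _ do rewrite (unsplitK (inl i)).
under [X in _ + X]eq_bigr => i _ do rewrite (unsplitK (inr i)).
rewrite [in LHS](ce v) [in LHS](ce' w).
have H1 : \sum_(i < m) c i v *: (e i, 0 : G) = (\sum_(i < m) c i v *: e i, 0).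
  elim/big_ind2: _ => //= [x1 x2 y1 y2 -> ->|i _]; first by congr pair; rewrite addr0.
  by congr pair; rewrite scaler0.
have H2 : \sum_(i < m') c' i w *: (0 : F, e' i) = (0, \sum_(i < m') c' i w *: e' i).
  elim/big_ind2: _ => //= [x1 x2 y1 y2 -> ->|i _]; first by congr pair; rewrite addr0.
  by congr pair; rewrite scaler0.
by rewrite H1 H2; congr pair; rewrite ?addr0 ?add0r.
Qed.

Lemma Ck_on_continuous E F k O (f : E -> F) : Ck_on k O f ->
  forall x, O x -> {for x, continuous f}.
Proof.
by case: k => //= k [df _] x Ox; apply: differentiable_continuous; exact: df.
Qed.

Lemma Ck_onW E F k O (f : E -> F) : Ck_on k.+1 O f -> Ck_on k O f.
Proof.
elim: k f => [|k IH] f; first exact: (@Ck_on_continuous _ _ 1).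
by move=> [df Hf]; split => // v; apply: IH; exact: Hf.
Qed.

Lemma Ck_on_subset E F k (O O' : set E) (f : E -> F) : O' `<=` O ->
  Ck_on k O f -> Ck_on k O' f.
Proof.
move=> OO'; elim: k f => [|k IH] f /=; first by move=> H x /OO'; exact: H.
by move=> [df Hf]; split => [x /OO'|v]; [exact: df|apply: IH; exact: Hf].
Qed.

(** [Ck_on] speaks of the total function ['D_v f], while formulas for derivatives hold only on O.
    Openness of O lets such a formula replace the derivative at every order. *)
Lemma Ck_on_eq E F k (O : set E) (f g : E -> F) : open O ->
  (forall x, O x -> f x = g x) -> Ck_on k O f -> Ck_on k O g.
Proof.
move=> oO; have nearO (h h' : E -> F) x : (forall y, O y -> h y = h' y) ->
    O x -> {near x, h =1 h'}.
  by move=> hh' Ox; have := open_nbhs_nbhs (conj oO Ox); apply: filterS.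
elim: k f g => [|k IH] f g fg /=.
  move=> cf x Ox; have ng := nearO _ _ _ fg Ox.
  rewrite /prop_for /continuous_at -(fg _ Ox).
  by apply: cvg_trans (cf x Ox); exact: near_eq_cvg.
move=> [df Hf]; split => [x Ox|v].
  by apply: near_eq_differentiable (df x Ox); exact: nearO.
by apply: (IH ('D_v f)) => // x Ox; apply: near_eq_derive; exact: nearO.
Qed.

Lemma Ck_on_cst E F k (O : set E) (c : F) : Ck_on k O (fun=> c).
Proof.
elim: k c => [|k IH] c /=; first by move=> x _; exact: cst_continuous.
split => [x _|v]; first exact: differentiable_cst.
rewrite (_ : 'D_v _ = fun=> 0) //; apply/funext => x; exact: derive_cst.
Qed.

Lemma Ck_on_clinear E F k (O : set E) (f : E -> F) : clinear f -> Ck_on k O f.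
Proof.
move=> lf; case: k => [|k] /=; first by move=> x _; exact: lf.2.
split => [x _|v]; first exact: (clinear_diff x lf).1.
rewrite (_ : 'D_v _ = fun=> f v); first exact: Ck_on_cst.
by apply/funext => x; exact: clinear_derive.
Qed.

Lemma Ck_onD E F k (O : set E) (f g : E -> F) : open O ->
  Ck_on k O f -> Ck_on k O g -> Ck_on k O (fun x => f x + g x).
Proof.
move=> oO; elim: k f g => [|k IH] f g /=.
  by move=> cf cg x Ox; apply: cvgD; [exact: cf|exact: cg].
move=> [df Hf] [dg Hg]; split => [x Ox|v].
  by apply: differentiableD; [exact: df|exact: dg].
apply: (@Ck_on_eq _ _ _ _ (fun x => 'D_v f x + 'D_v g x)) => // [x Ox|].
  by rewrite deriveD //; apply: diff_derivable; [exact: df|exact: dg].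
exact: IH.
Qed.

Lemma Ck_onM E k (O : set E) (f g : E -> R) : open O ->
  Ck_on k O f -> Ck_on k O g -> Ck_on k O (fun x => f x * g x).
Proof.
move=> oO; elim: k f g => [|k IH] f g.
  by move=> /= cf cg x Ox; apply: cvgM; [exact: cf|exact: cg].
move=> Cf Cg; have [df Hf] := Cf; have [dg Hg] := Cg.
split => [x Ox|v].
  by apply: differentiableM; [exact: df|exact: dg].
apply: (@Ck_on_eq _ _ _ _ (fun x => f x * 'D_v g x + g x * 'D_v f x)) => // [x Ox|].
  by rewrite deriveM //; apply: diff_derivable; [exact: df|exact: dg].
by apply: Ck_onD => //; apply: IH; [exact: (Ck_onW Cf)|exact: Hg|exact: (Ck_onW Cg)|exact: Hf].
Qed.

Lemma derive_post E F G (f : E -> F) (L : F -> G) x v : clinear L ->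
  differentiable f x -> 'D_v (L \o f) x = L ('D_v f x).
Proof.
move=> lL df; have [dL eL] := clinear_diff (f x) lL.
by rewrite (deriveE _ (differentiable_comp df dL)) (diff_comp df dL) /= eL (deriveE _ df).
Qed.

Lemma Ck_on_post E F G k (O : set E) (f : E -> F) (L : F -> G) : open O ->
  clinear L -> Ck_on k O f -> Ck_on k O (L \o f).
Proof.
move=> oO lL; elim: k f => [|k IH] f /=.
  move=> cf x Ox; apply: continuous_comp; first exact: cf.
  by have [_ ] := lL; apply.
move=> [df Hf]; split => [x Ox|v].
  by apply: differentiable_comp; [exact: df|exact: (clinear_diff _ lL).1].
apply: (@Ck_on_eq _ _ _ _ (L \o 'D_v f)) => // [x Ox|]; last exact: IH.
by rewrite derive_post //; exact: df.
Qed.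

Lemma Ck_on_sum E F k (O : set E) (I : Type) (r : seq I) (P : pred I)
    (f : I -> E -> F) : open O ->
  (forall i, Ck_on k O (f i)) -> Ck_on k O (fun x => \sum_(i <- r | P i) f i x).
Proof.
move=> oO Hf; elim: r => [|i r IH].
  by under eq_fun do rewrite big_nil; exact: Ck_on_cst.
under eq_fun do rewrite big_cons; case: (P i) => //.
exact: Ck_onD.
Qed.

Lemma Ck_on_coords E F k (O : set E) (f : E -> F) m (e : 'I_m -> F)
    (c : 'I_m -> F -> R) : open O -> (forall v, v = \sum_i c i v *: e i) ->
  (forall i, Ck_on k O (c i \o f)) -> Ck_on k O f.
Proof.
move=> oO ce H; rewrite (_ : f = fun x => \sum_i c i (f x) *: e i); last first.
  by apply/funext => x; exact: ce.
apply: Ck_on_sum => // i.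
by apply: (Ck_on_post (L := fun a => a *: e i) (f := c i \o f)) => //; exact: clinear_scale.
Qed.

Lemma Ck_on_rV E k m (O : set E) (f : E -> 'rV[R]_m) : open O ->
  (forall i, Ck_on k O (fun x => f x 0 i)) -> Ck_on k O f.
Proof.
move=> oO H.
exact: (Ck_on_coords (e := fun i => delta_mx 0 i) (c := fun i (v : 'rV[R]_m) => v 0 i) oO
  (fun v => row_sum_delta v)).
Qed.

(** In coordinates of F, the derivative of g o f along v is the sum of c_i (D_v f) times (D_(e_i) g)
    o f; the first factor is C^k by hypothesis, the second by induction. *)
Lemma Ck_on_comp E F G k (O : set E) (O' : set F) (f : E -> F) (g : F -> G) :
  has_coords F -> has_coords G -> open O -> open O' ->
  (forall x, O x -> O' (f x)) -> Ck_on k O f -> Ck_on k O' g ->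
  Ck_on k O (g \o f).
Proof.
move=> [m [e [c [cl ce]]]] [m' [e' [c' [cl' ce']]]] oO oO' fO Cf Cg.
apply: (Ck_on_coords oO ce') => i.
have {Cg} : Ck_on k O' (c' i \o g) by apply: Ck_on_post.
rewrite -[c' i \o (g \o f)]/((c' i \o g) \o f).
(* The scalar outer function is generalised, since the induction hypothesis is applied to its
   partial derivatives. *)
move: (c' i \o g) => {i g cl' ce' c' e'} g.
elim: k f fO Cf g => [|k IH] f fO Cf g Cg.
  move=> x Ox; apply: continuous_comp; first exact: Cf.
  by apply: Cg; exact: fO.
have [df Hf] := Cf; have [dg Hg] := Cg.
split => [x Ox|v].
  by apply: differentiable_comp; [exact: df|apply: dg; exact: fO].
apply: (@Ck_on_eq _ _ _ _ (fun x => \sum_i c i ('D_v f x) * ('D_(e i) g \o f) x)) => //.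
  move=> x Ox; have dgx := dg _ (fO _ Ox); have dfx := df _ Ox.
  rewrite [RHS](deriveE _ (differentiable_comp dfx dgx)) (diff_comp dfx dgx) /=.
  rewrite -(deriveE _ dfx) [in RHS](ce ('D_v f x)) linear_sum.
  by apply: eq_bigr => i _; rewrite linearZ /= -(deriveE _ dgx).
apply: Ck_on_sum => // i; apply: Ck_onM => //.
  exact: (Ck_on_post oO (cl i) (Hf v)).
by apply: IH => //; [exact: Ck_onW|exact: Hg].
Qed.

(** The bootstrapping step for inverse, square root, cosine and sine, whose derivatives are
    expressed through the same functions. *)
Lemma Ck_on_derive1 k (O : set R) (f f' : R -> R) : open O ->
  (forall x, O x -> is_derive x 1 f (f' x)) -> Ck_on k O f' -> Ck_on k.+1 O f.
Proof.
move=> oO Hf Cf'.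
have df x : O x -> differentiable f x.
  by move=> Ox; apply/derivable1_diffP; have [] := Hf x Ox.
split => // v.
apply: (@Ck_on_eq _ _ _ _ (fun x => v * f' x)) => // [x Ox|]; last first.
  by apply: Ck_onM => //; exact: Ck_on_cst.
have dfx := df x Ox; rewrite (deriveE _ dfx) (diff1E dfx) derive1E.
by have [_ ->] := Hf x Ox.
Qed.

End Calculus.

Section SmoothFunctions.
Context {R : realType}.
Implicit Types (E F G : normedModType R) (k : nat).

Lemma Ck_on_inv k : Ck_on k [set x : R | x != 0] (fun x => x^-1).
Proof.
have oN0 : open [set x : R | x != 0] := @open_neq _ 0.
elim: k => [|k IH]; first by move=> x /= x0; exact: inv_continuous.
apply: (@Ck_on_derive1 _ _ _ _ (fun x => - (x^-1 * x^-1))) => // [x /= x0|].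
  apply: is_derive_eq; first by apply: is_deriveV.
  by rewrite /= -[_ *: _]/(_ * _) mulr1 expr2 invfM.
apply: (Ck_on_eq (f := fun x : R => -1 * (x^-1 * x^-1) : R)) => // [x _|].
  by rewrite mulN1r.
by apply: Ck_onM => //; [exact: Ck_on_cst|exact: Ck_onM].
Qed.

Lemma Ck_on_sqrt k : Ck_on k [set x : R | 0 < x] Num.sqrt.
Proof.
have oP : open [set x : R | 0 < x] := @open_gt _ 0.
elim: k => [|k IH]; first by move=> x _; exact: sqrt_continuous.
apply: (@Ck_on_derive1 _ _ _ _ (fun x => (2 * Num.sqrt x)^-1)) => //.
apply: (@Ck_on_comp _ _ _ _ _ _ [set x | x != 0] (fun x => 2 * Num.sqrt x) (fun x => x^-1)).
- exact: has_coords_R.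
- exact: has_coords_R.
- by [].
- exact: (@open_neq _ 0).
- by move=> x /= x0; rewrite mulf_neq0// gt_eqF// sqrtr_gt0.
- by apply: Ck_onM => //; exact: Ck_on_cst.
- exact: Ck_on_inv.
Qed.

Lemma Ck_on_cos_sin k : Ck_on k [set: R] cos /\ Ck_on k [set: R] sin.
Proof.
elim: k => [|k [IHc IHs]].
  by split=> x _; [exact: continuous_cos|exact: continuous_sin].
split; last by apply: (@Ck_on_derive1 _ _ _ _ cos) => //; exact: openT.
apply: (@Ck_on_derive1 _ _ _ _ (fun x => - sin x)) => //; first exact: openT.
apply: (Ck_on_eq (f := fun x : R => -1 * sin x : R)) => //; first exact: openT.
  by move=> x _; rewrite mulN1r.
by apply: Ck_onM => //; [exact: openT|exact: Ck_on_cst].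
Qed.

Lemma smooth_on_subset E F (O O' : set E) (f : E -> F) : O' `<=` O ->
  smooth_on O f -> smooth_on O' f.
Proof. by move=> OO' sf k; exact: (Ck_on_subset OO'). Qed.

Lemma smooth_on_cst E F (O : set E) (c : F) : smooth_on O (fun=> c).
Proof. by move=> k; exact: Ck_on_cst. Qed.

Lemma smooth_on_clinear E F (O : set E) (f : E -> F) : clinear f -> smooth_on O f.
Proof. by move=> lf k; exact: Ck_on_clinear. Qed.

Lemma smooth_onD E F (O : set E) (f g : E -> F) : open O ->
  smooth_on O f -> smooth_on O g -> smooth_on O (fun x => f x + g x).
Proof. by move=> oO sf sg k; exact: Ck_onD. Qed.

Lemma smooth_onM E (O : set E) (f g : E -> R) : open O ->
  smooth_on O f -> smooth_on O g -> smooth_on O (fun x => f x * g x).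
Proof. by move=> oO sf sg k; exact: Ck_onM. Qed.

Lemma smooth_on_sum E F (O : set E) (I : Type) (r : seq I) (P : pred I)
    (f : I -> E -> F) : open O ->
  (forall i, smooth_on O (f i)) -> smooth_on O (fun x => \sum_(i <- r | P i) f i x).
Proof. by move=> oO sf k; apply: Ck_on_sum => // i; exact: sf. Qed.

Lemma smooth_on_post E F G (O : set E) (f : E -> F) (L : F -> G) : open O ->
  clinear L -> smooth_on O f -> smooth_on O (fun x => L (f x)).
Proof. by move=> oO lL sf k; exact: Ck_on_post. Qed.

Lemma smooth_onN E F (O : set E) (f : E -> F) : open O ->
  smooth_on O f -> smooth_on O (fun x => - f x).
Proof.
move=> oO; apply: (smooth_on_post (L := -%R)) => //; split => [a x y|].
  by rewrite opprD scalerN.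
exact: opp_continuous.
Qed.

Lemma smooth_onB E F (O : set E) (f g : E -> F) : open O ->
  smooth_on O f -> smooth_on O g -> smooth_on O (fun x => f x - g x).
Proof. by move=> oO sf sg; apply: smooth_onD => //; exact: smooth_onN. Qed.

Lemma smooth_onX E (O : set E) (f : E -> R) n : open O ->
  smooth_on O f -> smooth_on O (fun x => f x ^+ n).
Proof.
move=> oO sf; elim: n => [|n IH].
  by under eq_fun do rewrite expr0; exact: smooth_on_cst.
by under eq_fun do rewrite exprS; exact: smooth_onM.
Qed.

Lemma smooth_on_rV E m (O : set E) (f : E -> 'rV[R]_m) : open O ->
  (forall i, smooth_on O (fun x => f x 0 i)) -> smooth_on O f.
Proof. by move=> oO sf k; apply: Ck_on_rV => // i; exact: sf. Qed.

Lemma smooth_on_pair E F G (O : set E) (f : E -> F) (g : E -> G) : open O ->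
  smooth_on O f -> smooth_on O g -> smooth_on O (fun x => (f x, g x)).
Proof.
move=> oO sf sg.
rewrite (_ : (fun _ => _) = fun x => (f x, 0) + (0, g x)); last first.
  by apply/funext => x; congr pair; rewrite ?addr0 ?add0r.
have lcst (H : normedModType R) : clinear (fun _ : H => 0 : F).
  by split=> [a x y|x]; rewrite ?scaler0 ?addr0//; exact: cvg_cst.
have lcst' (H : normedModType R) : clinear (fun _ : H => 0 : G).
  by split=> [a x y|x]; rewrite ?scaler0 ?addr0//; exact: cvg_cst.
apply: smooth_onD => //.
  by apply: (smooth_on_post (L := fun v => (v, 0))) => //;
    apply: clinear_pair; [exact: clinear_id|exact: lcst'].
by apply: (smooth_on_post (L := fun v => (0, v))) => //;
  apply: clinear_pair; [exact: lcst|exact: clinear_id].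
Qed.

Lemma smooth_on_comp E F G (O : set E) (O' : set F) (f : E -> F) (g : F -> G) :
  has_coords F -> has_coords G -> open O -> open O' ->
  (forall x, O x -> O' (f x)) -> smooth_on O f -> smooth_on O' g ->
  smooth_on O (fun x => g (f x)).
Proof. by move=> cF cG oO oO' fO sf sg k; exact: (Ck_on_comp _ _ _ oO'). Qed.

Lemma smooth_onV E (O : set E) (f : E -> R) : open O ->
  (forall x, O x -> f x != 0) ->
  smooth_on O f -> smooth_on O (fun x => (f x)^-1).
Proof.
move=> oO f0 sf; apply: (smooth_on_comp (F := R) (G := R) (O' := [set x | x != 0])
  (g := fun x : R => x^-1)) => //.
- exact: has_coords_R.
- exact: has_coords_R.
- by move=> k; exact: Ck_on_inv.
Qed.

Lemma smooth_on_sqrt E (O : set E) (f : E -> R) : open O ->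
  (forall x, O x -> 0 < f x) ->
  smooth_on O f -> smooth_on O (fun x => Num.sqrt (f x)).
Proof.
move=> oO f0 sf; apply: (smooth_on_comp (F := R) (G := R) (O' := [set x | 0 < x])
  (g := Num.sqrt)) => //.
- exact: has_coords_R.
- exact: has_coords_R.
- by move=> k; exact: Ck_on_sqrt.
Qed.

Lemma smooth_on_cos E (O : set E) (f : E -> R) : open O ->
  smooth_on O f -> smooth_on O (fun x => cos (f x)).
Proof.
move=> oO sf; apply: (smooth_on_comp (F := R) (G := R) (O' := setT) (g := cos)) => //.
- exact: has_coords_R.
- exact: has_coords_R.
- exact: openT.
- by move=> k; have [] := Ck_on_cos_sin k.
Qed.

Lemma smooth_on_sin E (O : set E) (f : E -> R) : open O ->
  smooth_on O f -> smooth_on O (fun x => sin (f x)).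
Proof.
move=> oO sf; apply: (smooth_on_comp (F := R) (G := R) (O' := setT) (g := sin)) => //.
- exact: has_coords_R.
- exact: has_coords_R.
- exact: openT.
- by move=> k; have [] := Ck_on_cos_sin k.
Qed.

Lemma smooth_on_continuous E F (O : set E) (f : E -> F) : smooth_on O f ->
  forall x, O x -> {for x, continuous f}.
Proof. by move=> /(_ 0%N). Qed.

Lemma smooth_on_differentiable E F (O : set E) (f : E -> F) : smooth_on O f ->
  forall x, O x -> differentiable f x.
Proof. by move=> /(_ 1%N)[]. Qed.

Lemma smooth_on_derive E F (O : set E) (f : E -> F) v : smooth_on O f ->
  smooth_on O ('D_v f).
Proof. by move=> sf k; have [_] := sf k.+1; exact. Qed.

Lemma open_preimage_on E F (O : set E) (O' : set F) (f : E -> F) : open O ->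
  open O' -> (forall x, O x -> {for x, continuous f}) ->
  open (O `&` [set x | O' (f x)]).
Proof.
move=> oO oO' cf; rewrite openE => x [/= Ox O'x].
apply: filterI; first exact: open_nbhs_nbhs.
by apply: (cf x Ox); exact: open_nbhs_nbhs.
Qed.

End SmoothFunctions.

(** * Local diffeomorphisms and submanifolds *)

Section LocalDiffeo.
Context {R : realType}.
Implicit Types (E F G : normedModType R) (k : nat).

(** Equivalence of germs of pairs (E, X) at x and (F, Y) at y. Naming both base points makes such
    equivalences composable. *)
Definition locally_diffeo E F (X : set E) (x : E) (Y : set F) (y : F) : Prop :=
  exists (O : set E) (W : set F) (phi : E -> F) (psi : F -> E),
    [/\ open O, open W, O x & phi x = y] /\
    [/\ smooth_on O phi, smooth_on W psi,
        forall z, O z -> W (phi z) /\ psi (phi z) = z,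
        forall w, W w -> O (psi w) /\ phi (psi w) = w &
        forall z, O z -> X z <-> Y (phi z)].

Lemma locally_diffeo_trans E F G (X : set E) x (Y : set F) y (Z : set G) z :
  has_coords E -> has_coords F -> has_coords G ->
  locally_diffeo X x Y y -> locally_diffeo Y y Z z -> locally_diffeo X x Z z.
Proof.
move=> cE cF cG [ O [W [f [g [[ oO oW Ox fx] [sf sg fO gW XY]]]]]].
move=> [ O' [W' [f' [g' [[ oO' oW' Oy fy] [sf' sg' fO' gW' YZ]]]]]].
have oA : open (O `&` [set x | O' (f x)]).
  by apply: open_preimage_on => //; exact: smooth_on_continuous.
have oB : open (W' `&` [set x | W (g' x)]).
  by apply: open_preimage_on => //; exact: smooth_on_continuous.
exists (O `&` [set x | O' (f x)]), (W' `&` [set x | W (g' x)]), (f' \o f), (g \o g').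
split; first by split => //=; [rewrite fx|rewrite fx fy].
split.
- apply: (smooth_on_comp (O' := O') (g := f')) => // [u []//|].
  by apply: smooth_on_subset sf => u [].
- apply: (smooth_on_comp (O' := W) (g := g)) => // [u []//|].
  by apply: smooth_on_subset sg' => u [].
- move=> u [Ou /= O'u]; have [W1 e1] := fO _ Ou; have [W2 e2] := fO' _ O'u.
  by rewrite /= e2.
- move=> u [Wu /= W'u]; have [W1 e1] := gW' _ Wu; have [W2 e2] := gW _ W'u.
  by rewrite /= e2.
- by move=> u [Ou /= O'u]; rewrite XY // YZ.
Qed.

Lemma locally_diffeo_prod E1 E2 F1 F2 (X1 : set E1) x1 (X2 : set E2) x2
    (Y1 : set F1) y1 (Y2 : set F2) y2 :
  has_coords E1 -> has_coords E2 -> has_coords F1 -> has_coords F2 ->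
  locally_diffeo X1 x1 Y1 y1 -> locally_diffeo X2 x2 Y2 y2 ->
  locally_diffeo (X1 `*` X2) (x1, x2) (Y1 `*` Y2) (y1, y2).
Proof.
move=> cE1 cE2 cF1 cF2 [ O [W [f [g [[ oO oW Ox fx] [sf sg fO gW XY]]]]]].
move=> [ O' [W' [f' [g' [[ oO' oW' Oy fy] [sf' sg' fO' gW' YZ]]]]]].
have oX (E F : normedModType R) (A : set E) (B : set F) :
    open A -> open B -> open (A `*` B).
  move=> oA oB; rewrite openE => -[a b] [/= Aa Bb].
  by exists (A, B) => //; split; exact: open_nbhs_nbhs.
exists (O `*` O'), (W `*` W'), (fun u => (f u.1, f' u.2)),
  (fun u => (g u.1, g' u.2)).
have oOO := oX _ _ _ _ oO oO'; have oWW := oX _ _ _ _ oW oW'.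
split; first by split => //=; rewrite fx fy.
split.
- apply: smooth_on_pair => //.
    apply: (smooth_on_comp (O' := O) (f := fst) (g := f)) => // [[u v] []//|].
    by apply: smooth_on_clinear; exact: clinear_fst.
  apply: (smooth_on_comp (O' := O') (f := snd) (g := f')) => // [[u v] []//|].
  by apply: smooth_on_clinear; exact: clinear_snd.
- apply: smooth_on_pair => //.
    apply: (smooth_on_comp (O' := W) (f := fst) (g := g)) => // [[u v] []//|].
    by apply: smooth_on_clinear; exact: clinear_fst.
  apply: (smooth_on_comp (O' := W') (f := snd) (g := g')) => // [[u v] []//|].
  by apply: smooth_on_clinear; exact: clinear_snd.
- by move=> [u v] [/= Ou Ov]; have [? ->] := fO _ Ou; have [? ->] := fO' _ Ov.
- by move=> [u v] [/= Ou Ov]; have [? ->] := gW _ Ou; have [? ->] := gW' _ Ov.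
- move=> [u v] [/= Ou Ov]; split=> -[/= ? ?].
    by split=> /=; [rewrite -XY|rewrite -YZ].
  by split=> /=; [rewrite XY|rewrite YZ].
Qed.

Lemma locally_diffeo_linear E F (f : E -> F) (g : F -> E) (X : set E) (Y : set F) x :
  clinear f -> clinear g -> cancel f g -> cancel g f ->
  (forall z, X z <-> Y (f z)) -> locally_diffeo X x Y (f x).
Proof.
move=> lf lg fK gK XY; exists setT, setT, f, g.
by do 2![split] => //; do ?[exact: openT|exact: smooth_on_clinear].
Qed.

(** The slice chart condition at a single point, phrased so that it can be transported along
    [locally_diffeo]; the codimension c may depend on the point. *)
Definition submanifold_at E k (X : set E) (x : E) : Prop :=
  exists c y, locally_diffeo X x [set z : 'rV[R]_k * 'rV[R]_c | z.2 = 0] y.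

Lemma submanifoldP E k (X : set E) :
  (forall x, X x -> submanifold_at k X x) -> submanifold k X.
Proof.
move=> H x Xx; have [c [y [ O [W [f [g [[ oO oW Ox fx] [sf sg fO gW XY]]]]]]]] := H x Xx.
exists c, O, W, f, g; split=> //; split=> //.
- apply/seteqP; split=> [_ [u Ou <-]|w Ww]; first by have [] := fO _ Ou.
  by have [? ?] := gW _ Ww; exists (g w).
- by move=> z Oz; have [] := fO _ Oz.
- apply/seteqP; split=> [_ [u [Ou Xu] <-]|w [Ww Yw]].
    by split; [have [] := fO _ Ou|have [+ _] := XY _ Ou; apply].
  have [Ogw e] := gW _ Ww; exists (g w) => //; split => //.
  by have [_] := XY _ Ogw; apply; rewrite e.
Qed.

Lemma submanifold_at_diffeo E F k (X : set E) x (Y : set F) y :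
  has_coords E -> has_coords F ->
  locally_diffeo X x Y y -> submanifold_at k Y y -> submanifold_at k X x.
Proof.
move=> cE cF XY [c [z Yz]]; exists c, z.
apply: (locally_diffeo_trans _ _ _ XY Yz) => //.
by apply: has_coords_pair; exact: has_coords_rV.
Qed.

Lemma clinear_sum E F (I : Type) (r : seq I) (P : pred I) (f : I -> E -> F) :
  (forall i, clinear (f i)) -> clinear (fun x => \sum_(i <- r | P i) f i x).
Proof.
move=> H; elim: r => [|i r IH].
  under eq_fun do rewrite big_nil.
  by split=> [a x y|x]; rewrite ?scaler0 ?addr0//; exact: cvg_cst.
under eq_fun do rewrite big_cons; case: (P i) => //.
have [li ci] := H i; case: IH => lr cr; split=> [a x y|x].
  by rewrite li lr scalerDr addrACA.
by apply: cvgD; [exact: ci|exact: cr].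
Qed.

Lemma clinear_row E m (f : E -> 'rV[R]_m) :
  (forall i, clinear (fun x => f x 0 i)) -> clinear f.
Proof.
move=> H; rewrite (_ : f = fun y => \sum_i f y 0 i *: delta_mx 0 i); last first.
  by apply/funext => y; exact: row_sum_delta.
apply: clinear_sum => i.
by apply: (clinear_comp (f := fun y => f y 0 i) (g := fun a : R => a *: _)) => //;
  exact: clinear_scale.
Qed.

Lemma submanifold_at_prod E F k l (X : set E) x (Y : set F) y :
  has_coords E -> has_coords F -> submanifold_at k X x ->
  submanifold_at l Y y -> submanifold_at (k + l) (X `*` Y) (x, y).
Proof.
move=> cE cF [c [z Xz]] [d [w Yw]].
(* Linear regrouping: tangential coordinates of both factors come first, normal ones second. *)
pose f (u : ('rV[R]_k * 'rV[R]_c) * ('rV[R]_l * 'rV[R]_d)) :=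
  (row_mx u.1.1 u.2.1, row_mx u.1.2 u.2.2).
pose g (u : 'rV[R]_(k + l) * 'rV[R]_(c + d)) :=
  ((lsubmx u.1, lsubmx u.2), (rsubmx u.1, rsubmx u.2)).
exists (c + d)%N, (f (z, w)).
have cp (a b : nat) : has_coords ('rV[R]_a * 'rV[R]_b)%type.
  by apply: has_coords_pair; exact: has_coords_rV.
apply: (locally_diffeo_trans _ _ _ (locally_diffeo_prod cE cF (cp _ _) (cp _ _) Xz Yw)).
- exact: has_coords_pair.
- by apply: has_coords_pair; exact: cp.
- exact: cp.
have lcoord a (H : normedModType R) (h : H -> 'rV[R]_a) i :
    clinear h -> clinear (fun v => h v 0 i).
  move=> lh; apply: (clinear_comp (f := h) (g := fun v : 'rV[R]_a => v 0 i)) => //.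
  exact: clinear_coord.
have l1 (A B : normedModType R) : clinear (fun u : A * B => u.1) by exact: clinear_fst.
have l2 (A B : normedModType R) : clinear (fun u : A * B => u.2) by exact: clinear_snd.
have l11 (A B C D : normedModType R) : clinear (fun u : (A * B) * (C * D) => u.1.1).
  by apply: (clinear_comp (f := fst) (g := fst)).
have l12 (A B C D : normedModType R) : clinear (fun u : (A * B) * (C * D) => u.1.2).
  by apply: (clinear_comp (f := fst) (g := snd)).
have l21 (A B C D : normedModType R) : clinear (fun u : (A * B) * (C * D) => u.2.1).
  by apply: (clinear_comp (f := snd) (g := fst)).
have l22 (A B C D : normedModType R) : clinear (fun u : (A * B) * (C * D) => u.2.2).
  by apply: (clinear_comp (f := snd) (g := snd)).
apply: (locally_diffeo_linear (g := g)).
- apply: clinear_pair; apply: clinear_row => i.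
    under eq_fun do rewrite mxE; case: (fintype.split i) => j; exact: lcoord.
  by under eq_fun do rewrite mxE; case: (fintype.split i) => j; exact: lcoord.
- by apply: clinear_pair; apply: clinear_pair; apply: clinear_row => i;
    under eq_fun do rewrite mxE; exact: lcoord.
- by move=> [[? ?] [? ?]]; rewrite /f /g /= !row_mxKl !row_mxKr.
- by move=> [? ?]; rewrite /f /g /= !hsubmxK.
- move=> [[a b] [a' b']]; split=> /= [[/= -> ->]|/eqP]; first by rewrite row_mx0.
  by rewrite row_mx_eq0 => /andP[/eqP -> /eqP ->].
Qed.

(** The linear model to which all the charts below are reduced. The slice chart only sorts the
    coordinates, those in I becoming the normal ones. *)
Lemma submanifold_at_coord_subspace N (I : {set 'I_N}) k (x : 'rV[R]_N) :
  #|~: I| = k ->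
  submanifold_at k [set y : 'rV[R]_N | forall i, i \in I -> y 0 i = 0] x.
Proof.
move=> <-{k}.
pose f (y : 'rV[R]_N) : 'rV[R]_#|~: I| * 'rV[R]_#|I| :=
  (\row_i y 0 (enum_val i), \row_i y 0 (enum_val i)).
pose g (z : 'rV[R]_#|~: I| * 'rV[R]_#|I|) : 'rV[R]_N :=
  \sum_i z.1 0 i *: delta_mx 0 (enum_val i) + \sum_i z.2 0 i *: delta_mx 0 (enum_val i).
exists #|I|, (f x).
have sumE (A : {set 'I_N}) (c : 'I_#|A| -> R) (i : 'I_#|A|) :
    (\sum_j c j *: delta_mx 0 (enum_val j) : 'rV[R]_N) 0 (enum_val i) = c i.
  rewrite summxE (bigD1 i)//= !mxE !eqxx mulr1 big1 ?addr0// => j ji.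
  by rewrite !mxE eqxx (inj_eq enum_val_inj) eq_sym (negbTE ji) mulr0.
have sum0 (A : {set 'I_N}) (c : 'I_#|A| -> R) j : j \notin A ->
    (\sum_j c j *: delta_mx 0 (enum_val j) : 'rV[R]_N) 0 j = 0.
  move=> jA; rewrite summxE big1// => i _; rewrite !mxE eqxx /=.
  by case: eqP => [e|]; rewrite ?mulr0//; move: jA; rewrite e enum_valP.
apply: (locally_diffeo_linear (g := g)).
- apply: clinear_pair; apply: clinear_row => i; under eq_fun do rewrite mxE;
    exact: clinear_coord.
- have lin m (h : 'rV[R]_#|~: I| * 'rV[R]_#|I| -> 'rV[R]_m)
      (e : 'I_m -> 'rV[R]_N) : clinear h -> clinear (fun z => \sum_i h z 0 i *: e i).
    move=> lh; apply: clinear_sum => i.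
    apply: (clinear_comp (f := h) (g := fun v : 'rV[R]_m => v 0 i *: e i)) => //.
    apply: (clinear_comp (f := fun v : 'rV[R]_m => v 0 i) (g := fun a : R => a *: e i)).
      exact: clinear_coord.
    exact: clinear_scale.
  have [l1 c1] := lin _ fst (fun i => delta_mx 0 (enum_val i)) (@clinear_fst _ _ _).
  have [l2 c2] := lin _ snd (fun i => delta_mx 0 (enum_val i)) (@clinear_snd _ _ _).
  split=> [a u v|u]; first by rewrite /g l1 l2 scalerDr addrACA.
  by apply: cvgD; [exact: c1|exact: c2].
- move=> y; rewrite /g /f /=; under eq_bigr do rewrite mxE.
  under [X in _ + X]eq_bigr do rewrite mxE.
  apply/rowP => j; rewrite mxE; case: (boolP (j \in I)) => jI.
    rewrite sum0 ?inE ?jI// add0r -(enum_rankK_in jI jI).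
    exact: (sumE I (fun i => y 0 (enum_val i))).
  have jC : j \in ~: I by rewrite inE.
  rewrite [X in _ + X]sum0// addr0 -(enum_rankK_in jC jC).
  exact: (sumE (~: I) (fun i => y 0 (enum_val i))).
- move=> [u v]; rewrite /g /f /=; congr pair; apply/rowP => i; rewrite !mxE.
    by rewrite sumE sum0 ?addr0//; have := enum_valP i; rewrite inE.
  by rewrite sumE sum0 ?add0r// inE enum_valP.
- move=> y /=; split=> [yI|/rowP e i iI].
    by apply/rowP => i; rewrite !mxE yI// enum_valP.
  by have := e (enum_rank_in iI i); rewrite !mxE enum_rankK_in.
Qed.

End LocalDiffeo.

(** * Charts of the models *)

Section Models.
Context {R : realType}.
Implicit Types (k m N : nat).

Definition sqn N (y : 'rV[R]_N) : R := \sum_i y 0 i ^+ 2.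

(* The coordinates of z = q + ip. *)
Definition qc k (z : 'rV[R]_(k + k)) (l : 'I_k) : R := z 0 (lshift k l).
Definition pc k (z : 'rV[R]_(k + k)) (l : 'I_k) : R := z 0 (rshift k l).
Definition mkc k (f g : 'I_k -> R) : 'rV[R]_(k + k) := row_mx (\row_l f l) (\row_l g l).

Lemma qcE k (f g : 'I_k -> R) l : qc (mkc f g) l = f l.
Proof. by rewrite /qc /mkc row_mxEl mxE. Qed.

Lemma pcE k (f g : 'I_k -> R) l : pc (mkc f g) l = g l.
Proof. by rewrite /pc /mkc row_mxEr mxE. Qed.

Lemma eq_qp k (z w : 'rV[R]_(k + k)) : qc z =1 qc w -> pc z =1 pc w -> z = w.
Proof.
move=> qq pp; apply/rowP => i; rewrite -[i]splitK.
by case: (fintype.split i) => j /=; [exact: qq|exact: pp].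
Qed.

Lemma sqn_qp k (z : 'rV[R]_(k + k)) : sqn z = \sum_l (qc z l ^+ 2 + pc z l ^+ 2).
Proof. by rewrite /sqn big_split_ord big_split. Qed.

Lemma clinear_qc k l : clinear (fun z : 'rV[R]_(k + k) => qc z l).
Proof. exact: clinear_coord. Qed.

Lemma clinear_pc k l : clinear (fun z : 'rV[R]_(k + k) => pc z l).
Proof. exact: clinear_coord. Qed.

Lemma smooth_on_qc (E : normedModType R) (O : set E) k (f : E -> 'rV[R]_(k + k)) l :
  clinear f -> smooth_on O (fun x => qc (f x) l).
Proof.
move=> lf; apply: smooth_on_clinear; apply: (clinear_comp (f := f) (g := fun z => qc z l)) => //.
exact: clinear_qc.
Qed.

Lemma smooth_on_pc (E : normedModType R) (O : set E) k (f : E -> 'rV[R]_(k + k)) l :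
  clinear f -> smooth_on O (fun x => pc (f x) l).
Proof.
move=> lf; apply: smooth_on_clinear; apply: (clinear_comp (f := f) (g := fun z => pc z l)) => //.
exact: clinear_pc.
Qed.

Lemma smooth_on_row (E : normedModType R) (O : set E) m (f : E -> 'I_m -> R) :
  open O -> (forall l, smooth_on O (f^~ l)) -> smooth_on O (fun x => \row_l f x l).
Proof.
move=> oO sf; apply: smooth_on_rV => // i.
by rewrite (_ : (fun x => _) = f^~ i) //; apply/funext => x; rewrite mxE.
Qed.

Lemma smooth_on_if (E F : normedModType R) (O : set E) (b : bool) (f g : E -> F) :
  smooth_on O f -> smooth_on O g -> smooth_on O (fun x => if b then f x else g x).
Proof. by case: b. Qed.

Lemma smooth_on_mkc (E : normedModType R) (O : set E) k (f g : E -> 'I_k -> R) :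
  open O -> (forall l, smooth_on O (f^~ l)) -> (forall l, smooth_on O (g^~ l)) ->
  smooth_on O (fun x => mkc (f x) (g x)).
Proof.
move=> oO sf sg; apply: smooth_on_rV => // i; rewrite -[i]splitK.
case: (fintype.split i) => j /=.
  by under eq_fun do rewrite row_mxEl mxE; exact: sf.
by under eq_fun do rewrite row_mxEr mxE; exact: sg.
Qed.

Lemma sqn_neq0 N (y : 'rV[R]_N) : sqn y != 0 -> exists i, y 0 i != 0.
Proof.
move=> y0; apply/existsP; rewrite -[X in is_true X]negbK negb_exists.
apply/negP => /forallP yi; move/eqP: y0; apply; apply: big1 => i _.
by have := yi i; rewrite negbK => /eqP ->; rewrite expr0n.
Qed.

(* Replace the coordinate y_i by |y|^2 - c. *)
Lemma submanifold_at_sphere N (J : {set 'I_N}) (i : 'I_N) (c : R) (x : 'rV[R]_N) k :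
  i \notin J -> x 0 i != 0 -> #|~: (i |: J)| = k ->
  submanifold_at k [set y | sqn y = c /\ forall j, j \in J -> y 0 j = 0] x.
Proof.
move=> iJ xi kJ; set X := [set y | _].
pose K := [set y : 'rV[R]_N | forall j, j \in i |: J -> y 0 j = 0].
(* The sign of x_i selects the branch of the square root in the inverse chart. *)
pose e := Num.sg (x 0 i).
have ee : e * e = 1 by rewrite /e -expr2 sqr_sg xi.
pose rest (y : 'rV[R]_N) := \sum_(j | j != i) y 0 j ^+ 2.
have restE y : sqn y = y 0 i ^+ 2 + rest y by rewrite /sqn (bigD1 i).
pose f (y : 'rV[R]_N) : 'rV[R]_N := \row_j if j == i then sqn y - c else y 0 j.
(* The argument of the root recovers the square of the replaced coordinate: |y|^2 minus the squares
   of the others. *)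
pose g (y : 'rV[R]_N) : 'rV[R]_N :=
  \row_j if j == i then e * Num.sqrt (y 0 i + c - rest y) else y 0 j.
pose O := [set y : 'rV[R]_N | 0 < e * y 0 i].
pose W := [set y : 'rV[R]_N | 0 < y 0 i + c - rest y].
have restf y : rest (f y) = rest y.
  by apply: eq_bigr => j /negbTE ji; rewrite mxE ji.
have restg y : rest (g y) = rest y.
  by apply: eq_bigr => j /negbTE ji; rewrite mxE ji.
have scoord (A : set 'rV[R]_N) j : smooth_on A (fun y : 'rV[R]_N => y 0 j).
  by apply: smooth_on_clinear; exact: clinear_coord.
have srest : smooth_on setT rest.
  by apply: smooth_on_sum => [|j]; [exact: openT|apply: smooth_onX => //; exact: openT].
have sarg : smooth_on setT (fun y : 'rV[R]_N => y 0 i + c - rest y).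
  apply: smooth_onB => //; first exact: openT.
  by apply: smooth_onD => //; [exact: openT|exact: smooth_on_cst].
have oO : open O.
  have := open_preimage_on (O := setT) (O' := [set t : R | 0 < t])
    (f := fun y : 'rV[R]_N => e * y 0 i) openT (@open_gt _ 0).
  rewrite setTI; apply => y _.
  apply: (smooth_on_continuous (O := setT)) => //.
  by apply: smooth_onM => //; [exact: openT|exact: smooth_on_cst].
have oW : open W.
  have := open_preimage_on (O := setT) (O' := [set t : R | 0 < t])
    (f := fun y : 'rV[R]_N => y 0 i + c - rest y) openT (@open_gt _ 0).
  rewrite setTI; apply => y _.
  exact: (smooth_on_continuous sarg).
have XK : locally_diffeo X x K (f x).
  exists O, W, f, g; split.
    by split => //; rewrite /O /= /e -normrEsg normr_gt0.
  split.
  - apply: smooth_on_row => // j.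
    apply: smooth_on_if => //; apply: smooth_onB => //; last exact: smooth_on_cst.
    by apply: smooth_on_sum => // l; exact: smooth_onX.
  - apply: smooth_on_row => // j.
    apply: smooth_on_if => //; apply: smooth_onM => //; first exact: smooth_on_cst.
    by apply: smooth_on_sqrt => //; apply: smooth_on_subset sarg.
  - move=> y Oy; have fy : f y 0 i + c - rest (f y) = y 0 i ^+ 2.
      by rewrite restf mxE eqxx restE; ring.
    split; first by rewrite /W /= fy exprn_even_gt0 //=; move: Oy; rewrite /O /=;
      case: eqP => // ->; rewrite mulr0 ltxx.
    apply/rowP => j; rewrite mxE; case: eqP => [->|ji]; last by rewrite mxE; case: eqP.
    rewrite fy sqrtr_sqr -[in RHS](mul1r (y 0 i)) -ee -mulrA; congr (_ * _).
    have ene : `|e| = 1 by rewrite /e normr_sg xi.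
    by rewrite -(ger0_norm (ltW Oy)) normrM ene mul1r.
  - move=> y Wy; have W0 : 0 < Num.sqrt (y 0 i + c - rest y) by rewrite sqrtr_gt0.
    split; first by rewrite /O /= mxE eqxx mulrA ee mul1r.
    apply/rowP => j; rewrite mxE; case: eqP => [->|ji]; last by rewrite mxE; case: eqP.
    rewrite restE restg mxE eqxx exprMn expr2 ee mul1r sqr_sqrtr ?ltW//; ring.
  - move=> y _; split=> [[yc yJ] j|H].
      rewrite in_setU1 mxE; case: eqP => [_ _|_ /= /yJ //].
      by rewrite yc subrr.
    split; first by have := H i (setU11 _ _); rewrite mxE eqxx => /eqP; rewrite subr_eq0 => /eqP.
    move=> j jJ; have := H j; rewrite in_setU1 jJ orbT mxE => /(_ isT).
    by case: eqP => // ji; move: iJ; rewrite -ji jJ.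
apply: (submanifold_at_diffeo _ _ XK); [exact: has_coords_rV|exact: has_coords_rV|].
exact: submanifold_at_coord_subspace.
Qed.

End Models.

(** * The Lagrangian, the sphere and the Hopf relation as submanifolds *)

Section Charts.
Context {R : realType}.
Implicit Types (k m N : nat).

(* {e^{it} x : x in R^k, |x| = a}: the second condition says that all
   z_l conj(z_j) are real. *)
Definition lagr k (a : R) : set 'rV[R]_(k + k) :=
  [set z | sqn z = a ^+ 2 /\ forall l j, pc z l * qc z j = qc z l * pc z j].

Definition sphere N (b : R) : set 'rV[R]_N := [set w | sqn w = b ^+ 2].

(* Pairs of points of the sphere on the same Hopf circle: the last condition is
   w_i w'_l = w_l w'_i in C. *)
Definition hopf k (b : R) : set ('rV[R]_(k + k) * 'rV[R]_(k + k)) :=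
  [set u | [/\ sqn u.1 = b ^+ 2, sqn u.2 = b ^+ 2 &
    forall i l,
      qc u.1 i * qc u.2 l - pc u.1 i * pc u.2 l =
      qc u.1 l * qc u.2 i - pc u.1 l * pc u.2 i /\
      qc u.1 i * pc u.2 l + pc u.1 i * qc u.2 l =
      qc u.1 l * pc u.2 i + pc u.1 l * qc u.2 i]].

(* Multiplication by c + is. *)
Definition crot k (c s : R) (w : 'rV[R]_(k + k)) : 'rV[R]_(k + k) :=
  mkc (fun l => c * qc w l - s * pc w l) (fun l => c * pc w l + s * qc w l).

Lemma sqn_crot k c s (w : 'rV[R]_(k + k)) : sqn (crot c s w) = (c ^+ 2 + s ^+ 2) * sqn w.
Proof.
rewrite !sqn_qp mulr_sumr; apply: eq_bigr => l _.
by rewrite /crot qcE pcE; ring.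
Qed.

(** The scalar c + is is the Hermitian product of w' with w divided by |w|^2 = b^2. Multiplying w_i
    w'_l = w_l w'_i by conj(w_i) and summing over i gives w' = (c + is) w; comparing norms gives |c
    + is| = 1. *)
Lemma hopfP k (b : R) (u : 'rV[R]_(k + k) * 'rV[R]_(k + k)) : b != 0 ->
  hopf b u <-> sqn u.1 = b ^+ 2 /\
    exists c s, c ^+ 2 + s ^+ 2 = 1 /\ u.2 = crot c s u.1.
Proof.
move=> b0; case: u => w w' /=; split; last first.
  move=> [wb [c [s [cs1 ->]]]]; split => //=; first by rewrite sqn_crot cs1 mul1r.
  by move=> i l; rewrite /crot !qcE !pcE; split; ring.
move=> [/= wb wb' ww']; split => //.
pose c := (\sum_l (qc w l * qc w' l + pc w l * pc w' l)) / b ^+ 2.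
pose s := (\sum_l (qc w l * pc w' l - pc w l * qc w' l)) / b ^+ 2.
have bb : b ^+ 2 != 0 by rewrite expf_neq0.
have e : w' = crot c s w.
  apply: eq_qp => l; rewrite /crot ?qcE ?pcE; apply: (mulfI bb).
    rewrite -[in LHS]wb sqn_qp mulrBr mulrA [b ^+ 2 * c]mulrC divfK//.
    rewrite [b ^+ 2 * (s * _)]mulrA [b ^+ 2 * s]mulrC divfK// !mulr_suml -sumrB.
    apply: eq_bigr => i _; have [e1 e2] := ww' i l.
    transitivity (qc w i * (qc w i * qc w' l - pc w i * pc w' l) +
      pc w i * (qc w i * pc w' l + pc w i * qc w' l)); first by ring.
    by rewrite e1 e2 /=; ring.
  rewrite -[in LHS]wb sqn_qp mulrDr mulrA [b ^+ 2 * c]mulrC divfK//.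
  rewrite [b ^+ 2 * (s * _)]mulrA [b ^+ 2 * s]mulrC divfK// !mulr_suml -big_split.
  apply: eq_bigr => i _; have [e1 e2] := ww' i l.
  transitivity (qc w i * (qc w i * pc w' l + pc w i * qc w' l) -
    pc w i * (qc w i * qc w' l - pc w i * pc w' l)); first by ring.
  by rewrite e1 e2 /=; ring.
exists c, s; split => //.
by move: wb'; rewrite e sqn_crot wb => /(canRL (mulfK bb)) ->; rewrite divff.
Qed.

Lemma cardsC_setU1 N (i : 'I_N) (J : {set 'I_N}) : i \notin J ->
  #|~: (i |: J)| = (N - #|J|).-1.
Proof.
by move=> iJ; rewrite cardsCs finset.setCK cardsU1 iJ card_ord add1n subnS.
Qed.

Lemma submanifold_at_sphere0 N (b : R) (x : 'rV[R]_N) : b != 0 ->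
  sphere b x -> submanifold_at N.-1 (sphere b) x.
Proof.
move=> b0 xb; have [i xi] : exists i, x 0 i != 0.
  by apply: sqn_neq0; rewrite xb expf_neq0.
have := @submanifold_at_sphere R N finset.set0 i (b ^+ 2) x N.-1 _ xi.
rewrite (_ : [set y | _] = sphere b); last first.
  by apply/seteqP; split=> y; [case|split=> // j; rewrite inE].
by apply; rewrite ?inE// cardsC_setU1 ?inE// cards0 subn0.
Qed.

Lemma qp_neq0 k (z : 'rV[R]_(k + k)) : sqn z != 0 ->
  exists j, 0 < qc z j ^+ 2 + pc z j ^+ 2.
Proof.
move=> /sqn_neq0[i]; rewrite -[i]splitK; case: (fintype.split i) => j /= zi; exists j.
  by rewrite ltr_pwDl ?sqr_ge0// exprn_even_gt0.
by rewrite ltr_pwDr ?sqr_ge0// exprn_even_gt0.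
Qed.

Lemma open_qp k (j : 'I_k) :
  open [set z : 'rV[R]_(k + k) | 0 < qc z j ^+ 2 + pc z j ^+ 2].
Proof.
have := open_preimage_on (O := setT) (O' := [set t : R | 0 < t])
  (f := fun z : 'rV[R]_(k + k) => qc z j ^+ 2 + pc z j ^+ 2) openT (@open_gt _ 0).
rewrite setTI; apply => y _; apply: (smooth_on_continuous (O := setT)) => //.
have oT : open [set: 'rV[R]_(k + k)] by exact: openT.
apply: smooth_onD => //; apply: smooth_onX => //; apply: smooth_on_clinear.
  exact: clinear_qc.
exact: clinear_pc.
Qed.

(** In real and imaginary parts, with z_j = c + is and t = |z_j|: multiplication by conj(z_j) / t
    and by z_j / t are inverse to each other. *)
Lemma rotation_cancel (t q p c s : R) : t != 0 -> t ^+ 2 = c ^+ 2 + s ^+ 2 ->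
  [/\ ((q * c + p * s) / t * c - (p * c - q * s) / t * s) / t = q,
      ((p * c - q * s) / t * c + (q * c + p * s) / t * s) / t = p,
      ((q * c - p * s) / t * c + (p * c + q * s) / t * s) / t = q &
      ((p * c + q * s) / t * c - (q * c - p * s) / t * s) / t = p].
Proof.
move=> t0 e; have t20 : t ^+ 2 != 0 by rewrite expf_neq0.
(* The relation between t, c and s is built into q and p beforehand, so that what remains are
   identities of rational functions. *)
have qE : q = q * (c ^+ 2 + s ^+ 2) / t ^+ 2 by rewrite -e mulfK.
have pE : p = p * (c ^+ 2 + s ^+ 2) / t ^+ 2 by rewrite -e mulfK.
by split; [rewrite [RHS]qE|rewrite [RHS]pE|rewrite [RHS]qE|rewrite [RHS]pE]; field.
Qed.

(* Near a point with z_j <> 0, the norm-preserving map that multiplies z_l by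
   conj(z_j) / |z_j| for l <> j sends [lagr a] to the intersection of a sphere
   with the coordinate subspace p_l = 0, l <> j. *)
Lemma submanifold_at_lagr k (a : R) (x : 'rV[R]_(k + k)) : a != 0 ->
  lagr a x -> submanifold_at k (lagr a) x.
Proof.
move=> a0 [xa _]; have [j xj] : exists j, 0 < qc x j ^+ 2 + pc x j ^+ 2.
  by apply: qp_neq0; rewrite xa expf_neq0.
pose n2 (z : 'rV[R]_(k + k)) := qc z j ^+ 2 + pc z j ^+ 2.
pose r z := Num.sqrt (n2 z).
pose O := [set z | 0 < n2 z].
have oO : open O by exact: open_qp.
pose f (z : 'rV[R]_(k + k)) : 'rV[R]_(k + k) := mkc
  (fun l => if l == j then qc z l else (qc z l * qc z j + pc z l * pc z j) / r z)
  (fun l => if l == j then pc z l else (pc z l * qc z j - qc z l * pc z j) / r z).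
pose g (z : 'rV[R]_(k + k)) : 'rV[R]_(k + k) := mkc
  (fun l => if l == j then qc z l else (qc z l * qc z j - pc z l * pc z j) / r z)
  (fun l => if l == j then pc z l else (pc z l * qc z j + qc z l * pc z j) / r z).
have sq A l : smooth_on A (fun z : 'rV[R]_(k + k) => qc z l).
  by apply: smooth_on_clinear; exact: clinear_qc.
have sp A l : smooth_on A (fun z : 'rV[R]_(k + k) => pc z l).
  by apply: smooth_on_clinear; exact: clinear_pc.
have sr : smooth_on O (fun z => (r z)^-1).
  apply: smooth_onV => // [z Oz|]; first by rewrite gt_eqF// sqrtr_gt0.
  by apply: smooth_on_sqrt => //; apply: smooth_onD => //; exact: smooth_onX.
have sf : smooth_on O f.
  apply: smooth_on_mkc => // l; apply: smooth_on_if => //; apply: smooth_onM => //.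
    by apply: smooth_onD => //; exact: smooth_onM.
  by apply: smooth_onB => //; exact: smooth_onM.
have sg : smooth_on O g.
  apply: smooth_on_mkc => // l; apply: smooth_on_if => //; apply: smooth_onM => //.
    by apply: smooth_onB => //; exact: smooth_onM.
  by apply: smooth_onD => //; exact: smooth_onM.
have fj z : qc (f z) j = qc z j /\ pc (f z) j = pc z j by rewrite /f qcE pcE eqxx.
have gj z : qc (g z) j = qc z j /\ pc (g z) j = pc z j by rewrite /g qcE pcE eqxx.
have rf z : r (f z) = r z by rewrite /r /n2; have [-> ->] := fj z.
have rg z : r (g z) = r z by rewrite /r /n2; have [-> ->] := gj z.
have r0 z : O z -> r z != 0 by move=> Oz; rewrite gt_eqF// sqrtr_gt0.
have rr z : O z -> r z ^+ 2 = qc z j ^+ 2 + pc z j ^+ 2.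
  by move=> Oz; rewrite sqr_sqrtr// ltW.
have sqf z : O z -> sqn (f z) = sqn z.
  move=> Oz; rewrite !sqn_qp; apply: eq_bigr => l _; rewrite /f qcE pcE.
  case: eqP => // _; have := rr _ Oz; have := r0 _ Oz.
  move: (r z) (qc z l) (pc z l) (qc z j) (pc z j) => t q p c s t0 e.
  transitivity ((q ^+ 2 + p ^+ 2) * (c ^+ 2 + s ^+ 2) / t ^+ 2); first by field.
  by rewrite -e mulfK// expf_neq0.
pose J : {set 'I_(k + k)} := [set rshift k l | l in [set~ j]]%SET.
pose Y := [set y : 'rV[R]_(k + k) | sqn y = a ^+ 2 /\ forall i, i \in J -> y 0 i = 0].
have xX : locally_diffeo (lagr a) x Y (f x).
  exists O, O, f, g; split => //; split => //.
  - move=> z Oz; split; first by rewrite /O /= /n2; have [-> ->] := fj z.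
    apply: eq_qp => l; [rewrite [LHS]qcE|rewrite [LHS]pcE]; rewrite rf; have [-> ->] := fj z;
    case: eqP => [->|/eqP/negbTE lj]; rewrite ?qcE ?pcE ?eqxx ?lj //;
    by have [] := rotation_cancel (qc z l) (pc z l) (r0 _ Oz) (rr _ Oz).
  - move=> z Oz; split; first by rewrite /O /= /n2; have [-> ->] := gj z.
    apply: eq_qp => l; [rewrite [LHS]qcE|rewrite [LHS]pcE]; rewrite rg; have [-> ->] := gj z;
    case: eqP => [->|/eqP/negbTE lj]; rewrite ?qcE ?pcE ?eqxx ?lj //;
    by have [] := rotation_cancel (qc z l) (pc z l) (r0 _ Oz) (rr _ Oz).
  - move=> z Oz; rewrite /Y /lagr /= (sqf z Oz); split=> -[za zJ]; split => //.
      move=> i /imsetP[l]; rewrite !inE => /negbTE lj ->.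
      by rewrite -/(pc (f z) l) pcE lj zJ subrr mul0r.
    have im l : pc z l * qc z j = qc z l * pc z j.
      have [->|lj] := eqVneq l j; first by rewrite mulrC.
      have := zJ (rshift k l); rewrite imset_f ?inE// => /(_ isT).
      rewrite -/(pc (f z) l) pcE (negbTE lj) => /eqP.
      by rewrite mulf_eq0 invr_eq0 (negbTE (r0 _ Oz)) orbF subr_eq0 => /eqP.
    (* From the reality of all z_l conj(z_j) to that of z_l conj(z_i): after multiplication by
       |z_j|^2 the latter is a product of z_l conj(z_j) and the conjugate of z_i conj(z_j). *)
    move=> l i; have n0 : n2 z != 0 by rewrite gt_eqF.
    apply/eqP; rewrite -subr_eq0; apply/eqP; apply: (mulfI n0); rewrite mulr0 /n2.
    have := im l; have := im i.
    move: (qc z i) (pc z i) (qc z l) (pc z l) (qc z j) (pc z j) => q p q' p' c s e1 e2.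
    transitivity (c * (q * (p' * c) - q' * (p * c)) + s * (p' * (q * s) - p * (q' * s))).
      by ring.
    have -> : q * (p' * c) - q' * (p * c) = 0 by rewrite e1 e2; ring.
    have -> : p' * (q * s) - p * (q' * s) = 0 by rewrite -e1 -e2; ring.
    by rewrite !mulr0 addr0.
apply: (submanifold_at_diffeo _ _ xX); [exact: has_coords_rV|exact: has_coords_rV|].
(* The chart keeps z_j, which is nonzero, so q_j or p_j is a nonzero coordinate outside J. *)
have [i iJ fi] : exists2 i, i \notin J & f x 0 i != 0.
  have [e1 e2] := fj x; have [q0|q0] := eqVneq (qc x j) 0.
    exists (rshift k j).
      by apply/imsetP => -[l]; rewrite !inE => lj /rshift_inj jl; move: lj; rewrite jl eqxx.
    rewrite -/(pc (f x) j) e2; apply: contraTneq xj => ->.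
    by rewrite q0 expr0n addr0 ltxx.
  exists (lshift k j); last by rewrite -/(qc (f x) j) e1.
  by apply/imsetP => -[l _] /eqP; rewrite eq_lrshift.
apply: (submanifold_at_sphere (i := i)) => //.
(* Dimension count: 2k coordinates, less k - 1 for J and one for the sphere. *)
rewrite cardsC_setU1// card_imset; last exact: rshift_inj.
by rewrite cardsC1 card_ord; have := ltn_ord j; lia.
Qed.

End Charts.

Section HopfChart.
Context {R : realType}.
Implicit Types (k : nat).

Lemma coord_axis_complement k (j : 'I_k) (v : 'rV[R]_(k + k)) :
  (forall i, i \in ~: [set lshift k j; rshift k j]%SET -> v 0 i = 0) <->
  (forall l, l != j -> qc v l = 0 /\ pc v l = 0).
Proof.
split=> H => [l lj|i].
  split; apply: H; rewrite !inE negb_or.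
    by rewrite eq_lrshift andbT (inj_eq (@lshift_inj _ _)).
  by rewrite eq_rlshift /= (inj_eq (@rshift_inj _ _)).
rewrite !inE negb_or -[i]splitK; case: (fintype.split i) => l /= /andP[].
  by rewrite (inj_eq (@lshift_inj _ _)) => /H[].
by rewrite (inj_eq (@rshift_inj _ _)) => _ /H[].
Qed.

(* Near w_j <> 0, put v_j = w'_j / w_j and v_l = w'_l - v_j w_l for l <> j; then
   [hopf b] becomes sphere x circle in the coordinates (w, v). *)
Lemma submanifold_at_hopf k (b : R) (x : 'rV[R]_(k + k) * 'rV[R]_(k + k)) :
  b != 0 -> hopf b x -> submanifold_at (k + k) (hopf b) x.
Proof.
move=> b0 hx; have [xb [c0 [s0 [cs0 ex2]]]] := (hopfP x b0).1 hx.
have [j xj] : exists j, 0 < qc x.1 j ^+ 2 + pc x.1 j ^+ 2.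
  by apply: qp_neq0; rewrite xb expf_neq0.
pose V := 'rV[R]_(k + k).
pose n2 (z : V) := qc z j ^+ 2 + pc z j ^+ 2.
pose O := [set u : V * V | 0 < n2 u.1].
have oO : open O.
  have := open_preimage_on (O := setT) (f := @fst V V) openT (@open_qp R k j).
  by rewrite setTI; apply => y _; exact: cvg_fst.
pose c (u : V * V) := (qc u.2 j * qc u.1 j + pc u.2 j * pc u.1 j) / n2 u.1.
pose s (u : V * V) := (pc u.2 j * qc u.1 j - qc u.2 j * pc u.1 j) / n2 u.1.
pose v (u : V * V) : V := mkc
  (fun l => if l == j then c u else qc u.2 l - (c u * qc u.1 l - s u * pc u.1 l))
  (fun l => if l == j then s u else pc u.2 l - (c u * pc u.1 l + s u * qc u.1 l)).
(* The inverse of [v]: w'_l = v_l + v_j w_l for l <> j, and w'_j = v_j w_j, so the first summand is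
   0 at l = j. *)
pose w (u : V * V) : V := mkc
  (fun l => (if l == j then 0 else qc u.2 l) + (qc u.2 j * qc u.1 l - pc u.2 j * pc u.1 l))
  (fun l => (if l == j then 0 else pc u.2 l) + (qc u.2 j * pc u.1 l + pc u.2 j * qc u.1 l)).
pose f (u : V * V) := (u.1, v u).
pose g (u : V * V) := (u.1, w u).
have lfst : clinear (@fst V V) by exact: clinear_fst.
have lsnd : clinear (@snd V V) by exact: clinear_snd.
have sq1 A l : smooth_on A (fun u : V * V => qc u.1 l) by exact: smooth_on_qc.
have sq2 A l : smooth_on A (fun u : V * V => qc u.2 l) by exact: smooth_on_qc.
have sp1 A l : smooth_on A (fun u : V * V => pc u.1 l) by exact: smooth_on_pc.
have sp2 A l : smooth_on A (fun u : V * V => pc u.2 l) by exact: smooth_on_pc.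
have n0 (u : V * V) : O u -> n2 u.1 != 0 by move=> Ou; rewrite gt_eqF.
have sn : smooth_on O (fun u => (n2 u.1)^-1).
  by apply: smooth_onV => //; apply: smooth_onD => //; exact: smooth_onX.
have sc : smooth_on O c.
  by apply: smooth_onM => //; apply: smooth_onD => //; exact: smooth_onM.
have ss : smooth_on O s.
  by apply: smooth_onM => //; apply: smooth_onB => //; exact: smooth_onM.
have sfst : smooth_on O (@fst V V) by apply: smooth_on_clinear; exact: clinear_fst.
have sv : smooth_on O v.
  apply: smooth_on_mkc => // l; apply: smooth_on_if => //; apply: smooth_onB => //.
    by apply: smooth_onB => //; exact: smooth_onM.
  by apply: smooth_onD => //; exact: smooth_onM.
have sw : smooth_on O w.
  apply: smooth_on_mkc => // l; apply: smooth_onD => //.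
  - by apply: smooth_on_if => //; exact: smooth_on_cst.
  - by apply: smooth_onB => //; exact: smooth_onM.
  - by apply: smooth_on_if => //; exact: smooth_on_cst.
  - by apply: smooth_onD => //; exact: smooth_onM.
(* The unit circle in the j-th complex coordinate line: v lies on it exactly when w' is the unit
   multiple v_j of w. *)
pose C := [set y : V | sqn y = 1 /\
  forall i, i \in ~: [set lshift k j; rshift k j]%SET -> y 0 i = 0].
have cs_rot u a a' : O u -> qc u.2 j = a * qc u.1 j - a' * pc u.1 j ->
    pc u.2 j = a * pc u.1 j + a' * qc u.1 j -> c u = a /\ s u = a'.
  move=> Ou; rewrite /c /s => -> ->; have := n0 _ Ou; rewrite /n2 => N0.
  by split; field.
have gf u : O u -> w (f u) = u.2.
  move=> Ou; have N0 := n0 _ Ou; rewrite /n2 in N0; apply: eq_qp => l.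
    rewrite [LHS]qcE /= !qcE !pcE eqxx; case: eqP => [->|_]; last by ring.
    by rewrite /c /s /n2; field.
  rewrite [LHS]pcE /= !qcE !pcE eqxx; case: eqP => [->|_]; last by ring.
  by rewrite /c /s /n2; field.
have fg u : O u -> v (g u) = u.2.
  move=> Ou; have [e1 e2] : c (g u) = qc u.2 j /\ s (g u) = pc u.2 j.
    by apply: cs_rot => //=; rewrite ?qcE ?pcE eqxx add0r.
  apply: eq_qp => l; [rewrite [LHS]qcE|rewrite [LHS]pcE]; rewrite e1 e2;
  by case: eqP => [->//|/eqP/negbTE lj]; rewrite /= ?qcE ?pcE lj addrK.
have sqnC y : C y -> sqn y = qc y j ^+ 2 + pc y j ^+ 2.
  move=> [_ /coord_axis_complement H]; rewrite sqn_qp (bigD1 j)//= big1 ?addr0// => l lj.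
  by have [-> ->] := H l lj; rewrite expr0n addr0.
have X : locally_diffeo (hopf b) x (sphere b `*` C) (x.1, v x).
  exists O, O, f, g; split => //; split => //.
  - exact: smooth_on_pair.
  - exact: smooth_on_pair.
  - by move=> u Ou; split => //; rewrite /g gf//; case: u {Ou}.
  - by move=> u Ou; split => //; rewrite /f fg//; case: u {Ou}.
  - move=> u Ou; split=> [/(hopfP u b0)[ub [a [a' [aa' u2]]]]|[ub /[dup] Cv [v1 vJ]]].
      split => //=; have [ec es] : c u = a /\ s u = a'.
        by apply: cs_rot => //; rewrite u2 /crot ?qcE ?pcE.
      have vl l : l != j -> qc (v u) l = 0 /\ pc (v u) l = 0.
        move=> /negbTE lj; rewrite qcE pcE lj ec es u2 /crot qcE pcE.
        by rewrite !subrr.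
      split; last exact/coord_axis_complement.
      rewrite sqn_qp (bigD1 j)//= big1 ?addr0.
        by rewrite qcE pcE eqxx ec es.
      by move=> l lj; have [-> ->] := vl l lj; rewrite expr0n addr0.
    apply/hopfP => //; split => //; exists (qc (v u) j), (pc (v u) j).
    rewrite -(sqnC _ Cv) v1; split => //; rewrite -[LHS](gf _ Ou).
    move/coord_axis_complement: vJ => vJ.
    apply: eq_qp => l; [rewrite [LHS]qcE [RHS]qcE|rewrite [LHS]pcE [RHS]pcE];
    case: eqP => [_|/eqP /vJ [e1 e2]]; by rewrite /= ?e1 ?e2 add0r.
apply: (submanifold_at_diffeo _ _ X).
- by apply: has_coords_pair; exact: has_coords_rV.
- by apply: has_coords_pair; exact: has_coords_rV.
(* The sphere contributes 2k - 1 and the circle 1. *)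
suff : submanifold_at ((k + k).-1 + 1) (sphere b `*` C) (x.1, v x).
  by have -> : ((k + k).-1 + 1 = k + k)%N by have := ltn_ord j; lia.
apply: submanifold_at_prod; [exact: has_coords_rV|exact: has_coords_rV| |].
  exact: submanifold_at_sphere0.
have [e1 e2] : c x = c0 /\ s x = s0 by apply: cs_rot => //; rewrite ex2 /crot ?qcE ?pcE.
have [i iJ vi] : exists2 i, i \notin ~: [set lshift k j; rshift k j]%SET & v x 0 i != 0.
  have [cz|cz] := eqVneq c0 0.
    exists (rshift k j); first by rewrite !inE eqxx orbT.
    rewrite -/(pc (v x) j) pcE eqxx e2; apply/eqP => sz; move: cs0.
    by rewrite cz sz expr0n addr0 => /eqP; rewrite eq_sym oner_eq0.
  by exists (lshift k j); rewrite ?inE ?eqxx// -/(qc (v x) j) qcE eqxx e1.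
apply: (submanifold_at_sphere _ iJ vi).
rewrite cardsC_setU1// cardsCs finset.setCK card_ord cards2 eq_lrshift /=.
by have := ltn_ord j; lia.
Qed.

End HopfChart.

(** * Tangent spaces and isotropic leaves *)

Section Curves.
Context {R : realType}.
Implicit Types (k m N : nat) (E : normedModType R).

(** The [_fun] rules treat functions as pointwise lambda terms, the shape in which the compound
    expressions below occur. *)
Lemma is_deriveD_fun E (f g : E -> R) (t v : E) (a b : R) : is_derive t v f a -> is_derive t v g b ->
  is_derive t v (fun t => f t + g t) (a + b).
Proof. exact: is_deriveD. Qed.

Lemma is_deriveB_fun E (f g : E -> R) (t v : E) (a b : R) : is_derive t v f a -> is_derive t v g b ->
  is_derive t v (fun t => f t - g t) (a - b).
Proof. exact: is_deriveB. Qed.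

Lemma is_deriveM_fun E (f g : E -> R) (t v : E) (a b : R) : is_derive t v f a -> is_derive t v g b ->
  is_derive t v (fun t => f t * g t) (f t * b + g t * a).
Proof. exact: is_deriveM. Qed.

Lemma is_deriveMl_fun (c : R) (f : R -> R) (t a : R) : is_derive t 1 f a ->
  is_derive t 1 (fun t => c * f t) (c * a).
Proof. exact: is_deriveZ. Qed.

Lemma is_deriveMr_fun (c : R) (f : R -> R) (t a : R) : is_derive t 1 f a ->
  is_derive t 1 (fun t => f t * c) (a * c).
Proof.
move=> df; rewrite [a * c]mulrC; under eq_fun do rewrite mulrC.
exact: is_deriveMl_fun.
Qed.

Lemma is_derive_sqr (f : R -> R) (t a : R) : is_derive t 1 f a ->
  is_derive t 1 (fun t => f t ^+ 2) (2 * (f t * a)).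
Proof.
move=> df; rewrite mulr2n mulrDl mul1r.
exact: (is_deriveM_fun df df).
Qed.

Lemma is_derive_sum_fun E (I : Type) (r : seq I) (P : pred I) (F : I -> E -> R)
    (d : I -> R) (t v : E) : (forall i, is_derive t v (F i) (d i)) ->
  is_derive t v (fun t => \sum_(i <- r | P i) F i t) (\sum_(i <- r | P i) d i).
Proof.
move=> dF; elim: r => [|i r IH].
  by rewrite big_nil; under eq_fun do rewrite big_nil; exact: is_derive_cst.
rewrite big_cons; under eq_fun do rewrite big_cons.
by case: (P i) => //; exact: is_deriveD_fun.
Qed.

Lemma is_derive_linear (c t : R) : is_derive t 1 (fun t => c * t) c.
Proof. by apply: is_derive_eq; exact: mulr1. Qed.

Lemma is_derive_cosM (c t : R) : is_derive t 1 (fun t => cos (c * t)) (- c * sin (c * t)).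
Proof.
have dc := is_derive_linear c t.
have : is_derive t 1 (cos \o (fun t => c * t)) (- sin (c * t) * c).
  exact: is_derive1_comp.
by rewrite mulrC mulrN -mulNr.
Qed.

Lemma is_derive_sinM (c t : R) : is_derive t 1 (fun t => sin (c * t)) (c * cos (c * t)).
Proof.
have dc := is_derive_linear c t.
have : is_derive t 1 (sin \o (fun t => c * t)) (cos (c * t) * c).
  exact: is_derive1_comp.
by rewrite mulrC.
Qed.

Lemma is_derive_rV N (x : R -> 'rV[R]_N) (v : 'rV[R]_N) (t : R) :
  (forall i, is_derive t 1 (fun t => x t 0 i) (v 0 i)) -> is_derive t 1 x v.
Proof.
move=> dx; have dxt : derivable x t 1.
  apply/derivable_mxP => i j; rewrite (ord1 i).
  by have [] := dx j.
split=> //; rewrite derive_mx//; apply/rowP => j; rewrite mxE.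
by have [_] := dx j.
Qed.

Lemma is_derive_coord N (x : R -> 'rV[R]_N) (v : 'rV[R]_N) (t : R) i :
  is_derive t 1 x v -> is_derive t 1 (fun t => x t 0 i) (v 0 i).
Proof.
move=> [dx <-]; have dxi := (derivable_mxP x t 1).1 dx 0 i.
by split => //; rewrite derive_mx// mxE.
Qed.

Lemma is_derive_mkc k (f g : R -> 'I_k -> R) (f' g' : 'I_k -> R) (t : R) :
  (forall l, is_derive t 1 (f^~ l) (f' l)) ->
  (forall l, is_derive t 1 (g^~ l) (g' l)) ->
  is_derive t 1 (fun t => mkc (f t) (g t)) (mkc f' g').
Proof.
move=> df dg; apply: is_derive_rV => i; rewrite -[i]splitK.
case: (fintype.split i) => l /=.
  rewrite -/(qc _ l) qcE (_ : (fun t => _) = f^~ l) //.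
  by apply/funext => u; exact: qcE.
rewrite -/(pc _ l) pcE (_ : (fun t => _) = g^~ l) //.
by apply/funext => u; exact: pcE.
Qed.

Lemma polar (c s : R) : c ^+ 2 + s ^+ 2 = 1 -> exists th, c = cos th /\ s = sin th.
Proof.
move=> cs; have c1 : -1 <= c <= 1.
  by rewrite -ler_norml -(ler_pXn2r (n := 2)) ?nnegrE// ?real_normK ?num_real// expr1n -cs lerDl sqr_ge0.
have sE : Num.sqrt (1 - c ^+ 2) = `|s| by rewrite -cs addrAC subrr add0r sqrtr_sqr.
have ac : cos (acos c) = c by apply: acosK; rewrite in_itv.
have [s0|s0] := leP 0 s.
  by exists (acos c); rewrite ac sin_acos// sE ger0_norm.
by exists (- acos c); rewrite cosN sinN ac sin_acos// sE ltr0_norm// opprK.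
Qed.

Section GreatCircle.
Variables (N : nat) (y v : 'I_N -> R) (a : R).
Hypotheses (a0 : 0 < a) (ya : \sum_i y i ^+ 2 = a ^+ 2) (yv : \sum_i y i * v i = 0).

(* The speed [om] vanishes when [v] does, and then [sin (om * t) / om] is 0. *)
Let om := Num.sqrt (\sum_i v i ^+ 2) / a.

(** The geodesic of the sphere of radius a with initial point y and initial velocity v. Being
    defined for all times, it realises tangent vectors through [tangent_spaceI]. *)
Definition great_circle t i := cos (om * t) * y i + sin (om * t) / om * v i.

(** When om = 0 the quotient is 0 rather than 1, but then v vanishes too. *)
Lemma great_circle_v i : om / om * v i = v i.
Proof.
have [om0|om0] := eqVneq om 0; last by rewrite divff// mul1r.
have : \sum_i v i ^+ 2 = 0.
  apply/eqP; rewrite eq_le sumr_ge0 ?andbT; last by move=> j _; exact: sqr_ge0.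
  by move/eqP: om0; rewrite /om mulf_eq0 invr_eq0 (gt_eqF a0) orbF sqrtr_eq0.
move=> /eqP; rewrite psumr_eq0; last by move=> j _; exact: sqr_ge0.
move=> /allP/(_ i (mem_index_enum _)); rewrite /= sqrf_eq0 => /eqP ->.
by rewrite mulr0.
Qed.

Lemma great_circle0 i : great_circle 0 i = y i.
Proof. by rewrite /great_circle mulr0 cos0 sin0 !mul0r mul1r addr0. Qed.

Lemma great_circle_norm t : \sum_i great_circle t i ^+ 2 = a ^+ 2.
Proof.
have vv : \sum_i v i ^+ 2 = (om * a) ^+ 2.
  by rewrite /om divfK ?gt_eqF// sqr_sqrtr// sumr_ge0// => i _; exact: sqr_ge0.
transitivity (cos (om * t) ^+ 2 * (\sum_i y i ^+ 2) +
    2 * (cos (om * t) * (sin (om * t) / om)) * (\sum_i y i * v i) +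
    (sin (om * t) / om) ^+ 2 * (\sum_i v i ^+ 2)).
  rewrite !mulr_sumr -!big_split /=; apply: eq_bigr => i _.
  by rewrite /great_circle; ring.
rewrite ya yv mulr0 addr0 vv.
have [om0|om0] := eqVneq om 0.
  by rewrite om0 !mul0r cos0 sin0 !mul0r expr1n expr0n mul1r mul0r addr0.
rewrite -[RHS]mul1r -(cos2Dsin2 (om * t)) mulrDl; congr (_ + _).
by rewrite -exprMn mulrA divfK// exprMn.
Qed.

Lemma smooth_great_circle i : smooth_on [set: R] (great_circle^~ i).
Proof.
have oT : open [set: R] by exact: openT.
have sl : smooth_on [set: R] (fun t => om * t).
  by apply: smooth_onM => //; [exact: smooth_on_cst|apply: smooth_on_clinear; exact: clinear_id].
apply: smooth_onD => //; apply: smooth_onM => //; try exact: smooth_on_cst.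
  exact: smooth_on_cos.
by apply: smooth_onM => //; [exact: smooth_on_sin|exact: smooth_on_cst].
Qed.

Lemma is_derive_great_circle i : is_derive (0 : R) 1 (great_circle^~ i) (v i).
Proof.
have := is_deriveD_fun (is_deriveMr_fun (y i) (is_derive_cosM om 0))
  (is_deriveMr_fun (v i) (is_deriveMr_fun om^-1 (is_derive_sinM om 0))).
by rewrite /= mulr0 sin0 cos0 mulr0 mul0r add0r mulr1 great_circle_v.
Qed.

End GreatCircle.

End Curves.

(** * Tangent spaces, and the sphere with its symplectic orthogonals *)

Section Tangents.
Context {R : realType}.
Implicit Types (k m N : nat).

Lemma tangent_spaceI N (X : set 'rV[R]_N) (x v : 'rV[R]_N) (g : R -> 'rV[R]_N) :
  smooth_on setT g -> (forall t, X (g t)) -> g 0 = x -> is_derive (0 : R) 1 g v ->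
  tangent_space X x v.
Proof.
move=> sg Xg g0 [dg gv]; exists 1, g; split; [exact: ltr01| | |exact: g0|].
- exact: smooth_on_subset sg.
- by move=> t _; exact: Xg.
- by rewrite derive1E; exact: gv.
Qed.

(** Retains only what is needed to differentiate an equation of X along the curve at time 0. *)
Lemma tangent_spaceE N (X : set 'rV[R]_N) (x v : 'rV[R]_N) : tangent_space X x v ->
  exists g : R -> 'rV[R]_N, [/\ \forall t \near (0 : R), X (g t), g 0 = x &
    is_derive (0 : R) 1 g v].
Proof.
move=> [e [g [e0 sg Xg g0 gv]]]; exists g; split; [|exact: g0|].
  have e0' : (0 : R) \in `]- e, e[%R by rewrite in_itv /= oppr_lt0 e0.
  by apply: filterS (near_in_itvoo e0') => t te; apply: Xg; rewrite inE.
apply: DeriveDef; last by rewrite -derive1E; exact: gv.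
apply/diff_derivable; apply: (smooth_on_differentiable sg).
by rewrite /= in_itv /= oppr_lt0 e0.
Qed.

Lemma tangent_space_deriv N (X : set 'rV[R]_N) (O : set R) (g : R -> 'rV[R]_N) t :
  open O -> O t -> smooth_on O g -> (forall s, O s -> X (g s)) ->
  tangent_space X (g t) (g^`() t).
Proof.
move=> oO Ot sg Xg.
have /nbhs_ballP[e /= e0 eO] := open_nbhs_nbhs (conj oO Ot).
have inO s : (`]- e, e[ : set R) s -> O (t + s).
  rewrite /= in_itv /= -ltr_norml => se; apply: eO.
  by rewrite /ball /= opprD addrA subrr add0r normrN.
exists e, (fun s => g (t + s)); split; first exact: e0.
- apply: (smooth_on_comp (O' := O)) => //; try exact: has_coords_rV.
    exact: has_coords_R.
  apply: smooth_onD => //; first exact: smooth_on_cst.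
  by apply: smooth_on_clinear; exact: clinear_id.
- by move=> s; rewrite inE => /inO; exact: Xg.
- by rewrite addr0.
- rewrite /derive1; set d := (fun _ : R => _); set d' := (fun _ : R => _).
  suff -> : d = d' by [].
  by apply/funext => h; rewrite /d /d' !addr0 [t + h]addrC.
Qed.

Lemma derive_near_cst (f : R -> R) (c a t : R) :
  (\forall s \near t, f s = c) -> is_derive t 1 f a -> a = 0.
Proof.
move=> fc [_ <-]; rewrite (near_eq_derive (g := cst c))//; exact: derive_cst.
Qed.

Lemma tangent_orthogonal N (X : set 'rV[R]_N) (c : R) (x v : 'rV[R]_N) :
  X `<=` [set y | sqn y = c] -> tangent_space X x v -> \sum_i x 0 i * v 0 i = 0.
Proof.
move=> Xc /tangent_spaceE[g [Xg g0 dg]].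
have H : is_derive (0 : R) 1 (fun t => sqn (g t)) (2 * \sum_i x 0 i * v 0 i).
  rewrite mulr_sumr -g0; apply: is_derive_sum_fun => i.
  exact/is_derive_sqr/is_derive_coord.
have gc : \forall s \near (0 : R), sqn (g s) = c by apply: filterS Xg => t /Xc.
by have /eqP := derive_near_cst gc H; rewrite mulf_eq0 pnatr_eq0 /= => /eqP.
Qed.

Lemma tangent_sphere N (b : R) (x v : 'rV[R]_N) : 0 < b -> sphere b x ->
  tangent_space (sphere b) x v <-> \sum_i x 0 i * v 0 i = 0.
Proof.
move=> b0 xb; split; first by apply: (tangent_orthogonal (c := b ^+ 2)) => y.
move=> xv; pose y i := x 0 i; pose w i := v 0 i.
apply: (@tangent_spaceI _ _ _ _ (fun t => \row_i great_circle y w b t i)).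
- apply: smooth_on_row; first exact: openT.
  by move=> i; exact: smooth_great_circle.
- move=> t; rewrite /sphere /= -(great_circle_norm (y := y) (v := w) b0 xb xv t).
  by apply: eq_bigr => i _; rewrite mxE.
- by apply/rowP => i; rewrite mxE great_circle0.
- apply: is_derive_rV => i.
  rewrite (_ : (fun t => _) = (great_circle y w b)^~ i).
    exact: is_derive_great_circle.
  by apply/funext => t; rewrite mxE.
Qed.

Lemma omega0E k (v w : 'rV[R]_(k + k)) :
  omega0 v w = \sum_l (qc v l * pc w l - pc v l * qc w l).
Proof. by apply: eq_bigr => l _; rewrite !mxE. Qed.

Lemma sum_qp k (v w : 'rV[R]_(k + k)) :
  \sum_i v 0 i * w 0 i = \sum_l (qc v l * qc w l + pc v l * pc w l).
Proof. by rewrite big_split_ord big_split. Qed.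

(** The component of y orthogonal to x is itself an admissible test vector v, hence orthogonal to y
    and to x, so its square norm is 0. *)
Lemma collinear N (x y : 'I_N -> R) (a : R) : a != 0 ->
  \sum_i x i ^+ 2 = a ^+ 2 ->
  (forall v : 'I_N -> R, \sum_i x i * v i = 0 -> \sum_i y i * v i = 0) ->
  exists c, forall i, y i = c * x i.
Proof.
move=> a0 xa H; have aa : a ^+ 2 != 0 by rewrite expf_neq0.
pose c := (\sum_i x i * y i) / a ^+ 2; exists c => i.
pose v i := y i - c * x i.
have xv : \sum_i x i * v i = 0.
  rewrite (eq_bigr (fun i => x i * y i - c * x i ^+ 2)); last by move=> j _; rewrite /v; ring.
  by rewrite sumrB -mulr_sumr xa /c divfK// subrr.
have vv : \sum_i v i ^+ 2 = 0.
  rewrite (eq_bigr (fun i => y i * v i - c * (x i * v i))); last by move=> j _; rewrite /v; ring.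
  by rewrite sumrB -mulr_sumr xv H// mulr0 subrr.
move/eqP: vv; rewrite psumr_eq0; last by move=> j _; exact: sqr_ge0.
move=> /allP/(_ i (mem_index_enum _)); rewrite /= sqrf_eq0 subr_eq0.
by move/eqP.
Qed.

(** Since omega0(v, w) is the scalar product of iv with w, the vector v is orthogonal to the
    hyperplane tangent at x iff iv is a multiple of x, that is, v is a multiple of ix. *)
Lemma symp_orth_sphere k (b : R) (x v : 'rV[R]_(k + k)) : 0 < b -> sphere b x ->
  symp_orth (tangent_space (sphere b) x) v <->
  exists c, v = mkc (fun l => - (c * pc x l)) (fun l => c * qc x l).
Proof.
move=> b0 xb; split; last first.
  move=> [c ->] w /(tangent_sphere w b0 xb); rewrite sum_qp omega0E => xw.
  transitivity (- c * \sum_l (qc x l * qc w l + pc x l * pc w l)).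
    by rewrite mulr_sumr; apply: eq_bigr => l _; rewrite qcE pcE; ring.
  by rewrite xw mulr0.
move=> vT.
pose y i := (mkc (fun l => - pc v l) (fun l => qc v l)) 0 i.
have [c yc] : exists c, forall i, y i = c * x 0 i.
  apply: (@collinear _ _ _ b); [by rewrite gt_eqF|exact: xb|] => w xw.
  have := vT (\row_i w i) _; rewrite omega0E => e.
  transitivity (\sum_(i < k + k) mkc (fun l => - pc v l) (fun l => qc v l) 0 i * (\row_i w i) 0 i).
    by apply: eq_bigr => i _; rewrite [X in _ = _ * X]mxE.
  rewrite sum_qp -[RHS]e.
    by apply: eq_bigr => l _; rewrite qcE pcE; ring.
  apply/tangent_sphere => //; rewrite -[RHS]xw; apply: eq_bigr => i _.
  by rewrite mxE.
exists (- c); apply: eq_qp => l; rewrite ?qcE ?pcE mulNr ?opprK.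
  by have := yc (rshift k l); rewrite /y -/(pc _ l) pcE.
by have := yc (lshift k l); rewrite /y -/(qc _ l) qcE => /(congr1 -%R); rewrite opprK.
Qed.

Lemma coisotropic_sphere k (b : R) : 0 < b -> coisotropic (sphere b : set 'rV[R]_(k + k)).
Proof.
move=> b0 x xb v /(symp_orth_sphere v b0 xb)[c ->].
apply/tangent_sphere => //; rewrite sum_qp big1// => l _.
by rewrite qcE pcE; ring.
Qed.

End Tangents.

(** * The isotropy relation of the sphere *)

Section Isotropy.
Context {R : realType}.
Implicit Types (k m N : nat).

Lemma is_derive_qc k (x : R -> 'rV[R]_(k + k)) (v : 'rV[R]_(k + k)) (t : R) l :
  is_derive t 1 x v -> is_derive t 1 (fun t => qc (x t) l) (qc v l).
Proof. exact: is_derive_coord. Qed.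

Lemma is_derive_pc k (x : R -> 'rV[R]_(k + k)) (v : 'rV[R]_(k + k)) (t : R) l :
  is_derive t 1 x v -> is_derive t 1 (fun t => pc (x t) l) (pc v l).
Proof. exact: is_derive_coord. Qed.

Lemma smooth_near_derive N (K : set R) (x : R -> 'rV[R]_N) t :
  smooth_near K x -> K t -> is_derive t 1 x (x^`() t).
Proof.
move=> [A [ oA KA sx]] Kt; apply: DeriveDef; last by rewrite derive1E.
by apply/diff_derivable; apply: (smooth_on_differentiable sx); exact: KA.
Qed.

Lemma is_derive0_segment (f : R -> R) (a b : R) : a <= b ->
  (forall t : R, a <= t <= b -> is_derive t 1 f 0) -> f b = f a.
Proof.
move=> ab df; have df' (t : R) : t \in `]a, b[%R -> is_derive t 1 f 0.
  by rewrite in_itv /= => /andP[ta tb]; apply: df; rewrite !ltW.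
have cf : {within `[a, b], continuous f}.
  apply: derivable_within_continuous => t; rewrite in_itv /= => tab.
  by have [] := df t tab.
have [_ _ /eqP] := MVT_segment (df := fun=> 0) ab df' cf.
by rewrite mul0r subr_eq0 => /eqP.
Qed.

(** Along a characteristic curve x' = i c x, hence each w_i x_l - w_l x_i satisfies the same linear
    equation and keeps its modulus. It is 0 at the start, where x = w, so it is 0 at the end: this
    is the Hopf condition, obtained without integrating c. *)
Lemma isotropy_relation_sphere k (b : R) : 0 < b ->
  isotropy_relation (sphere b : set 'rV[R]_(k + k)) = hopf b.
Proof.
move=> b0; apply/seteqP; split=> -[w w'] /=.
  move=> [x [sx xT /= x0 x1]].
  have xb t : 0 <= t <= 1 -> sphere b (x t) /\ exists c,
      x^`() t = mkc (fun l => - (c * pc (x t) l)) (fun l => c * qc (x t) l).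
    move=> t01; have [] := xT t; first by rewrite inE /= in_itv.
    by move=> xtb /(symp_orth_sphere _ b0 xtb).
  split => /=.
  - by rewrite -x0; apply: (xb 0 _).1; rewrite lexx ler01.
  - by rewrite -x1; apply: (xb 1 _).1; rewrite lexx ler01.
  (* g1 + i g2 is w_i x_l - w_l x_i. *)
  move=> i l; pose g1 t := (qc w i * qc (x t) l - pc w i * pc (x t) l) -
    (qc w l * qc (x t) i - pc w l * pc (x t) i).
  pose g2 t := (qc w i * pc (x t) l + pc w i * qc (x t) l) -
    (qc w l * pc (x t) i + pc w l * qc (x t) i).
  (* Here c is chosen separately at each time, with no regularity in t; the squared modulus has
     derivative 0 whatever c is. *)
  have dg (t : R) : 0 <= t <= 1 -> is_derive t 1 (fun t => g1 t ^+ 2 + g2 t ^+ 2) 0.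
    move=> t01; have [_ [c xc]] := xb t t01.
    have dx : is_derive t 1 x (x^`() t).
      by apply: (smooth_near_derive sx); rewrite /= in_itv.
    have dq j := is_derive_qc j dx; have dp j := is_derive_pc j dx.
    have dg1 := is_deriveB_fun
      (is_deriveB_fun (is_deriveMl_fun (qc w i) (dq l)) (is_deriveMl_fun (pc w i) (dp l)))
      (is_deriveB_fun (is_deriveMl_fun (qc w l) (dq i)) (is_deriveMl_fun (pc w l) (dp i))).
    have dg2 := is_deriveB_fun
      (is_deriveD_fun (is_deriveMl_fun (qc w i) (dp l)) (is_deriveMl_fun (pc w i) (dq l)))
      (is_deriveD_fun (is_deriveMl_fun (qc w l) (dp i)) (is_deriveMl_fun (pc w l) (dq i))).
    have := is_deriveD_fun (is_derive_sqr dg1) (is_derive_sqr dg2).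
    rewrite xc !qcE !pcE; set D := (X in is_derive _ _ _ X -> _).
    by have -> : D = 0 by rewrite /D; ring.
  have /eqP := is_derive0_segment ler01 dg; rewrite /g1 /g2 x0 x1 => /eqP e.
  have /eqP : (qc w i * qc w' l - pc w i * pc w' l - (qc w l * qc w' i - pc w l * pc w' i)) ^+ 2 +
      (qc w i * pc w' l + pc w i * qc w' l - (qc w l * pc w' i + pc w l * qc w' i)) ^+ 2 = 0.
    by rewrite e; ring.
  rewrite paddr_eq0 ?sqr_ge0// !sqrf_eq0 !subr_eq0 => /andP[/eqP -> /eqP ->].
  by [].
move=> hw; have bn0 : b != 0 by rewrite gt_eqF.
have [/= wb [c [s [cs w'E]]]] := (hopfP _ bn0).1 hw.
have [th [cth sth]] := polar cs.
(* Conversely, rotation at constant speed th runs from w to w' along the Hopf circle. *)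
pose x t := crot (cos (th * t)) (sin (th * t)) w.
have xb t : sphere b (x t) by rewrite /sphere /= sqn_crot cos2Dsin2 mul1r.
have oT : open [set: R] by exact: openT.
have sl : smooth_on [set: R] (fun t => th * t).
  by apply: smooth_onM => //; [exact: smooth_on_cst|apply: smooth_on_clinear; exact: clinear_id].
exists x; split.
- exists setT; split => //; apply: smooth_on_mkc => // l.
    by apply: smooth_onB => //; apply: smooth_onM => //; try exact: smooth_on_cst;
      [exact: smooth_on_cos|exact: smooth_on_sin].
  by apply: smooth_onD => //; apply: smooth_onM => //; try exact: smooth_on_cst;
    [exact: smooth_on_cos|exact: smooth_on_sin].
- move=> t _; split => //; apply/(symp_orth_sphere _ b0 (xb t)); exists th.
  have dx : is_derive t 1 x (mkc (fun l => - (th * pc (x t) l)) (fun l => th * qc (x t) l)).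
    apply: is_derive_mkc => l.
      have := is_deriveB_fun (is_deriveMr_fun (qc w l) (is_derive_cosM th t))
        (is_deriveMr_fun (pc w l) (is_derive_sinM th t)).
      by rewrite pcE; set D := (X in is_derive _ _ _ X -> _); set D' := (X in _ -> is_derive _ _ _ X);
        have -> : D = D' by rewrite /D /D'; ring.
    have := is_deriveD_fun (is_deriveMr_fun (pc w l) (is_derive_cosM th t))
      (is_deriveMr_fun (qc w l) (is_derive_sinM th t)).
    by rewrite qcE; set D := (X in is_derive _ _ _ X -> _); set D' := (X in _ -> is_derive _ _ _ X);
      have -> : D = D' by rewrite /D /D'; ring.
  by rewrite derive1E; have [_ ->] := dx.
- rewrite /x mulr0 cos0 sin0; apply: eq_qp => l; rewrite ?qcE ?pcE mul1r mul0r ?subr0 ?addr0 //.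
- by rewrite /x mulr1 -cth -sth.
Qed.

(** The phase is that of a nonzero coordinate z_j: dividing x by z_j / |z_j| leaves a real vector y,
    because all z_l conj(z_j) are real. *)
Lemma lagrP k (a : R) (x : 'rV[R]_(k + k)) : a != 0 ->
  lagr a x <-> exists c s (y : 'I_k -> R), [/\ c ^+ 2 + s ^+ 2 = 1,
    \sum_l y l ^+ 2 = a ^+ 2 & x = mkc (fun l => c * y l) (fun l => s * y l)].
Proof.
move=> a0; split; last first.
  move=> [c [s [y [cs ya ->]]]]; split.
    rewrite sqn_qp -ya; apply: eq_bigr => l _; rewrite qcE pcE.
    by rewrite !exprMn -mulrDl cs mul1r.
  by move=> l j; rewrite !qcE !pcE; ring.
move=> [xa xx]; have [j xj] : exists j, 0 < qc x j ^+ 2 + pc x j ^+ 2.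
  by apply: qp_neq0; rewrite xa expf_neq0.
pose r := Num.sqrt (qc x j ^+ 2 + pc x j ^+ 2).
have r0 : r != 0 by rewrite gt_eqF// sqrtr_gt0.
have rr : r ^+ 2 = qc x j ^+ 2 + pc x j ^+ 2 by rewrite sqr_sqrtr// ltW.
have rr0 : r ^+ 2 != 0 by rewrite expf_neq0.
pose c := qc x j / r; pose s := pc x j / r.
have cs : c ^+ 2 + s ^+ 2 = 1 by rewrite /c /s !exprMn -mulrDl -rr exprVn divff.
pose y l := c * qc x l + s * pc x l.
have sc l : s * qc x l = c * pc x l.
  by rewrite /s /c mulrAC [pc x j * _]mulrC -xx [RHS]mulrAC [pc x l * _]mulrC.
have xE : x = mkc (fun l => c * y l) (fun l => s * y l).
  apply: eq_qp => l; rewrite ?qcE ?pcE /y.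
    rewrite -[LHS]mul1r -cs mulrDr [c * (s * _)]mulrCA -sc; ring.
  by rewrite -[LHS]mul1r -cs mulrDr [s * (c * _)]mulrCA sc; ring.
exists c, s, y; split => //.
rewrite -xa; transitivity (sqn (mkc (fun l => c * y l) (fun l => s * y l))); last by rewrite -xE.
rewrite sqn_qp; apply: eq_bigr => l _; rewrite qcE pcE.
transitivity ((c ^+ 2 + s ^+ 2) * y l ^+ 2); first by rewrite cs mul1r.
by ring.
Qed.

End Isotropy.

(** * Tangent spaces and isotropy relation of the Lagrangian *)

Section LagrangianIsotropy.
Context {R : realType}.
Implicit Types (k m N : nat).

Section Point.
Variables (k : nat) (a c s : R) (y : 'I_k -> R).
Hypotheses (a0 : 0 < a) (cs : c ^+ 2 + s ^+ 2 = 1) (ya : \sum_l y l ^+ 2 = a ^+ 2).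
Let x : 'rV[R]_(k + k) := mkc (fun l => c * y l) (fun l => s * y l).

(** With c + is = e^{it} this is e^{it} (A + i beta y): A is the velocity of the real vector y and
    beta that of the phase. *)
Definition lagr_tangent (A : 'I_k -> R) (beta : R) : 'rV[R]_(k + k) :=
  mkc (fun l => c * A l - s * (beta * y l)) (fun l => s * A l + c * (beta * y l)).

Lemma lagr_tangent_frame (v : 'rV[R]_(k + k)) (A : 'I_k -> R) beta :
  (forall l, A l = c * qc v l + s * pc v l) ->
  (forall l, c * pc v l - s * qc v l = beta * y l) ->
  v = lagr_tangent A beta.
Proof.
move=> AE BE; apply: eq_qp => l; rewrite ?qcE ?pcE AE -BE.
  transitivity ((c ^+ 2 + s ^+ 2) * qc v l); [by rewrite cs mul1r|by ring].
transitivity ((c ^+ 2 + s ^+ 2) * pc v l); [by rewrite cs mul1r|by ring].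
Qed.

(** Write v = e^{it} (A + iB). Differentiating |z|^2 = a^2 gives that A is orthogonal to y;
    differentiating the reality equations gives that B is a multiple of y. Conversely, a rotating
    phase times a great circle realises any such pair. *)
Lemma tangent_lagr (v : 'rV[R]_(k + k)) : tangent_space (lagr a) x v <->
  exists A beta, \sum_l y l * A l = 0 /\ v = lagr_tangent A beta.
Proof.
have aa : a ^+ 2 != 0 by rewrite expf_neq0// gt_eqF.
split=> [xv|[A [beta [yA ->]]]].
  pose A l := c * qc v l + s * pc v l; pose B l := c * pc v l - s * qc v l.
  exists A, ((\sum_j B j * y j) / a ^+ 2); split.
    have : \sum_i x 0 i * v 0 i = 0.
      by apply: (tangent_orthogonal (c := a ^+ 2) _ xv) => z [].
    rewrite sum_qp => e; rewrite -[RHS]e; apply: eq_bigr => l _.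
    by rewrite qcE pcE /A; ring.
  apply: lagr_tangent_frame => // l; rewrite -/(B l).
  (* The derivative of p_l q_j - q_l p_j along the curve. Multiplying by y_j and summing over j
     yields B = beta y. *)
  have BB j : B l * y j = B j * y l.
    have [g [Xg g0 dg]] := tangent_spaceE xv.
    have dq i := is_derive_qc i dg; have dp i := is_derive_pc i dg.
    have H := is_deriveB_fun (is_deriveM_fun (dp l) (dq j)) (is_deriveM_fun (dq l) (dp j)).
    have gc : \forall t \near (0 : R), pc (g t) l * qc (g t) j - qc (g t) l * pc (g t) j = 0.
      by apply: filterS Xg => t [_ ->]; rewrite subrr.
    have := derive_near_cst gc H; rewrite g0 /x !qcE !pcE => e.
    by apply/eqP; rewrite -subr_eq0; apply/eqP; rewrite -[RHS]e /B; ring.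
  apply: (mulIf aa); rewrite mulrAC divfK// -{1}ya mulr_sumr mulr_suml.
  by apply: eq_bigr => j _; rewrite expr2 mulrA BB; ring.
(* The real vector follows a great circle with velocity A while the phase advances at speed beta. *)
pose Y := great_circle y A a.
pose C t := cos (beta * t); pose S t := sin (beta * t).
apply: (@tangent_spaceI _ _ _ _ _ (fun t =>
  mkc (fun l => (C t * c - S t * s) * Y t l) (fun l => (C t * s + S t * c) * Y t l))).
- have oT : open [set: R] by exact: openT.
  have sl : smooth_on [set: R] (fun t => beta * t).
    by apply: smooth_onM => //; [exact: smooth_on_cst|apply: smooth_on_clinear; exact: clinear_id].
  have sC : smooth_on setT C by exact: smooth_on_cos.
  have sS : smooth_on setT S by exact: smooth_on_sin.
  have sY l : smooth_on setT (Y^~ l) by exact: smooth_great_circle.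
  apply: smooth_on_mkc => // l; apply: smooth_onM => //.
    by apply: smooth_onB => //; apply: smooth_onM => //; exact: smooth_on_cst.
  by apply: smooth_onD => //; apply: smooth_onM => //; exact: smooth_on_cst.
- move=> t; apply/lagrP; first by rewrite gt_eqF.
  exists (C t * c - S t * s), (C t * s + S t * c), (Y t); split => //.
    transitivity ((C t ^+ 2 + S t ^+ 2) * (c ^+ 2 + s ^+ 2)); first by ring.
    by rewrite cs /C /S cos2Dsin2 mulr1.
  exact: great_circle_norm.
- rewrite /x /C /S mulr0 cos0 sin0; apply: eq_qp => l; rewrite ?qcE ?pcE /Y great_circle0; ring.
- have dC := is_derive_cosM beta 0; have dS := is_derive_sinM beta 0.
  have dY l := is_derive_great_circle y A a0 l.
  rewrite /lagr_tangent; apply: is_derive_mkc => l.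
    have := is_deriveM_fun (is_deriveB_fun (is_deriveMr_fun c dC) (is_deriveMr_fun s dS)) (dY l).
    rewrite mulr0 cos0 sin0 great_circle0; set D := (X in is_derive _ _ _ X -> _).
    by set D' := (X in _ -> is_derive _ _ _ X); have -> : D = D' by rewrite /D /D'; ring.
  have := is_deriveM_fun (is_deriveD_fun (is_deriveMr_fun s dC) (is_deriveMr_fun c dS)) (dY l).
  rewrite mulr0 cos0 sin0 great_circle0; set D := (X in is_derive _ _ _ X -> _).
  by set D' := (X in _ -> is_derive _ _ _ X); have -> : D = D' by rewrite /D /D'; ring.
Qed.

(** In the frame e^{it} (A + iB), omega0 pairs real parts with imaginary parts. Two tangent vectors
    pair to 0 because A is orthogonal to y and B is parallel to it; conversely, each family of
    tangent vectors tests one of these two conditions. *)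
Lemma symp_orth_lagr :
  symp_orth (tangent_space (lagr a) x) = tangent_space (lagr a) x.
Proof.
apply/seteqP; split=> v; last first.
  move=> /tangent_lagr[A [beta [yA ->]]] w /tangent_lagr[A' [beta' [yA' ->]]].
  rewrite omega0E.
  transitivity ((c ^+ 2 + s ^+ 2) * (beta' * (\sum_l y l * A l) - beta * (\sum_l y l * A' l))).
    rewrite !mulr_sumr -sumrB mulr_sumr; apply: eq_bigr => l _.
    by rewrite !qcE !pcE; ring.
  by rewrite yA yA' !mulr0 subrr mulr0.
move=> vT; apply/tangent_lagr.
pose A l := c * qc v l + s * pc v l; pose B l := c * pc v l - s * qc v l.
have [beta Bb] : exists beta, forall l, B l = beta * y l.
  apply: (@collinear _ _ _ _ a) => //; first by rewrite gt_eqF.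
  (* Pairing with the real direction w is minus the scalar product of B with w, so B annihilates the
     orthogonal of y. *)
  move=> w yw; have := vT (lagr_tangent w 0).
  rewrite omega0E => /(_ _)/eqP; rewrite -oppr_eq0 => e.
  apply/eqP; rewrite (_ : \sum_i _ = - \sum_(l < k) (qc v l * pc (lagr_tangent w 0) l -
    pc v l * qc (lagr_tangent w 0) l)).
    by apply: e; apply/tangent_lagr; exists w, 0.
  rewrite -sumrN; apply: eq_bigr => l _.
  by rewrite !qcE !pcE /B; ring.
exists A, beta; split; last exact: lagr_tangent_frame.
(* Pairing with the phase direction e^{it} i y gives the scalar product of A with y. *)
have := vT (lagr_tangent (fun=> 0) 1); rewrite omega0E => e; rewrite -[RHS]e.
  apply: eq_bigr => l _; rewrite !qcE !pcE /A; ring.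
apply/tangent_lagr; exists (fun=> 0), 1; split => //.
by apply: big1 => l _; rewrite mulr0.
Qed.

End Point.

Lemma symp_orth_tangent_lagr k (a : R) (x : 'rV[R]_(k + k)) : 0 < a -> lagr a x ->
  symp_orth (tangent_space (lagr a) x) = tangent_space (lagr a) x.
Proof.
move=> a0 /(lagrP _ (lt0r_neq0 a0))[c [s [y [cs ya ->]]]].
exact: symp_orth_lagr.
Qed.

Lemma coisotropic_lagr k (a : R) : 0 < a -> coisotropic (lagr a : set 'rV[R]_(k + k)).
Proof. by move=> a0 x xa; rewrite symp_orth_tangent_lagr. Qed.

(* Since -y has phase shifted by pi, the two real vectors may be taken at an
   angle of at most pi/2, so that the segment between them avoids 0. *)
Lemma isotropy_relation_lagr k (a : R) : 0 < a ->
  isotropy_relation (lagr a : set 'rV[R]_(k + k)) = lagr a `*` lagr a.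
Proof.
move=> a0; have an0 : a != 0 by rewrite gt_eqF.
apply/seteqP; split=> -[x0 x1] /=.
  move=> [x [_ xT /= <- <-]]; split => /=.
    by have [] := xT 0; rewrite ?inE//= in_itv /= lexx ler01.
  by have [] := xT 1; rewrite ?inE//= in_itv /= lexx ler01.
move=> [/= /(lagrP _ an0)[c0 [s0 [y0 [cs0 ya0 x0E]]]]].
move=> /(lagrP _ an0)[c1' [s1' [y1' [cs1' ya1' x1E']]]].
have [c1 [s1 [y1 [cs1 ya1 x1E y01]]]] : exists c1 s1 y1, [/\ c1 ^+ 2 + s1 ^+ 2 = 1,
    \sum_l y1 l ^+ 2 = a ^+ 2, x1 = mkc (fun l => c1 * y1 l) (fun l => s1 * y1 l) &
    0 <= \sum_l y0 l * y1 l].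
  have [p|p] := leP 0 (\sum_l y0 l * y1' l); first by exists c1', s1', y1'.
  exists (- c1'), (- s1'), (fun l => - y1' l); split.
  - by rewrite !sqrrN.
  - by rewrite -ya1'; apply: eq_bigr => l _; rewrite sqrrN.
  - by rewrite x1E'; apply: eq_qp => l; rewrite ?qcE ?pcE mulrNN.
  - by rewrite (eq_bigr (fun l => - (y0 l * y1' l)))=> [|l _];
      rewrite ?sumrN ?oppr_ge0 ?mulrN// ltW.
have [th0 [cE0 sE0]] := polar cs0; have [th1 [cE1 sE1]] := polar cs1.
pose Y t l := (1 - t) * y0 l + t * y1 l.
pose n2 t := \sum_l Y t l ^+ 2.
pose th t := (1 - t) * th0 + t * th1.
pose nu t := a / Num.sqrt (n2 t).
pose x t := mkc (fun l => cos (th t) * (nu t * Y t l)) (fun l => sin (th t) * (nu t * Y t l)).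
have oT : open [set: R] by exact: openT.
have s1t A : smooth_on A (fun t : R => t) by apply: smooth_on_clinear; exact: clinear_id.
have saff (u v : R) : smooth_on setT (fun t : R => (1 - t) * u + t * v).
  apply: smooth_onD => //; apply: smooth_onM => //; try exact: smooth_on_cst.
  by apply: smooth_onB => //; exact: smooth_on_cst.
have sn2 : smooth_on setT n2.
  by apply: smooth_on_sum => // l; apply: smooth_onX => //; exact: saff.
pose O := [set t | 0 < n2 t].
have oO : open O.
  have := open_preimage_on (O := setT) (f := n2) oT (@open_gt _ 0).
  by rewrite setTI; apply; exact: smooth_on_continuous sn2.
(* The cross term is nonnegative on [0, 1] by the choice of y1, and the first term is positive. *)
have n2E t : n2 t = a ^+ 2 * ((1 - t) ^+ 2 + t ^+ 2) + 2 * ((1 - t) * t) * \sum_l y0 l * y1 l.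
  rewrite /n2 mulrDr -{1}ya0 -ya1 !mulr_suml mulr_sumr -!big_split /=.
  by apply: eq_bigr => l _; rewrite /Y; ring.
have O01 : `[0, 1] `<=` O.
  move=> t; rewrite /= in_itv /= => /andP[t0 t1]; rewrite /O /= n2E.
  have t1' : 0 <= 1 - t by rewrite subr_ge0.
  apply: ltr_pwDl; last by rewrite mulr_ge0// mulr_ge0// mulr_ge0.
  rewrite mulr_gt0 ?exprn_gt0//.
  have [->|tn0] := eqVneq t 0; first by rewrite subr0 expr1n expr0n addr0 ltr01.
  by rewrite ltr_pwDr ?sqr_ge0// exprn_even_gt0.
have sx : smooth_on O x.
  have snu : smooth_on O nu.
    apply: smooth_onM => //; first exact: smooth_on_cst.
    apply: smooth_onV => // [t Ot|]; first by rewrite gt_eqF// sqrtr_gt0.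
    by apply: smooth_on_sqrt => //; exact: smooth_on_subset sn2.
  have sth : smooth_on O th by apply: smooth_on_subset (saff _ _).
  have sY l : smooth_on O (Y^~ l) by apply: smooth_on_subset (saff _ _).
  apply: smooth_on_mkc => // l; apply: smooth_onM => //.
  - exact: smooth_on_cos.
  - exact: smooth_onM.
  - exact: smooth_on_sin.
  - exact: smooth_onM.
have Lx t : O t -> lagr a (x t).
  move=> Ot; apply/lagrP => //.
  exists (cos (th t)), (sin (th t)), (fun l => nu t * Y t l); split => //.
    exact: cos2Dsin2.
  have n0 : n2 t != 0 by rewrite gt_eqF.
  transitivity (nu t ^+ 2 * n2 t); first by rewrite mulr_sumr; apply: eq_bigr => l _; rewrite exprMn.
  by rewrite /nu exprMn exprVn sqr_sqrtr ?ltW// divfK.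
exists x; split => /=.
- by exists O.
- move=> t; rewrite inE => /O01 Ot; split; first exact: Lx.
  (* The orthogonal is the whole tangent space, so any smooth curve inside [lagr a] is
     characteristic. *)
  by rewrite symp_orth_tangent_lagr//; [exact: (tangent_space_deriv oO Ot)|exact: Lx].
- have e : n2 0 = a ^+ 2 by rewrite n2E; ring.
  rewrite /x /nu e sqrtr_sqr gtr0_norm// divff// x0E cE0 sE0 /th subr0 mul1r mul0r addr0.
  by apply: eq_qp => l; rewrite ?qcE ?pcE /Y subr0 !mul1r mul0r addr0.
- have e : n2 1 = a ^+ 2 by rewrite n2E; ring.
  rewrite /x /nu e sqrtr_sqr gtr0_norm// divff// x1E cE1 sE1 /th subrr mul1r mul0r add0r.
  by apply: eq_qp => l; rewrite ?qcE ?pcE /Y subrr !mul1r mul0r add0r.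
Qed.

End LagrangianIsotropy.

(** * Products *)

Section Products.
Context {R : realType}.
Variables k m : nat.
Local Notation V := 'rV[R]_((k + m) + (k + m)).
Local Notation V1 := 'rV[R]_(k + k).
Local Notation V2 := 'rV[R]_(m + m).

(** In R^(2(k + m)) all q precede all p, so the two symplectic factors are interleaved rather than
    adjacent blocks. *)
Definition fst_part (v : V) : V1 :=
  mkc (fun l => qc v (lshift m l)) (fun l => pc v (lshift m l)).
Definition snd_part (v : V) : V2 :=
  mkc (fun l => qc v (rshift k l)) (fun l => pc v (rshift k l)).
Definition join_parts (u : V1 * V2) : V :=
  mkc (fun i => match fintype.split i with inl l => qc u.1 l | inr l => qc u.2 l end)
      (fun i => match fintype.split i with inl l => pc u.1 l | inr l => pc u.2 l end).
Definition prodset (N1 : set V1) (N2 : set V2) : set V :=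
  [set v | N1 (fst_part v) /\ N2 (snd_part v)].

Lemma clinear_mkc (E : normedModType R) N (f g : E -> 'I_N -> R) :
  (forall l, clinear (f^~ l)) -> (forall l, clinear (g^~ l)) ->
  clinear (fun x => mkc (f x) (g x)).
Proof.
move=> lf lg; apply: clinear_row => i; rewrite -[i]splitK.
case: (fintype.split i) => l /=.
  rewrite (_ : (fun x => _) = f^~ l) //.
  by apply/funext => u; exact: qcE.
rewrite (_ : (fun x => _) = g^~ l) //.
by apply/funext => u; exact: pcE.
Qed.

Lemma clinear_fst_part : clinear fst_part.
Proof. by apply: clinear_mkc => l; exact: clinear_coord. Qed.

Lemma clinear_snd_part : clinear snd_part.
Proof. by apply: clinear_mkc => l; exact: clinear_coord. Qed.

Lemma clinear_join_parts : clinear join_parts.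
Proof.
have c1 (f : V1 -> R) : clinear f -> clinear (fun u : V1 * V2 => f u.1).
  by move=> lf; apply: (clinear_comp (f := fst) (g := f)) => //; exact: clinear_fst.
have c2 (f : V2 -> R) : clinear f -> clinear (fun u : V1 * V2 => f u.2).
  by move=> lf; apply: (clinear_comp (f := snd) (g := f)) => //; exact: clinear_snd.
apply: clinear_mkc => i; case: (fintype.split i) => l.
- exact: c1 (clinear_qc l).
- exact: c2 (clinear_qc l).
- exact: c1 (clinear_pc l).
- exact: c2 (clinear_pc l).
Qed.

Lemma join_partsK u : fst_part (join_parts u) = u.1 /\ snd_part (join_parts u) = u.2.
Proof.
split; apply: eq_qp => l; rewrite ?qcE ?pcE.
- by have := unsplitK (inl l : 'I_k + 'I_m); rewrite /= => ->.
- by have := unsplitK (inl l : 'I_k + 'I_m); rewrite /= => ->.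
- by have := unsplitK (inr l : 'I_k + 'I_m); rewrite /= => ->.
- by have := unsplitK (inr l : 'I_k + 'I_m); rewrite /= => ->.
Qed.

Lemma parts_join v : join_parts (fst_part v, snd_part v) = v.
Proof.
by apply: eq_qp => i; rewrite ?qcE ?pcE /=; case: (split_ordP i) => l ->;
  rewrite ?qcE ?pcE.
Qed.

Lemma sqn_parts v : sqn v = sqn (fst_part v) + sqn (snd_part v).
Proof.
rewrite !sqn_qp big_split_ord; congr (_ + _); apply: eq_bigr => l _.
  by rewrite qcE pcE.
by rewrite qcE pcE.
Qed.

Lemma omega0_parts v w : omega0 v w =
  omega0 (fst_part v) (fst_part w) + omega0 (snd_part v) (snd_part w).
Proof.
rewrite !omega0E big_split_ord; congr (_ + _); apply: eq_bigr => l _.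
  by rewrite !qcE !pcE.
by rewrite !qcE !pcE.
Qed.

Lemma derive1_post (E F : normedModType R) (L : E -> F) (x : R -> E) (t : R) :
  clinear L -> differentiable x t -> (fun t => L (x t))^`() t = L (x^`() t).
Proof. by move=> lL dx; rewrite !derive1E; exact: (derive_post _ lL dx). Qed.

Lemma derive1_join (x1 : R -> V1) (x2 : R -> V2) (t : R) :
  differentiable x1 t -> differentiable x2 t ->
  let x t := join_parts (x1 t, x2 t) in
  fst_part (derive1 x t) = derive1 x1 t /\ snd_part (derive1 x t) = derive1 x2 t.
Proof.
move=> d1 d2 x; have dx : differentiable x t.
  apply: (differentiable_comp (f := fun t => (x1 t, x2 t)) (g := join_parts)).
    exact: differentiable_pair.
  exact: (clinear_diff _ clinear_join_parts).1.
have e1 : (fun t => fst_part (x t)) = x1.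
  by apply/funext => s; exact: (join_partsK _).1.
have e2 : (fun t => snd_part (x t)) = x2.
  by apply/funext => s; exact: (join_partsK _).2.
split; [rewrite -[in RHS]e1|rewrite -[in RHS]e2]; symmetry.
  exact: derive1_post clinear_fst_part dx.
exact: derive1_post clinear_snd_part dx.
Qed.

Lemma smooth_on_join (O : set R) (x1 : R -> V1) (x2 : R -> V2) : open O ->
  smooth_on O x1 -> smooth_on O x2 -> smooth_on O (fun t => join_parts (x1 t, x2 t)).
Proof.
move=> oO s1 s2; apply: (smooth_on_post (L := join_parts)) => //.
  exact: clinear_join_parts.
exact: smooth_on_pair.
Qed.

Variables (N1 : set V1) (N2 : set V2).
Local Notation N := (prodset N1 N2).

Lemma tangent_prodset v w : tangent_space N v w <->
  tangent_space N1 (fst_part v) (fst_part w) /\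
  tangent_space N2 (snd_part v) (snd_part w).
Proof.
split.
  move=> [e [g [e0 sg Ng g0 gw]]]; have oe : open (`]- e, e[ : set R) by exact: interval_open.
  have dg : differentiable g 0.
    by apply: (smooth_on_differentiable sg); rewrite /= in_itv /= oppr_lt0 e0.
  split; exists e.
    exists (fun t => fst_part (g t)); split => //.
    - by apply: smooth_on_post => //; exact: clinear_fst_part.
    - by move=> t /Ng[].
    - by rewrite g0.
    - by rewrite derive1_post// ?gw//; exact: clinear_fst_part.
  exists (fun t => snd_part (g t)); split => //.
  - by apply: smooth_on_post => //; exact: clinear_snd_part.
  - by move=> t /Ng[].
  - by rewrite g0.
  - by rewrite derive1_post// ?gw//; exact: clinear_snd_part.
move=> [[e1 [g1 [e10 sg1 Ng1 g10 gw1]]] [e2 [g2 [e20 sg2 Ng2 g20 gw2]]]].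
pose e := Num.min e1 e2.
have sub1 : `]- e, e[ `<=` (`]- e1, e1[ : set R).
  by apply: subset_itvW; rewrite ?lerN2 ge_min lexx.
have sub2 : `]- e, e[ `<=` (`]- e2, e2[ : set R).
  by apply: subset_itvW; rewrite ?lerN2 ge_min lexx orbT.
exists e, (fun t => join_parts (g1 t, g2 t)); split.
- by rewrite lt_min e10.
- apply: smooth_on_join; first exact: interval_open.
    exact: smooth_on_subset sg1.
  exact: smooth_on_subset sg2.
- move=> t; rewrite inE => te; have [e1' e2'] := join_partsK (g1 t, g2 t).
  split; rewrite ?e1' ?e2' /=.
    by apply: Ng1; rewrite inE; exact: sub1.
  by apply: Ng2; rewrite inE; exact: sub2.
- by rewrite g10 g20 parts_join.
- have [||e1' e2'] := @derive1_join g1 g2 0.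
  + by apply: (smooth_on_differentiable sg1); rewrite /= in_itv /= oppr_lt0 e10.
  + by apply: (smooth_on_differentiable sg2); rewrite /= in_itv /= oppr_lt0 e20.
  by rewrite -[LHS]parts_join e1' e2' gw1 gw2 parts_join.
Qed.

Lemma tangent_space0 M (X : set 'rV[R]_M) x : X x -> tangent_space X x 0.
Proof.
move=> Xx; apply: (tangent_spaceI (g := fun=> x)) => //.
exact: smooth_on_cst.
Qed.

Lemma omega00 M (v : 'rV[R]_(M + M)) : omega0 v 0 = 0.
Proof. by rewrite omega0E; apply: big1 => l _; rewrite /qc /pc !mxE !mulr0 subrr. Qed.

(** omega0 is the sum of the forms of the factors, and 0 is tangent to either factor, so the
    orthogonality can be tested on vectors (u, 0) and (0, u). *)
Lemma symp_orth_prodset v w : N v ->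
  symp_orth (tangent_space N v) w <->
  symp_orth (tangent_space N1 (fst_part v)) (fst_part w) /\
  symp_orth (tangent_space N2 (snd_part v)) (snd_part w).
Proof.
move=> [Nv1 Nv2]; split=> [H|[H1 H2] u /tangent_prodset[T1 T2]]; last first.
  by rewrite omega0_parts H1// H2// addr0.
split=> u Tu.
  have := H (join_parts (u, 0)); rewrite omega0_parts !(join_partsK _).1 !(join_partsK _).2.
  rewrite omega00 addr0; apply; apply/tangent_prodset.
  by rewrite !(join_partsK _).1 !(join_partsK _).2; split => //; exact: tangent_space0.
have := H (join_parts (0, u)); rewrite omega0_parts !(join_partsK _).1 !(join_partsK _).2.
rewrite omega00 add0r; apply; apply/tangent_prodset.
by rewrite !(join_partsK _).1 !(join_partsK _).2; split => //; exact: tangent_space0.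
Qed.

Lemma coisotropic_prodset : coisotropic N1 -> coisotropic N2 -> coisotropic N.
Proof.
move=> c1 c2 v Nv w /(symp_orth_prodset w Nv)[H1 H2].
by apply/tangent_prodset; split; [apply: c1|apply: c2] => //; case: Nv.
Qed.

(** A curve is characteristic iff both its parts are, so leaves of the product are products of
    leaves. *)
Lemma isotropy_relation_prodset p : isotropy_relation N p <->
  isotropy_relation N1 (fst_part p.1, fst_part p.2) /\
  isotropy_relation N2 (snd_part p.1, snd_part p.2).
Proof.
split.
  move=> [x [[A [ oA KA sx]] xT x0 x1]].
  have dx t : t \in (`[0, 1] : set R) -> differentiable x t.
    by rewrite inE => /KA; exact: smooth_on_differentiable sx _.
  split.
    exists (fun t => fst_part (x t)); split => /=; rewrite ?x0 ?x1//.
    - by exists A; split => //; apply: smooth_on_post => //; exact: clinear_fst_part.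
    - move=> t t01; have [Nx /(symp_orth_prodset _ Nx)[T1 T2]] := xT t t01.
      rewrite derive1_post; [|exact: clinear_fst_part|exact: dx].
      by split => //; case: Nx.
  exists (fun t => snd_part (x t)); split => /=; rewrite ?x0 ?x1//.
  - by exists A; split => //; apply: smooth_on_post => //; exact: clinear_snd_part.
  - move=> t t01; have [Nx /(symp_orth_prodset _ Nx)[T1 T2]] := xT t t01.
    rewrite derive1_post; [|exact: clinear_snd_part|exact: dx].
    by split => //; case: Nx.
move=> [[x [[A [ oA KA sx]] xT /= x0 x1]] [y [[B [ oB KB sy]] yT /= y0 y1]]].
exists (fun t => join_parts (x t, y t)); split.
- exists (A `&` B); split.
  + exact: openI.
  + by move=> t t01; split; [exact: KA|exact: KB].
  + apply: smooth_on_join; first exact: openI.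
      by apply: smooth_on_subset sx => ? [].
    by apply: smooth_on_subset sy => ? [].
- move=> t t01; have [Nx Tx] := xT t t01; have [Ny Ty] := yT t t01.
  have NN : N (join_parts (x t, y t)).
    by split; rewrite ?(join_partsK _).1 ?(join_partsK _).2.
  split => //; apply/symp_orth_prodset => //.
  move: t01; rewrite inE => t01.
  have [||-> ->] := @derive1_join x y t.
  + by apply: (smooth_on_differentiable sx); exact: KA.
  + by apply: (smooth_on_differentiable sy); exact: KB.
  by rewrite (join_partsK _).1 (join_partsK _).2.
- by rewrite x0 y0 parts_join.
- by rewrite x1 y1 parts_join.
Qed.

Lemma submanifold_at_prodset d e v :
  submanifold_at d N1 (fst_part v) -> submanifold_at e N2 (snd_part v) ->
  submanifold_at (d + e) N v.
Proof.
move=> s1 s2; have c1 : has_coords V1 by exact: has_coords_rV.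
have c2 : has_coords V2 by exact: has_coords_rV.
apply: submanifold_at_diffeo (submanifold_at_prod c1 c2 s1 s2).
- exact: has_coords_rV.
- exact: has_coords_pair.
apply: (locally_diffeo_linear (f := fun v => (fst_part v, snd_part v)) (g := join_parts)).
- by apply: clinear_pair; [exact: clinear_fst_part|exact: clinear_snd_part].
- exact: clinear_join_parts.
- exact: parts_join.
- by move=> u; rewrite (join_partsK _).1 (join_partsK _).2; case: u.
- by [].
Qed.

Lemma submanifold_at_isotropy_prodset d e p :
  submanifold_at d (isotropy_relation N1) (fst_part p.1, fst_part p.2) ->
  submanifold_at e (isotropy_relation N2) (snd_part p.1, snd_part p.2) ->
  submanifold_at (d + e) (isotropy_relation N) p.
Proof.
move=> s1 s2; have c1 : has_coords (V1 * V1)%type.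
  by apply: has_coords_pair; exact: has_coords_rV.
have c2 : has_coords (V2 * V2)%type.
  by apply: has_coords_pair; exact: has_coords_rV.
apply: submanifold_at_diffeo (submanifold_at_prod c1 c2 s1 s2).
- by apply: has_coords_pair; exact: has_coords_rV.
- exact: has_coords_pair.
apply: (locally_diffeo_linear (f := fun p : V * V =>
    ((fst_part p.1, fst_part p.2), (snd_part p.1, snd_part p.2)))
  (g := fun q => (join_parts (q.1.1, q.2.1), join_parts (q.1.2, q.2.2)))).
- apply: clinear_pair; apply: clinear_pair.
  + by apply: (clinear_comp (f := fst) (g := fst_part)); [exact: clinear_fst|exact: clinear_fst_part].
  + by apply: (clinear_comp (f := snd) (g := fst_part)); [exact: clinear_snd|exact: clinear_fst_part].
  + by apply: (clinear_comp (f := fst) (g := snd_part)); [exact: clinear_fst|exact: clinear_snd_part].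
  + by apply: (clinear_comp (f := snd) (g := snd_part)); [exact: clinear_snd|exact: clinear_snd_part].
- apply: clinear_pair; (apply: (clinear_comp (g := join_parts)); last exact: clinear_join_parts);
    apply: clinear_pair.
  + by apply: (clinear_comp (f := fst) (g := fst)); exact: clinear_fst.
  + by apply: (clinear_comp (f := snd) (g := fst)); [exact: clinear_snd|exact: clinear_fst].
  + by apply: (clinear_comp (f := fst) (g := snd)); [exact: clinear_fst|exact: clinear_snd].
  + by apply: (clinear_comp (f := snd) (g := snd)); exact: clinear_snd.
- by move=> [u w] /=; rewrite !parts_join.
- by move=> [[u w] [u' w']] /=; rewrite !(join_partsK _).1 !(join_partsK _).2.
- by move=> q; rewrite isotropy_relation_prodset; split=> [[]|[]].
Qed.

End Products.

(** * Closedness, compactness and contractibility in the ball *)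

Section Admissible.
Context {R : realType}.
Implicit Types (k m n N : nat).

Lemma closed_eq_smooth (E : normedModType R) (f g : E -> R) :
  smooth_on setT f -> smooth_on setT g -> closed [set x | f x = g x].
Proof.
move=> sf sg; have oT : open [set: E] by exact: openT.
have sfg := smooth_onB oT sf sg.
rewrite (_ : [set x | _] = (fun x => f x - g x) @^-1` [set t | t = 0]).
  apply: preimage_closed; last exact: closed_eq.
  by move=> x _; exact: (smooth_on_continuous sfg).
by apply/seteqP; split=> x /= /eqP; [rewrite -subr_eq0 => /eqP|rewrite subr_eq0 => /eqP].
Qed.

Lemma smooth_on_sqn (E : normedModType R) N (f : E -> 'rV[R]_N) :
  clinear f -> smooth_on setT (fun x => sqn (f x)).
Proof.
move=> lf; apply: smooth_on_sum => [|i]; first exact: openT.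
apply: smooth_onX; first exact: openT.
apply: smooth_on_clinear; apply: (clinear_comp (f := f) (g := fun v : 'rV[R]_N => v 0 i)) => //.
exact: clinear_coord.
Qed.

Lemma closed_sphere N (b : R) : closed (sphere b : set 'rV[R]_N).
Proof.
apply: closed_eq_smooth; last exact: smooth_on_cst.
by apply: (smooth_on_sqn (f := id)); exact: clinear_id.
Qed.

Lemma closed_lagr k (a : R) : closed (lagr a : set 'rV[R]_(k + k)).
Proof.
have oT : open [set: 'rV[R]_(k + k)] by exact: openT.
have sq l : smooth_on setT (fun z : 'rV[R]_(k + k) => qc z l).
  by apply: smooth_on_clinear; exact: clinear_qc.
have sp l : smooth_on setT (fun z : 'rV[R]_(k + k) => pc z l).
  by apply: smooth_on_clinear; exact: clinear_pc.
rewrite (_ : lagr a = sphere a `&` \bigcap_l \bigcap_j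
  [set z : 'rV[R]_(k + k) | pc z l * qc z j = qc z l * pc z j]).
  apply: closedI; first exact: closed_sphere.
  apply: closed_bigI => l _; apply: closed_bigI => j _.
  by apply: closed_eq_smooth; exact: smooth_onM.
apply/seteqP; split=> z [za H]; split => //; first by move=> l _ j _; exact: H.
by move=> l j; exact: (H l I j I).
Qed.

Lemma closed_hopf k (b : R) : closed (hopf b : set ('rV[R]_(k + k) * 'rV[R]_(k + k))).
Proof.
pose V := 'rV[R]_(k + k).
have oT : open [set: V * V] by exact: openT.
have lfst : clinear (@fst V V) by exact: clinear_fst.
have lsnd : clinear (@snd V V) by exact: clinear_snd.
have sq1 l : smooth_on setT (fun u : V * V => qc u.1 l) by exact: smooth_on_qc.
have sq2 l : smooth_on setT (fun u : V * V => qc u.2 l) by exact: smooth_on_qc.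
have sp1 l : smooth_on setT (fun u : V * V => pc u.1 l) by exact: smooth_on_pc.
have sp2 l : smooth_on setT (fun u : V * V => pc u.2 l) by exact: smooth_on_pc.
rewrite (_ : hopf b = [set u : V * V | sqn u.1 = b ^+ 2] `&` ([set u : V * V | sqn u.2 = b ^+ 2] `&`
  \bigcap_i \bigcap_l ([set u : V * V | qc u.1 i * qc u.2 l - pc u.1 i * pc u.2 l =
      qc u.1 l * qc u.2 i - pc u.1 l * pc u.2 i] `&`
    [set u : V * V | qc u.1 i * pc u.2 l + pc u.1 i * qc u.2 l =
      qc u.1 l * pc u.2 i + pc u.1 l * qc u.2 i]))).
  apply: closedI.
    apply: closed_eq_smooth; last exact: smooth_on_cst.
    by apply: (smooth_on_sqn (f := fst)); exact: clinear_fst.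
  apply: closedI.
    apply: closed_eq_smooth; last exact: smooth_on_cst.
    by apply: (smooth_on_sqn (f := snd)); exact: clinear_snd.
  apply: closed_bigI => i _; apply: closed_bigI => l _; apply: closedI.
    by apply: closed_eq_smooth; apply: smooth_onB => //; exact: smooth_onM.
  by apply: closed_eq_smooth; apply: smooth_onD => //; exact: smooth_onM.
apply/seteqP; split=> u.
  by move=> [u1 u2 H]; do 2![split => //] => i _ l _; have [] := H i l.
by move=> [u1 [u2 H]]; split => // i l; have [] := H i I l I.
Qed.

Lemma closed_clinear_preimage (E F : normedModType R) (f : E -> F) (A : set F) :
  clinear f -> closed A -> closed (f @^-1` A).
Proof.
by move=> [_ cf] cA; apply: preimage_closed => // x _; exact: cf.
Qed.

Lemma closed_prodset k m (A : set 'rV[R]_(k + k)) (B : set 'rV[R]_(m + m)) :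
  closed A -> closed B -> closed (prodset A B).
Proof.
move=> cA cB; rewrite (_ : prodset A B =
  @fst_part R k m @^-1` A `&` @snd_part R k m @^-1` B) //.
by apply: closedI; apply: closed_clinear_preimage => //;
  [exact: clinear_fst_part|exact: clinear_snd_part].
Qed.

Lemma closed_isotropy_prodset k m (A : set 'rV[R]_(k + k)) (B : set 'rV[R]_(m + m)) :
  closed (isotropy_relation A) -> closed (isotropy_relation B) ->
  closed (isotropy_relation (prodset A B)).
Proof.
pose f (p : 'rV[R]_((k + m) + (k + m)) * 'rV[R]_((k + m) + (k + m))) :=
  (fst_part p.1, fst_part p.2).
pose g (p : 'rV[R]_((k + m) + (k + m)) * 'rV[R]_((k + m) + (k + m))) :=
  (snd_part p.1, snd_part p.2).
move=> cA cB; rewrite (_ : isotropy_relation _ =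
    f @^-1` isotropy_relation A `&` g @^-1` isotropy_relation B); last first.
  by apply/seteqP; split=> p /isotropy_relation_prodset.
apply: closedI; apply: closed_clinear_preimage => //; apply: clinear_pair.
- by apply: (clinear_comp (f := fst) (g := @fst_part R k m)); [exact: clinear_fst|exact: clinear_fst_part].
- by apply: (clinear_comp (f := snd) (g := @fst_part R k m)); [exact: clinear_snd|exact: clinear_fst_part].
- by apply: (clinear_comp (f := fst) (g := @snd_part R k m)); [exact: clinear_fst|exact: clinear_snd_part].
- by apply: (clinear_comp (f := snd) (g := @snd_part R k m)); [exact: clinear_snd|exact: clinear_snd_part].
Qed.

Lemma compact_sqn N (A : set 'rV[R]_N) :
  A `<=` [set x | sqn x < 1] -> closed A -> compact A.
Proof.
move=> A1 cA; apply: bounded_closed_compact => //.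
exists 1; split => // M M1 x /A1 /= x1.
rewrite /Num.Def.normr /= mx_normrE; apply: bigmax_le => [|[i j] _ /=].
  by rewrite ltW// (lt_trans _ M1).
rewrite (ord1 i) (le_trans _ (ltW M1))// -(ler_pXn2r (n := 2)) ?nnegrE//.
rewrite real_normK ?num_real// expr1n (le_trans _ (ltW x1))//.
by rewrite /sqn (bigD1 j)//= lerDl sumr_ge0// => l _; exact: sqr_ge0.
Qed.

Lemma unit_ball_convex n (x y : 'rV[R]_(n + n)) (t : R) : 0 <= t <= 1 ->
  unit_ball R n x -> unit_ball R n y -> unit_ball R n ((1 - t) *: x + t *: y).
Proof.
move=> /andP[t0 t1]; rewrite /unit_ball /= => x1 y1.
have H : \sum_i ((1 - t) *: x + t *: y) 0 i ^+ 2 <=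
    (1 - t) * \sum_i x 0 i ^+ 2 + t * \sum_i y 0 i ^+ 2.
  rewrite !mulr_sumr -big_split /=; apply: ler_sum => i _; rewrite !mxE.
  rewrite -subr_ge0 (_ : _ - _ = t * (1 - t) * (x 0 i - y 0 i) ^+ 2); last by ring.
  by rewrite mulr_ge0 ?sqr_ge0// mulr_ge0// subr_ge0.
apply: le_lt_trans H _; have [->|tn0] := eqVneq t 0.
  by rewrite subr0 mul1r mul0r addr0.
rewrite -[ltRHS](subrK t); apply: ler_ltD.
  by rewrite ler_piMr ?subr_ge0// ltW.
by rewrite gtr_pMr// lt_neqAle eq_sym tn0.
Qed.

(** The loop shrinks linearly to the origin. As x is continuous only within the circle, the second
    projection has to be followed as a limit within the circle. *)
Lemma contractible_unit_ball n (x : R * R -> 'rV[R]_(n + n)) :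
  {within circle, continuous x} -> x @` circle `<=` unit_ball R n ->
  contractible_loop (unit_ball R n) x.
Proof.
move=> cx xB; exists (fun u => (1 - u.1) *: x u.2 + u.1 *: 0), 0; split.
- apply/subspace_continuousP => -[t z] [/= t01 zc].
  have cxz : x @ within circle (nbhs z) --> x z by move/subspace_continuousP: cx; exact.
  have sndF : snd u @[u --> within (`[0, 1] `*` circle) (nbhs (t, z))] --> within circle (nbhs z).
    move=> U; rewrite /within /= => zU.
    have : \forall u \near (t, z), circle u.2 -> U u.2.
      exists (setT, [set w | circle w -> U w]) => [|[u v] [] //].
      by split => //=; exact: filterT.
    by apply: filterS => u H [_ /= uc]; exact: H.
  have fstF : fst u @[u --> within (`[0, 1] `*` circle) (nbhs (t, z))] --> t.
    by apply: cvg_within_filter; exact: cvg_fst.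
  apply: cvgD; last by apply: cvgZ => //; exact: cvg_cst.
  apply: cvgZ; first by apply: cvgB => //; exact: cvg_cst.
  exact: cvg_comp sndF cxz.
- move=> _ [[t z] [/= t01 zc] <-]; apply: unit_ball_convex => //=.
  + by apply: xB; exists z.
  + by rewrite /unit_ball /= big1 ?ltr01// => i _; rewrite mxE expr0n.
- by move=> z _ /=; rewrite subr0 scale1r scaler0 addr0.
- by move=> z _ /=; rewrite subrr scale0r scaler0 addr0.
Qed.

(** Leaves lie in N, hence in the convex ball, so their loops contract; compactness follows from
    closedness and the bound on the norm. *)
Lemma admissible_unit_ball n d e (N : set 'rV[R]_(n + n)) :
  N !=set0 -> N `<=` unit_ball R n -> closed N ->
  (forall x, N x -> submanifold_at d N x) -> coisotropic N ->
  closed (isotropy_relation N) ->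
  (forall p, isotropy_relation N p -> submanifold_at e (isotropy_relation N) p) ->
  admissible_coisotropic d (unit_ball R n) N.
Proof.
move=> N0 NB cN sN coN cI sI; split; split => //.
- exact: compact_sqn.
- exact: submanifoldP.
- split; last by exists e; exact: submanifoldP.
  exact: closed_subspaceW.
- move=> F x [x0 Nx0 ->] cx xF; apply: contractible_unit_ball => //.
  move=> _ [z zc <-]; apply: NB.
  have [y [_ yT _ /= <-]] : isotropy_relation N (x0, x z) by apply: xF; exists z.
  by have [] := yT 1; rewrite ?inE//= in_itv /= lexx ler01.
Qed.

End Admissible.

(** * Green's theorem on the disk *)

Section DiskIntegral.
Context {R : realType}.
Local Notation mu := (@lebesgue_measure R).
Local Notation RR := (measurableTypeR R * measurableTypeR R)%type.

(** The integral uses the product sigma-algebra. An open set belongs to it as the countable union of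
    the boxes inside it with rational centre and radius, which are the balls of the sup norm. *)
Lemma open_measurable_plane (U : set (R * R)) : open U -> measurable (U : set RR).
Proof.
move=> oU.
pose box (i : rat * rat * rat) : set RR :=
  ball (ratr i.1.1 : R) (ratr i.2) `*` ball (ratr i.1.2 : R) (ratr i.2).
pose F i := if pselect (box i `<=` U) then box i else set0.
rewrite (_ : U = \bigcup_i F i); last first.
  apply/seteqP; split=> [[x y] Uxy|z [i _]]; last first.
    by rewrite /F; case: pselect => // iU /iU.
  have /nbhs_ballP[e /= e0 eU] := open_nbhs_nbhs (conj oU Uxy).
  (* A box of radius below e / 2 whose centre is within that radius of (x, y) stays in the ball of
     radius e. *)
  have [r] := @rat_in_itvoo R 0 (e / 2) (divr_gt0 e0 (ltr0Sn _ 1)).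
  rewrite in_itv /= => /andP[r0 re].
  have [a] : exists q, ratr q \in `]x - ratr r, x + ratr r[%R.
    by apply: rat_in_itvoo; rewrite ltrBlDr -addrA ltrDl addr_gt0.
  rewrite in_itv /= => /andP[a1 a2].
  have [b] : exists q, ratr q \in `]y - ratr r, y + ratr r[%R.
    by apply: rat_in_itvoo; rewrite ltrBlDr -addrA ltrDl addr_gt0.
  rewrite in_itv /= => /andP[b1 b2].
  have ax : `|ratr a - x| < ratr r by rewrite ltr_distl a1 a2.
  have by_ : `|ratr b - y| < ratr r by rewrite ltr_distl b1 b2.
  exists (a, b, r) => //; rewrite /F; case: pselect => [boxU|H] /=; first by split.
  exfalso; apply: H => -[u v] [/= au bv]; apply: eU; split => /=.
    rewrite /ball /= (splitr e) -(subrKA (ratr a)).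
    rewrite (le_lt_trans (ler_normD _ _))// ltrD//.
      by rewrite distrC (lt_trans ax).
    by rewrite (lt_trans _ re).
  rewrite /ball /= (splitr e) -(subrKA (ratr b)).
  rewrite (le_lt_trans (ler_normD _ _))// ltrD//.
    by rewrite distrC (lt_trans by_).
  by rewrite (lt_trans _ re).
apply: countable_bigcupT_measurable => [|i]; first exact: countableP.
rewrite /F; case: pselect => boxU; last exact: measurable0.
by apply: measurableX; rewrite ball_itv; exact: measurable_itv.
Qed.

Lemma closed_disk : closed (disk : set (R * R)).
Proof.
pose f (z : R * R) := z.1 ^+ 2 + z.2 ^+ 2.
rewrite (_ : disk = f @^-1` [set t | t <= 1]) //.
apply: preimage_closed; last exact: closed_le.
move=> z _; have oT : open [set: R * R] by exact: openT.
apply: (smooth_on_continuous (O := setT)) => //.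
by apply: smooth_onD => //; apply: smooth_onX => //; apply: smooth_on_clinear;
  [exact: clinear_fst|exact: clinear_snd].
Qed.

Lemma measurable_disk : measurable (disk : set RR).
Proof.
rewrite -[disk]setCK; apply: measurableC; apply: open_measurable_plane.
exact/closed_openC/closed_disk.
Qed.

Lemma disk_square : (disk : set (R * R)) `<=` `[-1, 1] `*` `[-1, 1].
Proof.
move=> [x y] /= xy1; rewrite /disk /= !in_itv /= -!ler_norml.
rewrite -!(@ler_pXn2r _ 2 _ _ 1)// ?nnegrE// !real_normK ?num_real// expr1n.
split; apply: le_trans xy1; first by rewrite lerDl sqr_ge0.
by rewrite lerDr sqr_ge0.
Qed.

Lemma compact_disk : compact (disk : set (R * R)).
Proof.
apply: (subclosed_compact closed_disk _ disk_square).
by apply: compact_setX; exact: segment_compact.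
Qed.

Lemma finite_measure_disk : ((mu \x mu) (disk : set RR) < +oo)%E.
Proof.
apply: (@le_lt_trans _ _ ((mu \x mu)%E ((`[-1, 1] `*` `[-1, 1]) : set RR))).
  apply: le_measure; rewrite ?inE; [exact: measurable_disk| |exact: disk_square].
  exact: measurableX.
rewrite product_measure1E//= !lebesgue_measure_itv /= !lte_fin.
by case: ifP => _; rewrite ?mul0e ?ltry// -EFinD -EFinM ltry.
Qed.

Lemma integrable_disk (f : R * R -> R) :
  (forall z, disk z -> {for z, continuous f}) ->
  (mu \x mu)%E.-integrable (disk : set RR) (EFin \o f).
Proof.
move=> cf; apply: measurable_bounded_integrable.
- exact: measurable_disk.
- exact: finite_measure_disk.
- move=> _; apply: (measurability _ (RGenOInfty.measurableE R)) => //.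
  move=> _ [_ [x ->] <-].
  (* f is continuous only at points of the disk, so the preimage of the ray is replaced by its
     interior, which has the same trace on the disk. *)
  rewrite (_ : _ `&` _ = disk `&` (f @^-1` `]x, +oo[)^°); last first.
    apply/seteqP; split=> z [Dz]; last by move=> /interior_subset.
    move=> fz; split => //; apply: (cf z Dz).
    by apply: open_nbhs_nbhs; split => //; exact: interval_open.
  apply: measurableI; first exact: measurable_disk.
  by apply: open_measurable_plane; exact: open_interior.
- exact: measurable_disk.
- have cfD : {within disk, continuous f}.
    by apply: continuous_in_subspaceT => z; rewrite inE; exact: cf.
  have /compact_bounded[M [_ mrt]] := continuous_compact cfD compact_disk.
  by exists M; split; rewrite ?num_real // => ? ? ? ?; exact: mrt.
Qed.

End DiskIntegral.

(** * Both halves of Green's formula, by slicing *)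

Section Green.
Context {R : realType}.
Local Notation mu := (@lebesgue_measure R).
Local Notation RR := (measurableTypeR R * measurableTypeR R)%type.

Lemma is_derive_comp_curve (E F : normedModType R) (f : E -> F) (g : R -> E) (t : R) v :
  differentiable f (g t) -> is_derive t 1 g v ->
  is_derive t 1 (fun t => f (g t)) ('D_v f (g t)).
Proof.
move=> df [dg <-]; have dg' : differentiable g t by apply/derivable1_diffP.
have dfg : differentiable (fun t => f (g t)) t by exact: (differentiable_comp dg' df).
apply: DeriveDef; first exact/derivable1_diffP.
by rewrite (deriveE _ dfg) (diff_comp dg' df) /= (deriveE _ dg') (deriveE _ df).
Qed.

Lemma is_derive_pair (E F : normedModType R) (f : R -> E) (g : R -> F) (t : R) u v :
  is_derive t 1 f u -> is_derive t 1 g v ->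
  is_derive t 1 (fun t => (f t, g t)) (u, v).
Proof.
move=> [df <-] [dg <-]; have df' : differentiable f t by apply/derivable1_diffP.
have dg' : differentiable g t by apply/derivable1_diffP.
have dfg := differentiable_pair df' dg'.
apply: DeriveDef; first exact/derivable1_diffP.
by rewrite (deriveE _ dfg) diff_pair //= (deriveE _ df') (deriveE _ dg').
Qed.

(** The bound M is taken as 10 below, which exceeds all the angles that occur since pi < 4. *)
Lemma primitive_exists (g : R -> R) (M : R) : continuous g ->
  exists G : R -> R, forall x : R, `|x| < M -> is_derive x 1 G (g x).
Proof.
move=> cg; exists (fun x => \int[mu]_(t in `[- M, x]) g t)%R => x.
rewrite ltr_norml => /andP[Mx xM].
have ig : mu.-integrable `[- M, M] (EFin \o g).
  apply: continuous_compact_integrable; first exact: segment_compact.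
  exact: continuous_subspaceT.
have [dG eG] := continuous_FTC1_closed xM ig Mx (cg x).
by apply: DeriveDef dG _; rewrite -derive1E; exact: eG.
Qed.

(** The case a = b is included because the chords of the disk at x = -1 and x = 1 are points. *)
Lemma integral_derive (F f : R -> R) (a b : R) : a <= b ->
  (forall x : R, a <= x <= b -> is_derive x 1 F (f x)) ->
  (forall x : R, a <= x <= b -> {for x, continuous f}) ->
  (\int[mu]_(x in `[a, b]) (f x)%:E = (F b - F a)%:E)%E.
Proof.
rewrite le_eqVlt => /predU1P[<- _ _|ab dF cf].
  by rewrite set_itv1 integral_set1 subrr.
have cF x : a <= x <= b -> {for x, continuous F}.
  by move=> /dF[dx _]; apply/differentiable_continuous/derivable1_diffP.
rewrite EFinB; apply: continuous_FTC2 => //.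
- by apply: continuous_in_subspaceT => x; rewrite inE /= in_itv /=; exact: cf.
- split.
  + by move=> x; rewrite in_itv /= => /andP[ax xb]; have [] := dF x; rewrite ?ltW.
  + by apply: cvg_at_right_filter; apply: cF; rewrite lexx ltW.
  + by apply: cvg_at_left_filter; apply: cF; rewrite lexx ltW.
- move=> x; rewrite in_itv /= => /andP[ax xb]; rewrite derive1E.
  by have [] := dF x; rewrite ?ltW.
Qed.

(** Turns sqrt(1 - x^2), which is not differentiable at the endpoints, into the smooth function
    cosine. *)
Lemma integral_sin_substitution (h : R -> R) :
  (forall x : R, -1 <= x <= 1 -> {for x, continuous h}) ->
  (\int[mu]_(x in `[(-1)%R, 1%R]) (h x)%:E =
   \int[mu]_(x in `[(- (pi / 2))%R, (pi / 2)%R]) (h (sin x) * cos x)%:E)%E.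
Proof.
move=> ch; have sinE : (@sin R)^`() = cos.
  by apply/funext => x; rewrite derive1E; have [_ ->] := is_derive_sin x.
have := @integration_by_substitution_increasing R sin h (- (pi / 2)) (pi / 2).
rewrite sinN sin_pihalf sinE => -> //.
- by have := pihalf_ge1 R; lra.
- by move=> x y xI yI xy; rewrite ltr_sin.
- by move=> x _; exact: continuous_cos.
- by apply/cvg_ex; eexists; apply: cvg_at_right_filter; exact: continuous_cos.
- by apply/cvg_ex; eexists; apply: cvg_at_left_filter; exact: continuous_cos.
- split.
  + by move=> x _; exact: derivable_sin.
  + by apply: cvg_at_right_filter; exact: continuous_sin.
  + by apply: cvg_at_left_filter; exact: continuous_sin.
- by apply: continuous_in_subspaceT => x; rewrite inE /= in_itv /=; exact: ch.
Qed.

Lemma continuous_comp_pair (Q : R * R -> R) (f g : R -> R) (x : R) :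
  {for x, continuous f} -> {for x, continuous g} -> {for (f x, g x), continuous Q} ->
  {for x, continuous (fun x => Q (f x, g x))}.
Proof.
move=> cf cg cQ.
exact: (@continuous_comp _ _ _ (fun x => (f x, g x)) Q x (cvg_pair cf cg) cQ).
Qed.

Variables (O : set (R * R)) (P : R * R -> R).
Hypotheses (oO : open O) (DO : disk `<=` O) (sP : smooth_on O P).

Lemma disk_slice (x y : R) : -1 <= x <= 1 ->
  disk (x, y) <-> - Num.sqrt (1 - x ^+ 2) <= y <= Num.sqrt (1 - x ^+ 2).
Proof.
move=> x1; have x0 : 0 <= 1 - x ^+ 2.
  by move/andP: x1 => [? ?]; nra.
have s0 := sqrtr_ge0 (1 - x ^+ 2); have ss := sqr_sqrtr x0.
rewrite -ler_norml; have -> : (`|y| <= Num.sqrt (1 - x ^+ 2)) = (y ^+ 2 <= 1 - x ^+ 2).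
  by rewrite -[in RHS]ss -[y ^+ 2]real_normK ?num_real// ler_pXn2r ?nnegrE.
by rewrite /disk /= lerBrDl.
Qed.

Lemma on_circle (th : R) : O (cos th, sin th).
Proof. by apply: DO; rewrite /disk /= cos2Dsin2. Qed.

Lemma continuous_on_circle (th : R) : {for th, continuous (fun th => P (cos th, sin th))}.
Proof.
apply: (@continuous_comp _ _ _ (fun th => (cos th, sin th)) P).
  exact: (cvg_pair (@continuous_cos R th) (@continuous_sin R th)).
exact: (smooth_on_continuous sP (on_circle th)).
Qed.

Lemma sqrt_disk (x : R) : -1 <= x <= 1 ->
  [/\ O (x, Num.sqrt (1 - x ^+ 2)), O (x, - Num.sqrt (1 - x ^+ 2)),
      O (Num.sqrt (1 - x ^+ 2), x) & O (- Num.sqrt (1 - x ^+ 2), x)].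
Proof.
move=> x1; have x0 : 0 <= 1 - x ^+ 2 by move/andP: x1 => [? ?]; nra.
by split; apply: DO; rewrite /disk /= ?sqrrN sqr_sqrtr//; lra.
Qed.

Lemma continuous_sqrt_disk (x : R) :
  {for x, continuous (fun x : R => Num.sqrt (1 - x ^+ 2))}.
Proof.
apply: (@continuous_comp _ _ _ (fun x : R => 1 - x ^+ 2) Num.sqrt).
  by apply: cvgB; [exact: cvg_cst|exact: exprn_continuous].
exact: sqrt_continuous.
Qed.

Lemma cos_sin_sqrt (th : R) : - (pi / 2) <= th <= pi / 2 ->
  Num.sqrt (1 - sin th ^+ 2) = cos th.
Proof.
by move=> thI; rewrite -cos2sin2 sqrtr_sqr ger0_norm// cos_ge0_pihalf.
Qed.

(** Fubini for the integrand extended by 0 outside the disk, then the fundamental theorem of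
    calculus on each vertical chord. *)
Lemma integral_disk_y :
  (\int[(mu \x mu)%E]_(z in (disk : set RR)) ('D_(0, 1) P z)%:E =
   \int[mu]_(x in `[(-1)%R, 1%R])
     (P (x, Num.sqrt (1 - x ^+ 2)) - P (x, - Num.sqrt (1 - x ^+ 2)))%:E)%E.
Proof.
pose f := 'D_(0, 1) P; have sf : smooth_on O f by exact: smooth_on_derive.
have cf z : disk z -> {for z, continuous f} by move=> /DO; exact: smooth_on_continuous sf _.
have intf := integrable_disk cf.
have mD := @measurable_disk R.
rewrite integral_mkcond -integral12_prod_meas1; last first.
  by apply/(integrable_mkcond _ mD).
rewrite [RHS]integral_mkcond; apply: eq_integral => x _.
rewrite /fubini_F [RHS]patchE; case: ifPn => [|xI].
  rewrite inE /= in_itv /= => x1; set s := Num.sqrt _.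
  have s0 : 0 <= s := sqrtr_ge0 _.
  have inD y : - s <= y <= s -> disk (x, y) by move/(disk_slice y x1).
  have dP (y : R) : - s <= y <= s -> is_derive y 1 (fun y => P (x, y)) (f (x, y)).
    move=> /inD Dxy; apply: (is_derive_comp_curve (f := P) (g := fun y => (x, y))).
      by apply: (smooth_on_differentiable sP); exact: DO.
    exact: is_derive_pair.
  have cP (y : R) : - s <= y <= s -> {for y, continuous (fun y => f (x, y))}.
    move=> /inD Dxy; apply: (@continuous_comp _ _ _ (fun y => (x, y)) f).
      exact: (cvg_pair (@cvg_cst _ x _ _ _) cvg_id).
    exact: cf.
  rewrite -(integral_derive _ dP cP); last by rewrite ge0_cp.
  rewrite [RHS]integral_mkcond; apply: eq_integral => y _; rewrite !patchE.
  have [Dxy|nDxy] := pselect (disk (x, y)).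
    rewrite (mem_set Dxy) ifT// inE /= in_itv /=.
    exact/(disk_slice y x1).
  rewrite (memNset nDxy) ifF//; apply/negP; rewrite inE /= in_itv /= => /inD.
  exact: nDxy.
apply: integral0_eq => y _; rewrite patchE ifF//; apply/negP; rewrite inE => Dxy.
by move/negP: xI; apply; rewrite inE; have [] := disk_square Dxy.
Qed.

Lemma disk_swap (x y : R) : disk (x, y) -> disk (y, x).
Proof. by rewrite /disk /= addrC. Qed.

Lemma integral_disk_x :
  (\int[(mu \x mu)%E]_(z in (disk : set RR)) ('D_(1, 0) P z)%:E =
   \int[mu]_(x in `[(-1)%R, 1%R])
     (P (Num.sqrt (1 - x ^+ 2), x) - P (- Num.sqrt (1 - x ^+ 2), x))%:E)%E.
Proof.
pose f := 'D_(1, 0) P; have sf : smooth_on O f by exact: smooth_on_derive.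
have cf z : disk z -> {for z, continuous f} by move=> /DO; exact: smooth_on_continuous sf _.
have intf := integrable_disk cf.
have mD := @measurable_disk R.
rewrite integral_mkcond -integral21_prod_meas1; last first.
  by apply/(integrable_mkcond _ mD).
rewrite [RHS]integral_mkcond; apply: eq_integral => x _.
rewrite /fubini_G [RHS]patchE; case: ifPn => [|xI].
  rewrite inE /= in_itv /= => x1; set s := Num.sqrt _.
  have s0 : 0 <= s := sqrtr_ge0 _.
  have inD y : - s <= y <= s -> disk (y, x) by move/(disk_slice y x1)/disk_swap.
  have dP (y : R) : - s <= y <= s -> is_derive y 1 (fun y => P (y, x)) (f (y, x)).
    move=> /inD Dxy; apply: (is_derive_comp_curve (f := P) (g := fun y => (y, x))).
      by apply: (smooth_on_differentiable sP); exact: DO.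
    exact: is_derive_pair.
  have cP (y : R) : - s <= y <= s -> {for y, continuous (fun y => f (y, x))}.
    move=> /inD Dxy; apply: (@continuous_comp _ _ _ (fun y => (y, x)) f).
      exact: (cvg_pair cvg_id (@cvg_cst _ x _ _ _)).
    exact: cf.
  rewrite -(integral_derive _ dP cP); last by rewrite ge0_cp.
  rewrite [RHS]integral_mkcond; apply: eq_integral => y _; rewrite !patchE.
  have [Dxy|nDxy] := pselect (disk (y, x)).
    rewrite (mem_set Dxy) ifT// inE /= in_itv /=.
    exact/(disk_slice y x1)/disk_swap.
  rewrite (memNset nDxy) ifF//; apply/negP; rewrite inE /= in_itv /= => /inD.
  exact: nDxy.
apply: integral0_eq => y _; rewrite patchE ifF//; apply/negP; rewrite inE => Dxy.
by move/negP: xI; apply; rewrite inE; have [] := disk_square Dxy.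
Qed.

Lemma pihalf_bounds : 0 < pi / 2 :> R /\ pi / 2 < 2 :> R.
Proof. by have /andP := pihalf_02 R. Qed.

(** B is a primitive of -P dx along the circle. After x = sin th the upper end of a chord has angle
    pi / 2 - th and the lower one th - pi / 2, so the two half circles together cover [-pi, pi]. *)
Lemma green_y (B : R -> R) :
  (forall th : R, `|th| < 10 -> is_derive th 1 B (P (cos th, sin th) * sin th)) ->
  (\int[(mu \x mu)%E]_(z in (disk : set RR)) ('D_(0, 1) P z)%:E = (B pi - B (- pi))%:E)%E.
Proof.
move=> dB; rewrite integral_disk_y integral_sin_substitution; last first.
  move=> x x1; have [Oa Ob _ _] := sqrt_disk x1.
  apply: cvgB; apply: continuous_comp_pair; try exact: cvg_id.
  - exact: continuous_sqrt_disk.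
  - exact: (smooth_on_continuous sP Oa).
  - by apply: cvgN; exact: continuous_sqrt_disk.
  - exact: (smooth_on_continuous sP Ob).
have [p0 p2] := pihalf_bounds.
pose K (th : R) := B (th - pi / 2) - B (pi / 2 - th).
have dK (th : R) : - (pi / 2) <= th <= pi / 2 -> is_derive th 1 K
    ((P (sin th, cos th) - P (sin th, - cos th)) * cos th).
  move=> /andP[th1 th2].
  have d1 : is_derive th 1 (fun th : R => th - pi / 2) 1.
    have := is_deriveB_fun (is_derive_id th 1) (is_derive_cst (pi / 2) th 1).
    by rewrite subr0.
  have d2 : is_derive th 1 (fun th : R => pi / 2 - th) (-1).
    have := is_deriveB_fun (is_derive_cst (pi / 2) th 1) (is_derive_id th 1).
    by rewrite sub0r.
  have l1 : `|th - pi / 2| < 10 by rewrite ltr_norml; lra.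
  have l2 : `|pi / 2 - th| < 10 by rewrite ltr_norml; lra.
  have e1 := is_derive1_comp (g := fun th : R => th - pi / 2) (dB _ l1) d1.
  have e2 := is_derive1_comp (g := fun th : R => pi / 2 - th) (dB _ l2) d2.
  have := is_deriveB_fun e1 e2.
  rewrite -[pi / 2 - th]opprB cosN sinN cosBpihalf sinBpihalf !opprK.
  set D := (X in is_derive _ _ _ X) => H.
  by have -> : (P (sin th, cos th) - P (sin th, - cos th)) * cos th = D by rewrite /D; ring.
transitivity (\int[mu]_(th in `[(- (pi / 2))%R, (pi / 2)%R])
    ((P (sin th, cos th) - P (sin th, - cos th)) * cos th)%:E)%E.
  by apply: eq_integral => th; rewrite inE /= in_itv /= => thI; rewrite cos_sin_sqrt.
rewrite (integral_derive _ dK); [|lra|].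
  rewrite /K subrr sub0r opprK -opprD -splitr.
  by congr (_%:E); ring.
move=> th thI; apply: cvgM; last exact: continuous_cos.
have Oc := on_circle (pi / 2 - th); have Od := on_circle (th - pi / 2).
rewrite -[pi / 2 - th]opprB cosN sinN cosBpihalf sinBpihalf opprK in Oc.
rewrite cosBpihalf sinBpihalf in Od.
apply: cvgB; apply: continuous_comp_pair; try exact: continuous_sin.
- exact: continuous_cos.
- exact: (smooth_on_continuous sP Oc).
- by apply: cvgN; exact: continuous_cos.
- exact: (smooth_on_continuous sP Od).
Qed.

(** A is a primitive of P dy along the circle. The right end of a horizontal chord has angle th and
    the left one pi - th, so the angles cover [-pi / 2, 3 pi / 2]. *)
Lemma green_x (A : R -> R) :
  (forall th : R, `|th| < 10 -> is_derive th 1 A (P (cos th, sin th) * cos th)) ->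
  (\int[(mu \x mu)%E]_(z in (disk : set RR)) ('D_(1, 0) P z)%:E =
   (A (pi + pi / 2) - A (- (pi / 2)))%:E)%E.
Proof.
move=> dA; rewrite integral_disk_x integral_sin_substitution; last first.
  move=> x x1; have [_ _ Oa Ob] := sqrt_disk x1.
  apply: cvgB; apply: continuous_comp_pair; try exact: cvg_id.
  - exact: continuous_sqrt_disk.
  - exact: (smooth_on_continuous sP Oa).
  - by apply: cvgN; exact: continuous_sqrt_disk.
  - exact: (smooth_on_continuous sP Ob).
have [p0 p2] := pihalf_bounds.
have cpi th : cos (pi - th) = - cos th by rewrite cosB cospi sinpi; ring.
have spi th : sin (pi - th) = sin th by rewrite sinB cospi sinpi; ring.
pose K (th : R) := A th - A (pi - th).
have dK (th : R) : - (pi / 2) <= th <= pi / 2 -> is_derive th 1 K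
    ((P (cos th, sin th) - P (- cos th, sin th)) * cos th).
  move=> /andP[th1 th2].
  have d2 : is_derive th 1 (fun th : R => pi - th) (-1).
    have := is_deriveB_fun (is_derive_cst (pi : R) th 1) (is_derive_id th 1).
    by rewrite sub0r.
  have l1 : `|th| < 10 by rewrite ltr_norml; lra.
  have l2 : `|pi - th| < 10 by rewrite ltr_norml; lra.
  have e2 := is_derive1_comp (g := fun th : R => pi - th) (dA _ l2) d2.
  have := is_deriveB_fun (dA _ l1) e2; rewrite cpi spi.
  set D := (X in is_derive _ _ _ X) => H.
  by have -> : (P (cos th, sin th) - P (- cos th, sin th)) * cos th = D by rewrite /D; ring.
transitivity (\int[mu]_(th in `[(- (pi / 2))%R, (pi / 2)%R])
    ((P (cos th, sin th) - P (- cos th, sin th)) * cos th)%:E)%E.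
  by apply: eq_integral => th; rewrite inE /= in_itv /= => thI; rewrite cos_sin_sqrt.
rewrite (integral_derive _ dK); [|lra|].
  have -> : K (pi / 2) = 0 by rewrite /K (_ : pi - pi / 2 = pi / 2) ?subrr//; lra.
  by rewrite /K opprK; congr (_%:E); ring.
move=> th thI; apply: cvgM; last exact: continuous_cos.
have Oc := on_circle th; have Od := on_circle (pi - th); rewrite cpi spi in Od.
apply: cvgB; apply: continuous_comp_pair; try exact: continuous_sin.
- exact: continuous_cos.
- exact: (smooth_on_continuous sP Oc).
- by apply: cvgN; exact: continuous_cos.
- exact: (smooth_on_continuous sP Od).
Qed.

End Green.

(** * Symmetry of second derivatives *)

Section MixedPartials.
Context {R : realType} {E : normedModType R}.
Variables (O : set E) (f : E -> R).
Hypotheses (oO : open O) (sf : smooth_on O f).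

Lemma mean_value (g dg : R -> R) (h : R) : 0 < h ->
  (forall t : R, 0 <= t <= h -> is_derive t 1 g (dg t)) ->
  exists2 t, 0 <= t <= h & g h - g 0 = dg t * h.
Proof.
move=> h0 Dg; have dg' (t : R) : t \in `]0, h[%R -> is_derive t 1 g (dg t).
  by rewrite in_itv /= => /andP[t0 th]; apply: Dg; rewrite !ltW.
have cg : {within `[0, h], continuous g}.
  apply: derivable_within_continuous => t; rewrite in_itv /= => th.
  by have [] := Dg t th.
have [t] := MVT h0 dg' cg.
by rewrite in_itv /= subr0 => /andP[t0 th] e; exists t; rewrite ?ltW.
Qed.

Lemma is_derive_line (g : E -> R) (z v : E) (t : R) : differentiable g (z + t *: v) ->
  is_derive t 1 (fun t => g (z + t *: v)) ('D_v g (z + t *: v)).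
Proof.
move=> dg; apply: (is_derive_comp_curve (g := fun t : R => z + t *: v)) => //.
have dl : is_derive t 1 (fun t : R => t *: v) v.
  have lv := clinear_scale v; have [dv _] := clinear_diff t lv.
  apply: DeriveDef; first exact/derivable1_diffP.
  by rewrite clinear_derive// scale1r.
have := is_deriveD (is_derive_cst z t 1) dl.
by rewrite add0r.
Qed.

(** The mean value theorem is applied along v to a difference in direction w, then along w. The left
    side is symmetric in v and w, so the same quantity is reached in the other order. *)
Lemma second_difference (z v w : E) (h : R) : 0 < h ->
  (forall s t : R, 0 <= s <= h -> 0 <= t <= h -> O (z + s *: v + t *: w)) ->
  exists s t, [/\ 0 <= s <= h, 0 <= t <= h &
    f (z + h *: v + h *: w) - f (z + h *: v) - f (z + h *: w) + f z =
    'D_w ('D_v f) (z + s *: v + t *: w) * h ^+ 2].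
Proof.
move=> h0 hO; have h00 : 0 <= h <= h by rewrite lexx ltW.
have h01 : 0 <= (0 : R) <= h by rewrite lexx ltW.
have [s sh e1] : exists2 s, 0 <= s <= h &
    (f (z + h *: w + h *: v) - f (z + h *: v)) - (f (z + h *: w + 0 *: v) - f (z + 0 *: v)) =
    ('D_v f (z + h *: w + s *: v) - 'D_v f (z + s *: v)) * h.
  apply: (@mean_value (fun s => f (z + h *: w + s *: v) - f (z + s *: v))
    (fun s => 'D_v f (z + h *: w + s *: v) - 'D_v f (z + s *: v)) h h0) => t th.
  apply: is_deriveB_fun; apply: is_derive_line; apply: (smooth_on_differentiable sf).
    by rewrite addrAC; exact: hO.
  by have := hO t 0 th h01; rewrite scale0r addr0.
have [t th e2] : exists2 t, 0 <= t <= h &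
    'D_v f (z + s *: v + h *: w) - 'D_v f (z + s *: v + 0 *: w) =
    'D_w ('D_v f) (z + s *: v + t *: w) * h.
  apply: (@mean_value (fun t => 'D_v f (z + s *: v + t *: w))
    (fun t => 'D_w ('D_v f) (z + s *: v + t *: w)) h h0) => t th.
  apply: is_derive_line; apply: (smooth_on_differentiable (smooth_on_derive v sf)).
  exact: hO.
exists s, t; split => //; rewrite expr2 mulrA -e2.
rewrite scale0r addr0 [z + s *: v + h *: w]addrAC -e1 !scale0r !addr0.
by rewrite [z + h *: w + h *: v]addrAC; ring.
Qed.

Lemma cont_dist (g : E -> R) (z : E) (e : R) : 0 < e -> {for z, continuous g} ->
  exists2 d : R, 0 < d & forall y, `|y - z| < d -> `|g y - g z| < e.
Proof.
move=> e0 /cvgrPdist_lt/(_ e e0)/nbhs_ballP[d /= d0 H]; exists d => // y yz.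
by rewrite distrC; apply: H; rewrite -ball_normE /= distrC.
Qed.

End MixedPartials.

(** The common second difference makes the two mixed derivatives take equal values at two points
    near z. If they differed at z by d, continuity would keep each within d / 2 of its value at z, a
    contradiction. *)
Lemma mixed_partials {R : realType} {E : normedModType R} (O : set E) (f : E -> R)
  (z v w : E) : open O -> smooth_on O f -> O z ->
  'D_w ('D_v f) z = 'D_v ('D_w f) z.
Proof.
move=> oO sf Oz; set g1 := 'D_w ('D_v f); set g2 := 'D_v ('D_w f).
apply/eqP; rewrite -subr_eq0 -normr_eq0; apply: contraT => d0.
have {}d0 : 0 < `|g1 z - g2 z| by rewrite lt_neqAle eq_sym d0 normr_ge0.
set d := `|g1 z - g2 z| in d0.
have d2 : 0 < d / 2 by rewrite divr_gt0.
have c1 : {for z, continuous g1}.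
  by apply: smooth_on_continuous Oz; do 2!apply: smooth_on_derive.
have c2 : {for z, continuous g2}.
  by apply: smooth_on_continuous Oz; do 2!apply: smooth_on_derive.
have [r1 r10 H1] := cont_dist d2 c1; have [r2 r20 H2] := cont_dist d2 c2.
have /nbhs_ballP[r3 /= r30 H3] := open_nbhs_nbhs (conj oO Oz).
pose r := Num.min r1 (Num.min r2 r3).
have r0 : 0 < r by rewrite !lt_min r10 r20.
have vw0 : 0 < `|v| + `|w| + 1 by rewrite ltr_wpDl// addr_ge0.
(* Keeps the whole parallelogram within distance r of z; the 1 covers v = w = 0. *)
pose h := r / (`|v| + `|w| + 1).
have h0 : 0 < h by rewrite divr_gt0.
have near s t : 0 <= s <= h -> 0 <= t <= h -> `|z + s *: v + t *: w - z| < r.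
  move=> /andP[s0 sh] /andP[t0 th].
  rewrite -[z + _ + _]addrA [_ - z]addrC addKr (le_lt_trans (ler_normD _ _))// !normrZ.
  rewrite (ger0_norm s0) (ger0_norm t0).
  apply: (@le_lt_trans _ _ (h * (`|v| + `|w|))).
    by rewrite mulrDr lerD// ler_wpM2r.
  by rewrite /h mulrAC ltr_pdivrMr// ltr_pM2l// ltrDl.
have inO s t : 0 <= s <= h -> 0 <= t <= h -> O (z + s *: v + t *: w).
  move=> sh th; apply: H3; rewrite -ball_normE /= distrC.
  by have := near s t sh th; rewrite !lt_min => /and3P[].
have inO' s t : 0 <= s <= h -> 0 <= t <= h -> O (z + s *: w + t *: v).
  by move=> sh th; rewrite addrAC; exact: inO.
have [s [t [sh th e1]]] := second_difference sf h0 inO.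
have [s' [t' [sh' th' e2]]] := second_difference sf h0 inO'.
have e : g1 (z + s *: v + t *: w) = g2 (z + s' *: w + t' *: v).
  have hh : h ^+ 2 != 0 by rewrite expf_neq0// gt_eqF.
  apply: (mulIf hh); rewrite -[LHS]e1 -[RHS]e2 [z + h *: w + h *: v]addrAC.
  by congr (_ + _); exact: addrAC.
have := near s t sh th; rewrite !lt_min => /and3P[n1 _ _].
have := near t' s' th' sh'; rewrite !lt_min => /and3P[_ n2 _].
rewrite [z + t' *: v + _]addrAC in n2.
have k1 := H1 _ n1; have k2 := H2 _ n2.
have k3 := ler_distD (g1 (z + s *: v + t *: w)) (g1 z) (g2 z).
rewrite -e in k2; rewrite distrC in k1.
have := le_lt_trans k3 (ltrD k1 k2).
by rewrite -splitr /d ltxx.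
Qed.

(** * The symplectic area as a boundary integral *)

Section Area.
Context {R : realType} {n : nat}.
Local Notation mu := (@lebesgue_measure R).
Local Notation RR := (measurableTypeR R * measurableTypeR R)%type.

Lemma qc_comb (a b : R) (x y : 'rV[R]_(n + n)) l :
  qc (a *: x + b *: y) l = a * qc x l + b * qc y l.
Proof. by rewrite /qc !mxE. Qed.

Lemma pc_comb (a b : R) (x y : 'rV[R]_(n + n)) l :
  pc (a *: x + b *: y) l = a * pc x l + b * pc y l.
Proof. by rewrite /pc !mxE. Qed.

Variables (O : set (R * R)) (u : R * R -> 'rV[R]_(n + n)).
Hypotheses (oO : open O) (DO : disk `<=` O) (su : smooth_on O u).

Let q l z := qc (u z) l.
Let p l z := pc (u z) l.

Lemma smooth_q l : smooth_on O (q l).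
Proof.
by apply: (smooth_on_post (L := fun w : 'rV[R]_(n + n) => qc w l)) => //; exact: clinear_qc.
Qed.

Lemma smooth_p l : smooth_on O (p l).
Proof.
by apply: (smooth_on_post (L := fun w : 'rV[R]_(n + n) => pc w l)) => //; exact: clinear_pc.
Qed.

(** The pullback under u of the one-form q dp - p dq, evaluated on v. *)
Let form v z := \sum_l (q l z * 'D_v (p l) z - p l z * 'D_v (q l) z).

Lemma smooth_form v : smooth_on O (form v).
Proof.
apply: smooth_on_sum => // l; apply: smooth_onB => //; apply: smooth_onM => //;
  do ?[exact: smooth_q|exact: smooth_p]; apply: smooth_on_derive;
  do ?[exact: smooth_q|exact: smooth_p].
Qed.

Lemma derive_form v w z : O z -> 'D_w (form v) z =
  \sum_l (q l z * 'D_w ('D_v (p l)) z + 'D_v (p l) z * 'D_w (q l) z -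
    (p l z * 'D_w ('D_v (q l)) z + 'D_v (q l) z * 'D_w (p l) z)).
Proof.
move=> Oz; have dO (f : R * R -> R) : smooth_on O f -> is_derive z w f ('D_w f z).
  by move=> sf; apply/derivableP/diff_derivable; exact: (smooth_on_differentiable sf).
have H : is_derive z w (form v) (\sum_l (q l z * 'D_w ('D_v (p l)) z + 'D_v (p l) z * 'D_w (q l) z -
    (p l z * 'D_w ('D_v (q l)) z + 'D_v (q l) z * 'D_w (p l) z))).
  apply: is_derive_sum_fun => l; apply: is_deriveB_fun; apply: is_deriveM_fun; apply: dO.
  - exact: smooth_q.
  - by apply: smooth_on_derive; exact: smooth_p.
  - exact: smooth_p.
  - by apply: smooth_on_derive; exact: smooth_q.
by have [_ ->] := H.
Qed.

(** The coordinate form of d(q dp - p dq) = 2 dq /\ dp: once the mixed derivatives are identified,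
    [axy] and [bxy] cancel. *)
Lemma curl_algebra (a b ax ay bx by' axy bxy : R) : ax * by' - bx * ay =
  2^-1 * (a * bxy + by' * ax - (b * axy + ay * bx) - (a * bxy + bx * ay - (b * axy + ax * by'))).
Proof. by field. Qed.

Lemma boundary_algebra (a b ax ay bx by' c s : R) :
  (a * by' - b * ay) * c - (a * bx - b * ax) * s =
  a * (- s * bx + c * by') - b * (- s * ax + c * ay).
Proof. by ring. Qed.

Lemma curl_form z : O z ->
  omega0 ('D_(1, 0) u z) ('D_(0, 1) u z) =
  2^-1 * ('D_(1, 0) (form (0, 1)) z - 'D_(0, 1) (form (1, 0)) z).
Proof.
move=> Oz; rewrite !derive_form// -sumrB mulr_sumr omega0E; apply: eq_bigr => l _.
have du := smooth_on_differentiable su Oz.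
have qE v : qc ('D_v u z) l = 'D_v (q l) z.
  by rewrite -(derive_post (L := fun w : 'rV[R]_(n + n) => qc w l))//; exact: clinear_qc.
have pE v : pc ('D_v u z) l = 'D_v (p l) z.
  by rewrite -(derive_post (L := fun w : 'rV[R]_(n + n) => pc w l))//; exact: clinear_pc.
transitivity ('D_(1, 0) (q l) z * 'D_(0, 1) (p l) z - 'D_(1, 0) (p l) z * 'D_(0, 1) (q l) z).
  by congr (_ * _ - _ * _); [exact: qE|exact: pE|exact: pE|exact: qE].
rewrite (mixed_partials ((0, 1) : R * R) ((1, 0) : R * R) oO (smooth_q l) Oz).
rewrite (mixed_partials ((0, 1) : R * R) ((1, 0) : R * R) oO (smooth_p l) Oz).
exact: curl_algebra.
Qed.

Lemma period_shift (F f : R -> R) (a b : R) : a <= b ->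
  (forall t : R, a <= t <= b -> is_derive t 1 F (f t)) ->
  (forall t : R, a <= t <= b -> is_derive (t + pi *+ 2) 1 F (f t)) ->
  F (b + pi *+ 2) - F (a + pi *+ 2) = F b - F a.
Proof.
move=> ab dF dF'; pose g t := F (t + pi *+ 2) - F t.
have dg (t : R) : a <= t <= b -> is_derive t 1 g 0.
  move=> tI; have ds : is_derive t 1 (fun t : R => t + pi *+ 2) 1.
    have := is_deriveD_fun (is_derive_id t 1) (is_derive_cst (pi *+ 2 : R) t 1).
    by rewrite addr0.
  have := is_deriveB_fun (is_derive1_comp (g := fun t : R => t + pi *+ 2) (dF' t tI) ds) (dF t tI).
  by rewrite mulr1 subrr.
have := is_derive0_segment ab dg; rewrite /g; lra.
Qed.

(** Green's formula delivers the two halves over different intervals of length 2 pi; periodicity of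
    the integrand moves both to [0, 2 pi]. *)
Lemma primitive_period (F f : R -> R) :
  (forall t : R, `|t| < 10 -> is_derive t 1 F (f t)) ->
  (forall t, f (t + pi *+ 2) = f t) ->
  F (pi + pi / 2) - F (- (pi / 2)) = F (pi *+ 2) - F 0 /\
  F pi - F (- pi) = F (pi *+ 2) - F 0.
Proof.
move=> dF per; have [p0 p2] := @pihalf_bounds R.
have p2E : pi *+ 2 = pi / 2 + pi / 2 + pi / 2 + pi / 2 :> R by rewrite mulr2n; lra.
have key (a : R) : - pi <= a <= 0 -> F (pi *+ 2) - F (a + pi *+ 2) = F 0 - F a.
  move=> /andP[a1 a0].
  have d1 (t : R) : a <= t <= 0 -> is_derive t 1 F (f t).
    by move=> /andP[t0 t1]; apply: dF; rewrite ltr_norml; lra.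
  have d2 (t : R) : a <= t <= 0 -> is_derive (t + pi *+ 2) 1 F (f t).
    by move=> /andP[t0 t1]; rewrite -per; apply: dF; rewrite ltr_norml; lra.
  by have := period_shift a0 d1 d2; rewrite add0r.
split.
  have -> : pi + pi / 2 = - (pi / 2) + pi *+ 2 :> R by lra.
  by have := key (- (pi / 2)) _; lra.
have -> : F pi = F (- pi + pi *+ 2) by congr F; lra.
by have := key (- pi) _; lra.
Qed.

(* The boundary integral of q dp - p dq is written through a primitive [G] of its
   integrand in the angle. *)
Lemma symp_area_boundary : exists G : R -> R,
  (forall t : R, 0 <= t <= pi *+ 2 -> exists u' : 'rV[R]_(n + n),
    is_derive t 1 (fun t => u (cos t, sin t)) u' /\
    is_derive t 1 G (\sum_l (qc (u (cos t, sin t)) l * pc u' l -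
      pc (u (cos t, sin t)) l * qc u' l))) /\
  symp_area u = 2^-1 * (G (pi *+ 2) - G 0).
Proof.
have [p0 p2] := @pihalf_bounds R.
have cont v : continuous (fun t => form v (cos t, sin t)).
  by move=> t; exact: (continuous_on_circle DO (smooth_form v)).
have [A dA] : exists A : R -> R, forall t : R, `|t| < 10 ->
    is_derive t 1 A (form (0, 1) (cos t, sin t) * cos t).
  apply: primitive_exists => t; apply: cvgM; [exact: cont|exact: continuous_cos].
have [B dB] : exists B : R -> R, forall t : R, `|t| < 10 ->
    is_derive t 1 B (form (1, 0) (cos t, sin t) * sin t).
  apply: primitive_exists => t; apply: cvgM; [exact: cont|exact: continuous_sin].
have gx := green_x DO (smooth_form (0, 1)) dA.
have gy := green_y DO (smooth_form (1, 0)) dB.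
(* By linearity of the form in its vector, the derivative of A - B is its value on the velocity (-
   sin t, cos t) of the circle. *)
exists (fun t => A t - B t); split.
  move=> t /andP[t0 t2]; have t10 : `|t| < 10 by rewrite ger0_norm//; lra.
  have dc : is_derive t 1 (fun t => (cos t, sin t)) (- sin t, cos t).
    exact: is_derive_pair.
  have Oc := on_circle DO t.
  pose u' := 'D_(- sin t, cos t) u (cos t, sin t).
  exists u'; split.
    apply: (is_derive_comp_curve (g := fun t => (cos t, sin t))) => //.
    exact: (smooth_on_differentiable su).
  have := is_deriveB_fun (dA t t10) (dB t t10).
  set D := (X in is_derive _ _ _ X); set D' := (X in _ -> is_derive _ _ _ X).
  suff -> : D = D' by [].
  have du := smooth_on_differentiable su Oc.
  have u'E : u' = - sin t *: 'D_(1, 0) u (cos t, sin t) + cos t *: 'D_(0, 1) u (cos t, sin t).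
    rewrite /u' !(deriveE _ du) -!linearZ -linearD /=; congr ('d u _ _).
    by congr pair => /=; rewrite /GRing.scale /= ?mulr0 ?mulr1 ?addr0 ?add0r.
  have qE l v : qc ('D_v u (cos t, sin t)) l = 'D_v (q l) (cos t, sin t).
    by rewrite -(derive_post (L := fun w : 'rV[R]_(n + n) => qc w l))//; exact: clinear_qc.
  have pE l v : pc ('D_v u (cos t, sin t)) l = 'D_v (p l) (cos t, sin t).
    by rewrite -(derive_post (L := fun w : 'rV[R]_(n + n) => pc w l))//; exact: clinear_pc.
  rewrite /D /D' /form !mulr_suml -sumrB; apply: eq_bigr => l _.
  have -> : pc u' l = - sin t * 'D_(1, 0) (p l) (cos t, sin t) + cos t * 'D_(0, 1) (p l) (cos t, sin t).
    by rewrite u'E pc_comb; congr (_ * _ + _ * _); exact: pE.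
  have -> : qc u' l = - sin t * 'D_(1, 0) (q l) (cos t, sin t) + cos t * 'D_(0, 1) (q l) (cos t, sin t).
    by rewrite u'E qc_comb; congr (_ * _ + _ * _); exact: qE.
  exact: boundary_algebra.
have mD := @measurable_disk R.
pose f1 := 'D_(1, 0) (form (0, 1)); pose f2 := 'D_(0, 1) (form (1, 0)).
have I1 : (mu \x mu)%E.-integrable (disk : set RR) (EFin \o f1).
  apply: integrable_disk => z /DO; apply: smooth_on_continuous.
  by apply: smooth_on_derive; exact: smooth_form.
have I2 : (mu \x mu)%E.-integrable (disk : set RR) (EFin \o f2).
  apply: integrable_disk => z /DO; apply: smooth_on_continuous.
  by apply: smooth_on_derive; exact: smooth_form.
rewrite /symp_area.
transitivity (\int[(mu \x mu)%E]_(z in (disk : set RR))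
    (2^-1 * (f1 z - f2 z))).
  by apply: eq_Rintegral => z; rewrite inE => /DO; exact: curl_form.
rewrite RintegralZl//; last exact: (integrableB mD I1 I2).
rewrite (RintegralB mD I1 I2).
have e1 : \int[(mu \x mu)%E]_(z in (disk : set RR)) f1 z = A (pi + pi / 2) - A (- (pi / 2)).
  by rewrite /Rintegral /f1 gx.
have e2 : \int[(mu \x mu)%E]_(z in (disk : set RR)) f2 z = B pi - B (- pi).
  by rewrite /Rintegral /f2 gy.
transitivity (2^-1 * (A (pi + pi / 2) - A (- (pi / 2)) - (B pi - B (- pi)))).
  by congr (_ * (_ - _)); [exact: e1|exact: e2].
have [eA _] := primitive_period dA (fun t => congr2 *%R
  (congr1 (form (0, 1)) (congr2 pair (cosD2pi t) (sinD2pi t))) (cosD2pi t)).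
have [_ eB] := primitive_period dB (fun t => congr2 *%R
  (congr1 (form (1, 0)) (congr2 pair (cosD2pi t) (sinD2pi t))) (sinD2pi t)).
by rewrite eA eB; ring.
Qed.

End Area.

(** * Winding numbers *)

Section Winding.
Context {R : realType}.
Implicit Types (k m n : nat).

Lemma cos_eq1 (x : R) : cos x = 1 -> exists k : int, x = k%:~R * (pi *+ 2).
Proof.
have pi20 : 0 < pi *+ 2 :> R by rewrite mulrn_wgt0// pi_gt0.
pose k := Num.floor (x / (pi *+ 2)); pose y := x - k%:~R * (pi *+ 2).
have perz (z : R) (j : int) : cos (z + j%:~R * (pi *+ 2)) = cos z.
  have pern (w : R) (i : nat) : cos (w + i%:R * (pi *+ 2)) = cos w.
    by rewrite mulr_natl; exact: (periodicn (@cosD2pi R)).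
  case: j => i; first exact: pern.
  by rewrite NegzE mulrNz mulNr -[in RHS](subrK (i.+1%:R * (pi *+ 2)) z) pern.
move=> x1; have y1 : cos y = 1.
  by rewrite -x1 -[in RHS](subrK (k%:~R * (pi *+ 2)) x) perz.
have y0 : 0 <= y.
  by rewrite subr_ge0 -ler_pdivlMr// floor_le_tmp.
have y2 : y < pi *+ 2.
  rewrite ltrBlDr -{1}[pi *+ 2]mul1r -mulrDl -ltr_pdivrMr//.
  by have := floorD1_gt (x / (pi *+ 2)); rewrite intrD addrC.
exists k; apply/eqP; rewrite -subr_eq0 -/y; apply/eqP.
have [yp|yp] := leP y pi.
  by apply: (@cos_inj R); rewrite ?in_itv /= ?y0 ?yp ?lexx ?pi_ge0// y1 cos0.
(* In the second half of the period, reflection brings y into [0, pi], where cosine is injective; y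
   = 2 pi is then excluded. *)
have : pi *+ 2 - y = 0.
  apply: (@cos_inj R); rewrite ?in_itv /= ?lexx ?pi_ge0//.
    by rewrite mulr2n in y2 *; lra.
  by rewrite cos0 -y1 -(cosN y) -[in RHS](cosD2pi (- y)) addrC.
by move/eqP; rewrite subr_eq0 => /eqP e; move: y2; rewrite e ltxx.
Qed.

(** Turning the vector (l1, l2) back by the accumulated angle phi = G - G 0 gives (a, b), which has
    derivative 0. Comparing a closed loop at its two ends yields cos phi(T) = 1. *)
Lemma winding_number (l1 l2 G : R -> R) (T : R) : 0 <= T ->
  (forall t, l1 t ^+ 2 + l2 t ^+ 2 = 1) -> l1 T = l1 0 -> l2 T = l2 0 ->
  (forall t : R, 0 <= t <= T -> exists d1 d2, [/\ is_derive t 1 l1 d1, is_derive t 1 l2 d2 &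
    is_derive t 1 G (l1 t * d2 - l2 t * d1)]) ->
  exists k : int, G T - G 0 = k%:~R * (pi *+ 2).
Proof.
move=> T0 l1l2 e1 e2 dG; pose phi t := G t - G 0.
pose a t := l1 t * cos (phi t) + l2 t * sin (phi t).
pose b t := l2 t * cos (phi t) - l1 t * sin (phi t).
have dab (t : R) : 0 <= t <= T -> is_derive t 1 a 0 /\ is_derive t 1 b 0.
  move=> /dG[d1 [d2 [D1 D2 DG]]].
  have Dphi := is_deriveB_fun DG (is_derive_cst (G 0) t 1).
  have Dc := is_derive1_comp (f := cos) (is_derive_cos _) Dphi.
  have Ds := is_derive1_comp (f := sin) (is_derive_sin _) Dphi.
  have orth : l1 t * d1 + l2 t * d2 = 0.
    have H := is_deriveD_fun (is_derive_sqr D1) (is_derive_sqr D2).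
    have n1 : \forall s \near t, l1 s ^+ 2 + l2 s ^+ 2 = 1 by exact: filterE.
    by have := derive_near_cst n1 H; lra.
  have u := l1l2 t.
  (* The velocity of a unit vector is orthogonal to it, hence equals the angular speed times (- l2,
     l1). *)
  have d1E : d1 = - l2 t * (l1 t * d2 - l2 t * d1).
    transitivity (d1 * (l1 t ^+ 2 + l2 t ^+ 2) - l1 t * (l1 t * d1 + l2 t * d2)).
      by rewrite u orth; ring.
    by ring.
  have d2E : d2 = l1 t * (l1 t * d2 - l2 t * d1).
    transitivity (d2 * (l1 t ^+ 2 + l2 t ^+ 2) - l2 t * (l1 t * d1 + l2 t * d2)).
      by rewrite u orth; ring.
    by ring.
  move: (l1 t * d2 - l2 t * d1) d1E d2E Dc Ds => w d1E d2E Dc Ds; split.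
    have := is_deriveD_fun (is_deriveM_fun D1 Dc) (is_deriveM_fun D2 Ds).
    rewrite d1E d2E /= subr0; set D := (X in is_derive _ _ _ X -> _).
    by have -> : D = 0 by rewrite /D; ring.
  have := is_deriveB_fun (is_deriveM_fun D2 Dc) (is_deriveM_fun D1 Ds).
  rewrite d1E d2E /= subr0; set D := (X in is_derive _ _ _ X -> _).
  by have -> : D = 0 by rewrite /D; ring.
have aT : a T = a 0 by apply: is_derive0_segment => // t /dab[].
have bT : b T = b 0 by apply: is_derive0_segment => // t /dab[].
move: aT bT; rewrite /a /b /phi subrr cos0 sin0 e1 e2 !mulr1 !mulr0 addr0 subr0.
move=> aT bT; apply: cos_eq1; rewrite -[RHS](l1l2 0).
transitivity ((l1 0 ^+ 2 + l2 0 ^+ 2) * cos (G T - G 0)); first by rewrite l1l2 mul1r.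
transitivity (l1 0 * (l1 0 * cos (G T - G 0) + l2 0 * sin (G T - G 0)) +
  l2 0 * (l2 0 * cos (G T - G 0) - l1 0 * sin (G T - G 0))); first by ring.
by rewrite aT bT; ring.
Qed.

Definition action_form k (x v : 'rV[R]_(k + k)) : R :=
  \sum_l (qc x l * pc v l - pc x l * qc v l).

(* The action form along the loop g is kappa times the angle form of an
   S^1-valued loop. *)
Definition angular k (kappa : R) (g : R -> 'rV[R]_(k + k)) : Prop :=
  exists l1 l2 : R -> R, [/\ forall t, l1 t ^+ 2 + l2 t ^+ 2 = 1,
    l1 (pi *+ 2) = l1 0, l2 (pi *+ 2) = l2 0 &
    forall (t : R) v, is_derive t 1 g v -> exists d1 d2,
      [/\ is_derive t 1 l1 d1, is_derive t 1 l2 d2 &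
          action_form (g t) v = kappa * (l1 t * d2 - l2 t * d1)]].

(** The derivatives of l1 and l2 come from their quadratic formulas in g. The phase e^{it} = c + is
    enters only pointwise, to verify the final identity coordinate by coordinate, so it need not be
    chosen continuously. *)
Lemma angular_lagr k (a : R) (g : R -> 'rV[R]_(k + k)) : a != 0 ->
  (forall t, lagr a (g t)) -> g (pi *+ 2) = g 0 -> angular (a ^+ 2 / 2) g.
Proof.
move=> a0 ga g2; have aa : a ^+ 2 != 0 by rewrite expf_neq0.
pose l1 t := (\sum_l (qc (g t) l ^+ 2 - pc (g t) l ^+ 2)) / a ^+ 2.
pose l2 t := (\sum_l 2 * (qc (g t) l * pc (g t) l)) / a ^+ 2.
have pt t : exists c s (y : 'I_k -> R), [/\ c ^+ 2 + s ^+ 2 = 1, l1 t = c ^+ 2 - s ^+ 2,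
    l2 t = 2 * (c * s) & g t = mkc (fun l => c * y l) (fun l => s * y l)].
  have [c [s [y [cs ya gE]]]] := (lagrP _ a0).1 (ga t).
  exists c, s, y; split => //; apply: (mulIf aa); rewrite divfK// -ya mulr_sumr;
    by apply: eq_bigr => l _; rewrite gE qcE pcE; ring.
exists l1, l2; split.
- move=> t; have [c [s [y [cs -> -> _]]]] := pt t.
  by transitivity ((c ^+ 2 + s ^+ 2) ^+ 2); [ring|rewrite cs expr1n].
- by rewrite /l1 g2.
- by rewrite /l2 g2.
move=> t v dg; have dq l := is_derive_qc l dg; have dp l := is_derive_pc l dg.
exists ((\sum_l (2 * (qc (g t) l * qc v l) - 2 * (pc (g t) l * pc v l))) / a ^+ 2).
exists ((\sum_l 2 * (qc (g t) l * pc v l + pc (g t) l * qc v l)) / a ^+ 2); split.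
- apply: is_deriveMr_fun; apply: is_derive_sum_fun => l.
  by apply: is_deriveB_fun; apply: is_derive_sqr.
- apply: is_deriveMr_fun; apply: is_derive_sum_fun => l.
  by apply: is_deriveMl_fun; apply: is_deriveM_fun.
have [c [s [y [cs -> -> gE]]]] := pt t.
rewrite [RHS](_ : _ = 2^-1 * ((c ^+ 2 - s ^+ 2) *
    (\sum_l 2 * (qc (g t) l * pc v l + pc (g t) l * qc v l)) - 2 * (c * s) *
    (\sum_l (2 * (qc (g t) l * qc v l) - 2 * (pc (g t) l * pc v l))))); last by field.
rewrite [X in 2^-1 * (X - _)]mulr_sumr [X in 2^-1 * (_ - X)]mulr_sumr -sumrB mulr_sumr.
apply: eq_bigr => l _.
rewrite gE !qcE !pcE.
transitivity ((c ^+ 2 + s ^+ 2) * (c * y l * pc v l - s * y l * qc v l)).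
  by rewrite cs mul1r.
by field.
Qed.

(** The S^1-valued loop is the scalar lambda = c + is with g = lambda w, and the action form is
    |w|^2 times its angle form. *)
Lemma angular_hopf k (b : R) (w : 'rV[R]_(k + k)) (g : R -> 'rV[R]_(k + k)) : b != 0 ->
  (forall t, hopf b (w, g t)) -> g (pi *+ 2) = g 0 -> angular (b ^+ 2) g.
Proof.
move=> b0 gb g2; have bb : b ^+ 2 != 0 by rewrite expf_neq0.
have wb : sqn w = b ^+ 2 by have [] := gb 0.
pose c (v : 'rV[R]_(k + k)) := (\sum_l (qc w l * qc v l + pc w l * pc v l)) / b ^+ 2.
pose s (v : 'rV[R]_(k + k)) := (\sum_l (qc w l * pc v l - pc w l * qc v l)) / b ^+ 2.
have cs_rot c' s' : c (crot c' s' w) = c' /\ s (crot c' s' w) = s'.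
  split; apply: (mulIf bb); rewrite divfK// -wb sqn_qp mulr_sumr;
    by apply: eq_bigr => l _; rewrite /crot qcE pcE; ring.
have gE t : g t = crot (c (g t)) (s (g t)) w /\ c (g t) ^+ 2 + s (g t) ^+ 2 = 1.
  have [_ [c' [s' [cs /= ->]]]] := (hopfP _ b0).1 (gb t).
  by have [-> ->] := cs_rot c' s'.
have dc (t : R) v : is_derive t 1 g v -> is_derive t 1 (fun t => c (g t)) (c v).
  move=> dg; apply: is_deriveMr_fun; apply: is_derive_sum_fun => l.
  by apply: is_deriveD_fun; apply: is_deriveMl_fun; [exact: is_derive_qc|exact: is_derive_pc].
have ds (t : R) v : is_derive t 1 g v -> is_derive t 1 (fun t => s (g t)) (s v).
  move=> dg; apply: is_deriveMr_fun; apply: is_derive_sum_fun => l.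
  by apply: is_deriveB_fun; apply: is_deriveMl_fun; [exact: is_derive_pc|exact: is_derive_qc].
exists (fun t => c (g t)), (fun t => s (g t)); split.
- by move=> t; have [] := gE t.
- by rewrite g2.
- by rewrite g2.
move=> t v dg; exists (c v), (s v); split; [exact: dc|exact: ds|].
have Dc := dc t v dg; have Ds := ds t v dg.
(* c and s are linear, so differentiating g = lambda w shows that v is lambda' w with lambda' = c v
   + i s v. *)
have vE : v = crot (c v) (s v) w.
  have dr : is_derive t 1 g (crot (c v) (s v) w).
    rewrite {1}(_ : g = fun t => crot (c (g t)) (s (g t)) w); last first.
      by apply/funext => r; have [] := gE r.
    apply: is_derive_mkc => l.
      by apply: is_deriveB_fun; exact: is_deriveMr_fun.
    by apply: is_deriveD_fun; exact: is_deriveMr_fun.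
  by have [_ E1] := dg; have [_ E2] := dr; rewrite -E2; exact: esym E1.
rewrite -wb sqn_qp mulr_suml; apply: eq_bigr => l _.
have [e _] := gE t; rewrite {1 2}e [in X in _ * X - _]vE [in X in _ - _ * X]vE.
by rewrite /crot !qcE !pcE; ring.
Qed.

Lemma action_form_parts k m (x v : 'rV[R]_((k + m) + (k + m))) :
  action_form x v = action_form (fst_part x) (fst_part v) +
    action_form (snd_part x) (snd_part v).
Proof.
rewrite /action_form big_split_ord; congr (_ + _); apply: eq_bigr => l _.
  by rewrite !qcE !pcE.
by rewrite !qcE !pcE.
Qed.

Lemma is_derive_post (E F : normedModType R) (L : E -> F) (g : R -> E) (t : R) v :
  clinear L -> is_derive t 1 g v -> is_derive t 1 (fun t => L (g t)) (L v).
Proof.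
move=> lL [dg <-]; have dg' : differentiable g t by apply/derivable1_diffP.
apply: DeriveDef; last exact: derive_post.
by apply/derivable1_diffP; apply: differentiable_comp => //; exact: (clinear_diff _ lL).1.
Qed.

(* The product of two S^1-valued loops has as angle form the sum of theirs. *)
Lemma angular_prod k m (kappa : R) (g : R -> 'rV[R]_((k + m) + (k + m))) :
  angular kappa (fun t => fst_part (g t)) -> angular kappa (fun t => snd_part (g t)) ->
  angular kappa g.
Proof.
move=> [a [b [ab a2 b2 dab]]] [c [d [cd c2 d2 dcd]]].
exists (fun t => a t * c t - b t * d t), (fun t => a t * d t + b t * c t); split.
- move=> t; transitivity ((a t ^+ 2 + b t ^+ 2) * (c t ^+ 2 + d t ^+ 2)); first by ring.
  by rewrite ab cd mulr1.
- by rewrite a2 b2 c2 d2.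
- by rewrite a2 b2 c2 d2.
move=> t v dg.
have [a' [b' [Da Db e1]]] := dab t _ (is_derive_post (@clinear_fst_part R k m) dg).
have [c' [d' [Dc Dd e2]]] := dcd t _ (is_derive_post (@clinear_snd_part R k m) dg).
exists (a t * c' + c t * a' - (b t * d' + d t * b')).
exists (a t * d' + d t * a' + (b t * c' + c t * b')); split.
- by apply: is_deriveB_fun; exact: is_deriveM_fun.
- by apply: is_deriveD_fun; exact: is_deriveM_fun.
rewrite action_form_parts e1 e2 -mulrDr; congr (_ * _).
transitivity ((c t ^+ 2 + d t ^+ 2) * (a t * b' - b t * a') +
  (a t ^+ 2 + b t ^+ 2) * (c t * d' - d t * c')); first by rewrite ab cd !mul1r.
by ring.
Qed.

Lemma minimal_area_ge n (kappa : R) (M N : set 'rV[R]_(n + n)) : 0 < kappa ->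
  (forall F (g : R -> 'rV[R]_(n + n)), isotropic_leaf N F -> (forall t, F (g t)) ->
     g (pi *+ 2) = g 0 -> angular kappa g) ->
  ((kappa * pi)%:E <= minimal_area M N)%E.
Proof.
move=> k0 ang; apply: le_ereal_inf_tmp => _ [x [[u [[A [ oA DA su]] _ [F leafF uF] xE]] /= x0] <-].
rewrite lee_fin.
have [G [dG area]] := symp_area_boundary oA DA su.
pose g (t : R) := u (cos t, sin t).
have gF t : F (g t) by apply: uF; exists (cos t, sin t) => //; rewrite /circle /= cos2Dsin2.
have g2 : g (pi *+ 2) = g 0 by rewrite /g cos2pi sin2pi cos0 sin0.
have [l1 [l2 [l12 e1 e2 dl]]] := ang F g leafF gF g2.
have pi20 : 0 <= pi *+ 2 :> R by rewrite mulrn_wge0// pi_ge0.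
have [|k kE] := @winding_number l1 l2 (fun t => kappa^-1 * G t) (pi *+ 2) pi20 l12 e1 e2.
  move=> t tI; have [v [dg dGt]] := dG t tI; have [d1 [d2 [D1 D2 e]]] := dl t v dg.
  exists d1, d2; split => //.
  have := is_deriveMl_fun kappa^-1 dGt.
  by rewrite -/(action_form _ _) e mulKf// gt_eqF.
have xk : x = kappa * pi * k%:~R.
  rewrite xE area; have kn0 : kappa != 0 by rewrite gt_eqF.
  have -> : G (pi *+ 2) - G 0 = kappa * (k%:~R * (pi *+ 2)).
    by rewrite -kE mulrBr !mulVKf.
  by rewrite mulr2n; field.
have kp0 : 0 < kappa * pi by rewrite mulr_gt0// pi_gt0.
rewrite xk ler_peMr ?(ltW kp0)// ler1z; move: x0; rewrite xk pmulr_rgt0// ltr0z.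
by [].
Qed.

End Winding.

(** * The capacity bounds *)

Section Capacities.
Context {R : realType}.
Implicit Types (k m n : nat).

Lemma lagr_nonempty k (a : R) : (0 < k)%N -> 0 < a -> exists x : 'rV[R]_(k + k), lagr a x.
Proof.
case: k => // k _ a0; pose y (l : 'I_k.+1) := if l == ord0 then a else 0.
exists (mkc (fun l => 1 * y l) (fun l => 0 * y l)); apply/lagrP; first by rewrite gt_eqF.
exists 1, 0, y; split => //; first by rewrite expr1n expr0n addr0.
rewrite (bigD1 ord0)//= big1 ?addr0 /y//= => l /negbTE ->.
by rewrite expr0n.
Qed.

Lemma closed_isotropy_lagr k (a : R) : 0 < a ->
  closed (isotropy_relation (lagr a : set 'rV[R]_(k + k))).
Proof.
move=> a0; rewrite isotropy_relation_lagr//.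
rewrite (_ : _ `*` _ = fst @^-1` lagr a `&` snd @^-1` lagr a)//.
apply: closedI; apply: closed_clinear_preimage; do ?exact: closed_lagr.
  exact: clinear_fst.
exact: clinear_snd.
Qed.

Lemma le_capacity n d (N : set 'rV[R]_(n + n)) (M : set 'rV[R]_(n + n)) (x : \bar R) :
  admissible_coisotropic d M N -> (x <= minimal_area M N)%E ->
  (x <= coiso_capacity d M)%E.
Proof.
move=> aN xN; apply: le_trans xN _; apply: ereal_sup_ubound; right.
by exists N.
Qed.

Lemma le_limit (c : R) (x : \bar R) : 0 < c ->
  (forall r : R, 0 < r -> r < 1 -> ((r * c)%:E <= x)%E) -> (c%:E <= x)%E.
Proof.
move=> c0 H; apply/lee_addgt0Pr => e e0.
(* e / c makes the loss t c at most e, and 1 / 2 keeps 1 - t positive. *)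
pose t := Num.min (e / c) (2^-1).
have t0 : 0 < t by rewrite lt_min divr_gt0//= invr_gt0.
have t1 : t <= 2^-1 by rewrite ge_min lexx orbT.
have te : t * c <= e by rewrite -ler_pdivlMr// ge_min lexx.
have := H (1 - t); rewrite subr_gt0 gtrBl => /(_ _ t0) tc.
apply: (@le_trans _ _ ((((1 - t) * c)%:E) + e%:E)%E).
  by rewrite -EFinD lee_fin; lra.
by apply: leeD => //; apply: tc; lra.
Qed.

Lemma lagr_capacity n (r : R) : (0 < n)%N -> 0 < r -> r < 1 ->
  ((r * (pi / 2))%:E <= Lag_capacity (unit_ball R n))%E.
Proof.
move=> n0 r0 r1; pose a := Num.sqrt r.
have a0 : 0 < a by rewrite sqrtr_gt0.
have an0 : a != 0 by rewrite gt_eqF.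
have ar : a ^+ 2 = r by rewrite sqr_sqrtr// ltW.
have isoE := @isotropy_relation_lagr R n a a0.
have -> : r * (pi / 2) = a ^+ 2 / 2 * pi by rewrite ar; ring.
apply: (le_capacity (N := lagr a)).
  apply: (@admissible_unit_ball _ _ _ (n + n)).
  - exact: lagr_nonempty.
  - by move=> x [xa _]; rewrite /unit_ball /= -/(sqn x) xa ar.
  - exact: closed_lagr.
  - by move=> x xa; exact: submanifold_at_lagr.
  - exact: coisotropic_lagr.
  - exact: closed_isotropy_lagr.
  - rewrite isoE => -[x y] [/= xa ya].
    by apply: submanifold_at_prod; try exact: has_coords_rV; exact: submanifold_at_lagr.
apply: minimal_area_ge; first by rewrite divr_gt0// exprn_gt0.
move=> F g [x0 _ ->] gF g2; apply: angular_lagr => // t.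
by have := gF t; rewrite /= isoE => -[].
Qed.

Lemma coisotropic_capacity k m (r : R) : (0 < k)%N -> (0 < m)%N -> 0 < r -> r < 1 ->
  ((r * (pi / 3))%:E <= coiso_capacity (k + (m + m).-1) (unit_ball R (k + m)))%E.
Proof.
move=> k0 m0 r0 r1; pose a := Num.sqrt (2 * r / 3); pose b := Num.sqrt (r / 3).
have a0 : 0 < a by rewrite sqrtr_gt0; lra.
have b0 : 0 < b by rewrite sqrtr_gt0; lra.
have an0 : a != 0 by rewrite gt_eqF.
have bn0 : b != 0 by rewrite gt_eqF.
have ar : a ^+ 2 = 2 * r / 3 by rewrite sqr_sqrtr//; lra.
have br : b ^+ 2 = r / 3 by rewrite sqr_sqrtr//; lra.
have ab : a ^+ 2 / 2 = b ^+ 2 by rewrite ar br; field.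
have isoL := @isotropy_relation_lagr R k a a0.
have isoS := @isotropy_relation_sphere R m b b0.
have -> : r * (pi / 3) = b ^+ 2 * pi by rewrite br; ring.
pose N := prodset (lagr a : set 'rV[R]_(k + k)) (sphere b : set 'rV[R]_(m + m)).
apply: (le_capacity (N := N)).
  (* The isotropy relation has dimension 2k from pairs of points of the Lagrangian plus 2m from the
     Hopf relation. *)
  apply: (@admissible_unit_ball _ _ _ ((k + k) + (m + m))).
  (* A point of [lagr b] is in particular a point of the sphere of radius b. *)
  - have [x xa] := lagr_nonempty k0 a0; have [y [yb _]] := lagr_nonempty m0 b0.
    exists (join_parts (x, y)); have [e1 e2] := join_partsK (x, y).
    by split; rewrite ?e1 ?e2.
  - move=> v [[va _] vb]; rewrite /unit_ball /= -/(sqn v) sqn_parts va vb ar br.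
    by lra.
  - by apply: closed_prodset; [exact: closed_lagr|exact: closed_sphere].
  - move=> v [va vb]; apply: submanifold_at_prodset.
      exact: submanifold_at_lagr.
    exact: submanifold_at_sphere0.
  - by apply: coisotropic_prodset; [exact: coisotropic_lagr|exact: coisotropic_sphere].
  - apply: closed_isotropy_prodset.
      exact: closed_isotropy_lagr.
    by rewrite isoS; exact: closed_hopf.
  - move=> p /isotropy_relation_prodset[]; rewrite isoL isoS => -[/= p1 p2] ph.
    apply: submanifold_at_isotropy_prodset.
      rewrite isoL; apply: submanifold_at_prod; try exact: has_coords_rV;
        exact: submanifold_at_lagr.
    by rewrite isoS; exact: submanifold_at_hopf.
apply: minimal_area_ge; first by rewrite exprn_gt0.
move=> F g [x0 _ ->] gF g2.
have gI t : lagr a (fst_part (g t)) /\ hopf b (snd_part x0, snd_part (g t)).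
  by have /isotropy_relation_prodset[] := gF t; rewrite isoL isoS => -[].
apply: angular_prod.
  by rewrite -ab; apply: angular_lagr => // [t|]; [have [] := gI t|rewrite g2].
by apply: (angular_hopf (w := snd_part x0)) => // [t|]; [have [] := gI t|rewrite g2].
Qed.

End Capacities.

Theorem theorem3 (R : realType) (n : nat) (hn : (2 <= n)%N) :
  ((pi / 2)%:E <= Lag_capacity (unit_ball R n))%E /\
  (forall d : nat, (n + 1 <= d)%N -> (d <= 2 * n - 3)%N ->
    ((pi / 3)%:E <= coiso_capacity d (unit_ball R n))%E).
Proof.
split.
  apply: le_limit; first by rewrite divr_gt0// pi_gt0.
  by move=> r r0 r1; apply: lagr_capacity => //; exact: ltnW.
move=> d nd dn; apply: le_limit; first by rewrite divr_gt0// pi_gt0.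
move=> r r0 r1.
have [k [m [k0 m0 nE dE]]] : exists k m, [/\ (0 < k)%N, (0 < m)%N, n = (k + m)%N &
    d = (k + (m + m).-1)%N].
  (* The solution of n = k + m and d = k + 2m - 1; the bounds on d keep the truncated subtractions
     exact and both values positive. *)
  by exists (2 * n - d - 1)%N, (d + 1 - n)%N; split; lia.
by rewrite nE dE; exact: coisotropic_capacity.
Qed.
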